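(* Let $R$ be a Hausdorff linearly topologized ring and let $M$ be a finitely presented right $R$-module. (i) If $R$ is first countable and satisfies $\mathcal{P}\in\mathscr{P}_{\mathrm{top}}\cap\mathscr{P}_{\mathrm{mor}}$, then $\mathrm{End}(M)/I_2^M$ satisfies $\mathcal{P}$ when $\mathrm{End}(M)$ is endowed with $\tau_2^M$. In particular, if $M$ is Hausdorff, then $\mathrm{End}(M)$ has $\mathcal{P}$. (ii) Assume $R$ is quasi-$\pi_\infty$-regular and let $i\in\{1,2\}$. Then $\mathrm{End}(M)/I_i^M$ is quasi-$\pi_\infty$-regular when $\mathrm{End}(M)$ is endowed with $\tau_i^M$. In particular, if $M$ is Hausdorff, then $\mathrm{End}(M)$ is quasi-$\pi_\infty$-regular with respect to $\tau_1^M$. (iii) If $R$ is semiperfect and quasi-$\pi_\infty$-regular, then $\mathrm{End}(M)$ is semiperfect.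
   Context: All rings are unital. A topological ring is linearly topologized (LT) if it has a basis of neighborhoods of $0$ (a local basis) consisting of two-sided ideals; $\mathcal{I}_R$ is the set of open (two-sided) ideals of $R$. It is first countable if it has a countable local basis. Quotients carry the quotient topology. Topologies on modules and endomorphism rings: a right $R$-module $M$ has the standard topology with basis of neighborhoods $\{x+MJ: J\in\mathcal{I}_R\}$ at $x\in M$; ''$M$ is Hausdorff'' refers to it. For $n\ge1$ let $P_{n-1}\to\cdots\to P_0\to P_{-1}=M\to0$ be an exact sequence with $P_0,\dots,P_{n-1}$ projective right $R$-modules (a projective resolution $P$ of length $n$; the first map need not be injective). For $J\in\mathcal{I}_R$ let $\mathrm{B}(J,P)$ be the set of $f_{-1}\in\mathrm{Hom}_R(M,MJ)$ that extend to a chain map $(f_i)_{-1\le i<n}$, $f_i\in\mathrm{End}(P_i)$, with $\mathrm{im}\, f_i\subseteq P_iJ$ for all $-1\le i<n$. The $\mathrm{B}(J,P)$ are ideals forming a local basis of a ring topology on $\mathrm{End}(M)$ that depends only on $n$, denoted $\tau_n^M$; $I_n^M$ is the closure of the zero ideal in $\tau_n^M$. ($\tau_1^M$ has local basis $\{\mathrm{Hom}_R(M,MJ):J\in\mathcal{I}_R\}$.) Properties: $\mathscr{P}_{\mathrm{disc}}$ is the set of properties: semiprimary; right perfect; left perfect; $\pi_\infty$-regular and semiperfect; $\pi_\infty$-regular; $\pi$-regular and semiperfect; $\pi$-regular. $\mathscr{P}_{\mathrm{top}}$ is the set of properties of LT rings: pro-$\mathcal{Q}$, and pro-$\mathcal{Q}$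 and semiperfect, for $\mathcal{Q}\in\mathscr{P}_{\mathrm{disc}}$; quasi-$\mathcal{Q}$, and quasi-$\mathcal{Q}$ and semiperfect, for $\mathcal{Q}\in\{\pi_\infty\text{-regular},\pi\text{-regular}\}$. $\mathscr{P}_{\mathrm{mor}}$ is the set of properties in $\mathscr{P}_{\mathrm{disc}}\cup\mathscr{P}_{\mathrm{top}}$ preserved under Morita equivalence; for a property in $\mathscr{P}_{\mathrm{top}}$ this means that whenever a Hausdorff LT ring $R$ has it, so do $\mathrm{M}_n(R)$ (with local basis $\{\mathrm{M}_n(I):I\in\mathcal{I}_R\}$) and $eRe$ (induced topology) for every idempotent $e$ such that $eR$ is a progenerator. Definitions: $R$ is semilocal if $R/\mathrm{Jac}(R)$ is semisimple artinian; semiperfect if semilocal and idempotents lift modulo $\mathrm{Jac}(R)$; semiprimary if semilocal with $\mathrm{Jac}(R)$ nilpotent; right (left) perfect if semilocal and for every sequence $x_1,x_2,\dots\in\mathrm{Jac}(R)$ the sequence $x_1,x_2x_1,x_3x_2x_1,\dots$ (resp. $x_1,x_1x_2,x_1x_2x_3,\dots$) eventually vanishes. $R$ is $\pi$-regular if for every $a\in R$ the chain $aR\supseteq a^2R\supseteq\cdots$ stabilizes; $\pi_\infty$-regular if $\mathrm{M}_n(R)$ is $\pi$-regular for all $n$. A topological ring is pro-$\mathcal{Q}$ if it is isomorphic as a topological ring to the inverse limit of an inverse system of discrete rings satisfying $\mathcal{Q}$. A Hausdorff LT ring $R$ is quasi-$\pi$-regular if for every $a\in R$ there is an idempotent $e\in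 R$ such that, with $f:=1-e$: $a=eae+faf$; $eae$ is invertible in $eRe$; and $(faf)^n\to0$ as $n\to\infty$. It is quasi-$\pi_\infty$-regular if $\mathrm{M}_n(R)$ (with the ring topology having local basis $\{\mathrm{M}_n(I):I\in\mathcal{I}_R\}$) is quasi-$\pi$-regular for all $n$. *)

(* Defs.v *)
From HB Require Import structures.
From mathcomp Require Import all_boot all_order all_algebra generic_quotient.
From mathcomp Require Import all_classical.
From mathcomp Require Import topology tvs.

Set Implicit Arguments.
Unset Strict Implicit.
Unset Printing Implicit Defensive.

Import GRing.Theory.
Local Open Scope classical_set_scope.
Local Open Scope ring_scope.

(* Rings may be trivial, hence pzRingType. A right R-module is a left module
   over the converse ring R^c: in M : lmodType R^c, a *: x stands for x a. *)

Section Ideals.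
Variable A : pzRingType.
Implicit Types I J : set A.

Definition is_right_ideal I :=
  [/\ I 0, forall x y, I x -> I y -> I (x + y) & forall x a, I x -> I (x * a)].

Definition is_ideal I :=
  [/\ I 0, forall x y, I x -> I y -> I (x + y),
      forall a x, I x -> I (a * x) & forall x a, I x -> I (x * a)].

Lemma is_idealT : is_ideal setT.
Proof. by []. Qed.

Lemma is_idealI I J : is_ideal I -> is_ideal J -> is_ideal (I `&` J).
Proof.
move=> [I0 ID Il Ir] [J0 JD Jl Jr]; split=> //.
- by move=> x y [? ?] [? ?]; split; [exact: ID|exact: JD].
- by move=> a x [? ?]; split; [exact: Il|exact: Jl].
- by move=> x a [? ?]; split; [exact: Ir|exact: Jr].
Qed.

Lemma is_idealN I x : is_ideal I -> I x -> I (- x).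
Proof. by move=> [_ _ Il _] Ix; rewrite -mulN1r; exact: Il. Qed.

Record ideal := Ideal { ideal_set :> set A; idealP : is_ideal ideal_set }.

Record ideal_base := IdealBase {
  base_set :> set (set A);
  base_ideal : forall J, base_set J -> is_ideal J;
  base_neq0 : base_set !=set0;
  base_directed : forall I J, base_set I -> base_set J ->
    exists2 K, base_set K & K `<=` I `&` J }.

End Ideals.

(* The linear topology defined by a family B of subgroups. *)
Definition linear_open (A : zmodType) (B : set (set A)) (U : set A) :=
  forall x, U x -> exists2 J, B J & forall j, J j -> U (x + j).

Section LinearOpen.
Variables (A : zmodType) (B : set (set A)).
Hypothesis B_neq0 : B !=set0.
Hypothesis B_dir : forall I J, B I -> B J -> exists2 K, B K & K `<=` I `&` J.

Lemma linear_openT : linear_open B setT.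
Proof. by move=> x _; have [J BJ] := B_neq0; exists J. Qed.

Lemma linear_openI : setI_closed (linear_open B).
Proof.
move=> U V oU oV x [Ux Vx].
have [I BI IU] := oU x Ux; have [J BJ JV] := oV x Vx.
have [K BK KIJ] := B_dir BI BJ; exists K => // k /KIJ[? ?].
by split; [exact: IU|exact: JV].
Qed.

Lemma linear_open_bigU (I : Type) (f : I -> set A) :
  (forall i, linear_open B (f i)) -> linear_open B (\bigcup_i f i).
Proof.
move=> of_ x [i _ fix_]; have [J BJ Jf] := of_ i x fix_.
by exists J => // j Jj; exists i => //; exact: Jf.
Qed.

End LinearOpen.

HB.mixin Record isLT R of TopologicalZmodule R & GRing.PzRing R := {
  mul_continuous : continuous (fun x : R * R => x.1 * x.2);
  lt_basis : forall U : set R, nbhs (0 : R) U ->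
    exists J : set R, [/\ is_ideal J, nbhs (0 : R) J & J `<=` U] }.

#[short(type="ltRingType")]
HB.structure Definition LTRing :=
  {R of TopologicalZmodule R & GRing.PzRing R & isLT R}.

HB.factory Record isLinearlyTopologized A of Topological A & GRing.PzRing A := {
  lt_base : ideal_base A;
  lt_openE : forall U : set A, open U <-> linear_open lt_base U }.

HB.builders Context A of isLinearlyTopologized A.

Lemma nbhs_ltE (x : A) (U : set A) :
  nbhs x U <-> exists2 J, base_set lt_base J & forall j, J j -> U (x + j).
Proof.
split=> [|[J BJ JU]]; rewrite nbhsE.
  move=> [V [/lt_openE oV Vx] VU]; have [J BJ JV] := oV x Vx.
  by exists J => // j /JV/VU.
have [J0 JD _ _] := base_ideal BJ.
exists [set x + j | j in J]; last by move=> _ [j Jj <-]; exact: JU.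
split; last by exists 0 => //; rewrite addr0.
apply/lt_openE => _ [j Jj <-]; exists J => // k Jk.
by exists (j + k); [exact: JD|rewrite addrA].
Qed.

Lemma lt_sub_continuous : continuous (fun x : A * A => x.1 - x.2).
Proof.
move=> [x y] U /nbhs_ltE[J BJ JU]; have [J0 JD Jl Jr] := base_ideal BJ.
exists ([set x + j | j in J], [set y + j | j in J]).
  by split; apply/nbhs_ltE; exists J => // j Jj; exists j.
move=> [_ _] /= [[j Jj <-] [k Jk <-]].
have -> : x + j - (y + k) = x - y + (j - k) by rewrite opprD addrACA.
by apply: JU; apply: JD => //; exact: is_idealN (base_ideal BJ) Jk.
Qed.

HB.instance Definition _ :=
  PreTopologicalNmodule_isTopologicalZmodule.Build A lt_sub_continuous.

Lemma lt_mul_continuous : continuous (fun x : A * A => x.1 * x.2).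
Proof.
move=> [x y] U /nbhs_ltE[J BJ JU]; have [J0 JD Jl Jr] := base_ideal BJ.
exists ([set x + j | j in J], [set y + j | j in J]).
  by split; apply/nbhs_ltE; exists J => // j Jj; exists j.
move=> [_ _] /= [[j Jj <-] [k Jk <-]].
rewrite mulrDl !mulrDr -addrA; apply: JU.
by apply: (JD); [exact: Jl|apply: (JD); [exact: Jr|exact: Jl]].
Qed.

Lemma lt_basis_subproof (U : set A) : nbhs (0 : A) U ->
  exists J : set A, [/\ is_ideal J, nbhs (0 : A) J & J `<=` U].
Proof.
move=> /nbhs_ltE[J BJ JU]; exists J; split; first exact: base_ideal BJ.
  by apply/nbhs_ltE; exists J => // j; rewrite add0r.
by move=> j /JU; rewrite add0r.
Qed.

HB.instance Definition _ := isLT.Build A lt_mul_continuous lt_basis_subproof.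

HB.end.

Definition lt_top (A : pzRingType) (B : ideal_base A) : Type := A.

Section LtTop.
Variables (A : pzRingType) (B : ideal_base A).
HB.instance Definition _ := GRing.PzRing.on (lt_top B).
HB.instance Definition _ := isOpenTopological.Build (lt_top B)
  (linear_openT (base_neq0 B)) (linear_openI (@base_directed _ B))
  (@linear_open_bigU _ B).

Let openE (U : set (lt_top B)) : open U <-> linear_open B U.
Proof. by []. Qed.

Let B' : ideal_base (lt_top B) := @IdealBase (lt_top B) B (@base_ideal _ B)
  (base_neq0 B) (@base_directed _ B).

HB.instance Definition _ := @isLinearlyTopologized.Build (lt_top B) B' openE.
End LtTop.

Section Quotient.
Local Open Scope quotient_scope.
Variables (A : pzRingType) (I : ideal A).

Definition ideal_rel : rel A := fun x y => `[< ideal_set I (x - y) >].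

Lemma ideal_rel_refl : reflexive ideal_rel.
Proof. by move=> x; apply/asboolP; rewrite subrr; have [] := idealP I. Qed.

Lemma ideal_rel_sym : symmetric ideal_rel.
Proof.
have sub x y : ideal_rel x y -> ideal_rel y x.
  move=> /asboolP Ixy; apply/asboolP; rewrite -opprB.
  exact: is_idealN (idealP I) Ixy.
by move=> x y; apply/idP/idP; exact: sub.
Qed.

Lemma ideal_rel_trans : transitive ideal_rel.
Proof.
move=> y x z /asboolP Ixy /asboolP Iyz; apply/asboolP.
by rewrite -(subrKA y); have [_ ID _ _] := idealP I; exact: ID.
Qed.

Definition ideal_equiv :=
  EquivRel ideal_rel ideal_rel_refl ideal_rel_sym ideal_rel_trans.

Definition quot_ring : Type := {eq_quot ideal_equiv}.
HB.instance Definition _ : EqQuotient A ideal_equiv quot_ring :=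
  EqQuotient.on quot_ring.
HB.instance Definition _ := Choice.on quot_ring.

Local Notation Q := quot_ring.

Lemma quot_eqP (x y : A) :
  \pi_Q x = \pi_Q y <-> ideal_set I (x - y).
Proof. by split=> [/eqquotP/asboolP|Ixy]//; apply/eqquotP/asboolP. Qed.

Lemma repr_quot (x : A) : ideal_set I (repr (\pi_Q x) - x).
Proof. by apply/quot_eqP; rewrite reprK. Qed.

Definition quot_add (x y : Q) : Q := \pi_Q (repr x + repr y).
Definition quot_opp (x : Q) : Q := \pi_Q (- repr x).
Definition quot_mul (x y : Q) : Q := \pi_Q (repr x * repr y).

Lemma pi_quot_add (x y : A) : quot_add (\pi_Q x) (\pi_Q y) = \pi_Q (x + y).
Proof.
apply/quot_eqP; rewrite opprD addrACA; have [_ ID _ _] := idealP I.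
by apply: ID; exact: repr_quot.
Qed.

Lemma pi_quot_opp (x : A) : quot_opp (\pi_Q x) = \pi_Q (- x).
Proof.
apply/quot_eqP; rewrite -opprD; apply: (is_idealN (idealP I)).
exact: repr_quot.
Qed.

Lemma pi_quot_mul (x y : A) : quot_mul (\pi_Q x) (\pi_Q y) = \pi_Q (x * y).
Proof.
apply/quot_eqP; have [_ ID Il Ir] := idealP I.
rewrite -(subrKA (x * repr (\pi_Q y))) -mulrBl -mulrBr.
by apply: ID; [apply: Ir|apply: Il]; exact: repr_quot.
Qed.

Let quotW (P : Q -> Prop) : (forall x, P (\pi_Q x)) -> forall x, P x.
Proof. by move=> PP x; rewrite -[x]reprK; exact: PP. Qed.

Let addA : associative quot_add.
Proof.
by elim/quotW=> x; elim/quotW=> y; elim/quotW=> z; rewrite !pi_quot_add addrA.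
Qed.
Let addC : commutative quot_add.
Proof. by elim/quotW=> x; elim/quotW=> y; rewrite !pi_quot_add addrC. Qed.
Let add0 : left_id (\pi_Q 0) quot_add.
Proof. by elim/quotW=> x; rewrite !pi_quot_add add0r. Qed.
Let addN : left_inverse (\pi_Q 0) quot_opp quot_add.
Proof. by elim/quotW=> x; rewrite !pi_quot_opp !pi_quot_add addNr. Qed.
Let mulA : associative quot_mul.
Proof.
by elim/quotW=> x; elim/quotW=> y; elim/quotW=> z; rewrite !pi_quot_mul mulrA.
Qed.
Let mul1 : left_id (\pi_Q 1) quot_mul.
Proof. by elim/quotW=> x; rewrite !pi_quot_mul mul1r. Qed.
Let mul_1 : right_id (\pi_Q 1) quot_mul.
Proof. by elim/quotW=> x; rewrite !pi_quot_mul mulr1. Qed.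
Let mulDl : left_distributive quot_mul quot_add.
Proof.
elim/quotW=> x; elim/quotW=> y; elim/quotW=> z.
by rewrite !(pi_quot_mul, pi_quot_add) mulrDl.
Qed.
Let mulDr : right_distributive quot_mul quot_add.
Proof.
elim/quotW=> x; elim/quotW=> y; elim/quotW=> z.
by rewrite !(pi_quot_mul, pi_quot_add) mulrDr.
Qed.

HB.instance Definition _ := GRing.isPzRing.Build Q
  addA addC add0 addN mulA mul1 mul_1 mulDl mulDr.

Lemma quot_piD (x y : A) : \pi_Q (x + y) = \pi_Q x + \pi_Q y.
Proof. by rewrite -pi_quot_add. Qed.

Lemma quot_piM (x y : A) : \pi_Q (x * y) = \pi_Q x * \pi_Q y.
Proof. by rewrite -pi_quot_mul. Qed.

End Quotient.

Section DiscreteProperties.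
Variable A : pzRingType.

Definition is_maximal_right_ideal (m : set A) :=
  [/\ is_right_ideal m, ~ m 1 &
    forall n, is_right_ideal n -> m `<=` n -> ~ n 1 -> n = m].

Definition Jac : set A := \bigcap_(m in is_maximal_right_ideal) m.

Lemma is_ideal_Jac : is_ideal Jac.
Proof.
split.
- by move=> m [[m0 _ _] _ _].
- by move=> x y Jx Jy m mm; case: (mm) => [[_ mD _] _ _];
    apply: mD; [exact: Jx|exact: Jy].
- move=> a x Jx m mm; case: (mm) => [[m0 mD mr] m1 mmax].
  have [ma|nma] := pselect (m a); first exact: mr.
  apply: (Jx [set y | m (a * y)]); split=> /=.
  + split=> /= [|y z my mz|y b my]; first by rewrite mulr0.
      by rewrite mulrDr; exact: mD.
    by rewrite mulrA; exact: mr.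
  + by rewrite mulr1.
  + move=> n [n0 nD nr] mn n1; apply/seteqP; split=> // y ny.
    rewrite /=; have [//|nmay] := pselect (m (a * y)); exfalso.
    (* m + a y A is a right ideal, hence contains 1 *)
    pose m' := [set z | exists2 b, m b & exists c, z = b + a * y * c].
    have m'1 : m' 1.
      apply: contrapT => m'1.
      have m'E : m' = m.
        apply: mmax m'1 => [|z mz]; last first.
          by exists z => //; exists 0; rewrite mulr0 addr0.
        split.
        - by exists 0 => //; exists 0; rewrite mulr0 addr0.
        - move=> _ _ [b mb [c ->]] [b' mb' [c' ->]].
          exists (b + b'); first exact: mD.
          by exists (c + c'); rewrite mulrDr addrACA.
        - move=> _ d [b mb [c ->]]; exists (b * d); first exact: mr.
          by exists (c * d); rewrite mulrDl mulrA.
      apply: nmay; rewrite -m'E; exists 0 => //; exists 1.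
      by rewrite mulr1 add0r.
    case: m'1 => b mb [c bc].
    apply: n1; rewrite -(subrK (y * (c * a)) 1).
    apply: nD; last exact: nr.
    apply: mn => /=; rewrite mulrBr mulr1 !mulrA.
    have -> : a - a * y * c * a = b * a.
      by rewrite -{1}[a]mul1r bc mulrDl addrK.
    exact: mr.
- move=> x a Jx m mm; case: (mm) => [[m0 mD mr] _ _].
  by apply: mr; exact: Jx.
Qed.

Definition Jac_ideal : ideal A := Ideal is_ideal_Jac.

End DiscreteProperties.

Section DiscreteProperties.
Variable A : pzRingType.

(* Every right ideal is a direct summand of the right module A_A. *)
Definition semisimple_artinian := forall I : set A, is_right_ideal I ->
  exists I' : set A, [/\ is_right_ideal I',
    forall a, exists x y, [/\ I x, I' y & a = x + y] &
    forall x, I x -> I' x -> x = 0].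

Definition principal_right_ideal (a : A) : set A := [set a * r | r in setT].

Definition pi_regular := forall a : A, exists n, forall m, (n <= m)%N ->
  principal_right_ideal (a ^+ m) = principal_right_ideal (a ^+ n).

Definition right_T_nilpotent (J : set A) := forall x : nat -> A,
  (forall i, J (x i)) -> exists N, forall n, (N <= n)%N ->
  \prod_(i < n) x (n - i.+1)%N = 0.

Definition left_T_nilpotent (J : set A) := forall x : nat -> A,
  (forall i, J (x i)) -> exists N, forall n, (N <= n)%N ->
  \prod_(i < n) x i = 0.

(* The ideal power J ^ n is spanned by the products of n elements of J. *)
Definition nilpotent_ideal (J : set A) := exists n, forall x : 'I_n -> A,
  (forall i, J (x i)) -> \prod_(i < n) x i = 0.

Definition idempotents_lift (J : set A) := forall a : A, J (a * a - a) ->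
  exists e : A, e * e = e /\ J (e - a).

End DiscreteProperties.

Definition semilocal (A : pzRingType) :=
  semisimple_artinian (quot_ring (Jac_ideal A)).

Definition semiperfect (A : pzRingType) :=
  semilocal A /\ idempotents_lift (@Jac A).

Definition semiprimary (A : pzRingType) :=
  semilocal A /\ nilpotent_ideal (@Jac A).

Definition right_perfect (A : pzRingType) :=
  semilocal A /\ right_T_nilpotent (@Jac A).

Definition left_perfect (A : pzRingType) :=
  semilocal A /\ left_T_nilpotent (@Jac A).

Definition pi_infty_regular (A : pzRingType) :=
  forall n, pi_regular 'M[A]_n.+1.

Inductive P_disc : (pzRingType -> Prop) -> Prop :=
| disc_semiprimary : P_disc semiprimary
| disc_right_perfect : P_disc right_perfect
| disc_left_perfect : P_disc left_perfect
| disc_pi_infty_regular_semiperfect :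
    P_disc (fun A => pi_infty_regular A /\ semiperfect A)
| disc_pi_infty_regular : P_disc pi_infty_regular
| disc_pi_regular_semiperfect :
    P_disc (fun A => pi_regular A /\ semiperfect A)
| disc_pi_regular : P_disc pi_regular.

Section LTRings.
Variable R : ltRingType.

Definition open_ideal : set (set R) := [set J | is_ideal J /\ open J].

Lemma open_idealT : open_ideal setT.
Proof. by split; [exact: is_idealT|exact: openT]. Qed.

Lemma open_idealI I J : open_ideal I -> open_ideal J -> open_ideal (I `&` J).
Proof.
by move=> [iI oI] [iJ oJ]; split; [exact: is_idealI|exact: openI].
Qed.

Lemma nbhs_addl (x y : R) (U : set R) :
  nbhs (x + y) U -> nbhs y [set z | U (x + z)].
Proof.
move=> nU; have cx : {for y, continuous (fun z : R => x + z)}.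
  apply: (@continuous_comp R (R * R)%type R (fun z => (x, z))
    (fun z => z.1 + z.2)); last exact: add_continuous.
  by apply: cvg_pair => //=; exact: cvg_cst.
exact: cx nU.
Qed.

Lemma nbhs_ideal_open (J : set R) : is_ideal J -> nbhs 0 J -> open J.
Proof.
move=> iJ nJ; rewrite openE => x Jx.
have /nbhs_addl : nbhs (- x + x) J by rewrite addNr.
apply: filterS => z /= Jz; rewrite -(addKr (- x) z) opprK.
by have [_ JD _ _] := iJ; exact: JD.
Qed.

Lemma nbhs0_ltP (U : set R) :
  nbhs 0 U <-> exists2 J, open_ideal J & J `<=` U.
Proof.
split=> [/lt_basis[J [iJ nJ JU]]|[J [iJ oJ] JU]].
  by exists J => //; split=> //; exact: nbhs_ideal_open.
apply: (filterS JU); apply: open_nbhs_nbhs; split=> //.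
by case: iJ.
Qed.

Lemma lt_openP (U : set R) : open U <-> linear_open open_ideal U.
Proof.
split=> [+ x Ux|oU].
  rewrite openE => /(_ x Ux); rewrite /interior /= -[x in nbhs x _]addr0.
  by move=> /nbhs_addl/nbhs0_ltP[J oJ JU]; exists J.
rewrite openE => x /oU[J oJ JU].
have /nbhs_addl : nbhs (- x + x) J by rewrite addNr; apply/nbhs0_ltP; exists J.
by apply: filterS => z /= /JU; rewrite addrA subrr add0r.
Qed.

Definition first_countable := exists U : nat -> set R,
  (forall n, nbhs (0 : R) (U n)) /\
  forall V, nbhs (0 : R) V -> exists n, U n `<=` V.

Definition closure0 : set R := closure [set 0].

Lemma closure0P x : closure0 x <-> forall J, open_ideal J -> J x.
Proof.
split=> [cx J oJ|xJ U].
  have /cx[_ [-> /=]] : nbhs x [set z | J (x - z)]; last by rewrite subr0.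
  have : nbhs (- x + x) J by rewrite addNr; apply/nbhs0_ltP; exists J.
  move=> /nbhs_addl; apply: filterS => z /= Jz.
  by rewrite -opprB; apply: is_idealN; [case: oJ|rewrite addrC].
rewrite -[x]addr0 => /nbhs_addl/nbhs0_ltP[J oJ JU].
exists 0; split=> //; rewrite -(subrr x); apply: JU.
by apply: is_idealN; [case: oJ|exact: xJ].
Qed.

Lemma is_ideal_closure0 : is_ideal closure0.
Proof.
split.
- by apply/closure0P => J [[]].
- move=> x y /closure0P cx /closure0P cy; apply/closure0P => J oJ.
  by have [[_ JD _ _] _] := oJ; apply: JD; [exact: cx|exact: cy].
- move=> a x /closure0P cx; apply/closure0P => J oJ.
  by have [[_ _ Jl _] _] := oJ; apply: Jl; exact: cx.
- move=> x a /closure0P cx; apply/closure0P => J oJ.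
  by have [[_ _ _ Jr] _] := oJ; apply: Jr; exact: cx.
Qed.

Definition closure0_ideal : ideal R := Ideal is_ideal_closure0.

End LTRings.

Definition lt_quot (R : ltRingType) (I : ideal R) : Type := quot_ring I.

Section LtQuot.
Local Open Scope quotient_scope.
Variables (R : ltRingType) (I : ideal R).
Local Notation Q := (lt_quot I).
Local Notation pi := (\pi_(quot_ring I) : R -> Q).

HB.instance Definition _ := GRing.PzRing.on Q.

Definition lt_quot_open (U : set Q) := open (pi @^-1` U).

Lemma lt_quot_openT : lt_quot_open setT.
Proof. exact: openT. Qed.

Lemma lt_quot_openI : setI_closed lt_quot_open.
Proof. by move=> U V; exact: openI. Qed.

Lemma lt_quot_open_bigU (K : Type) (f : K -> set Q) :
  (forall i, lt_quot_open (f i)) -> lt_quot_open (\bigcup_i f i).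
Proof. by move=> of_; apply: bigcup_open => i _; exact: of_. Qed.

HB.instance Definition _ := isOpenTopological.Build Q
  lt_quot_openT lt_quot_openI lt_quot_open_bigU.

Let pi_repr (x : Q) : pi (repr (x : quot_ring I)) = x.
Proof. exact: reprK. Qed.
Let piD (x y : R) : pi (x + y) = pi x + pi y.
Proof. exact: quot_piD. Qed.
Let piM (x y : R) : pi (x * y) = pi x * pi y.
Proof. exact: quot_piM. Qed.
Let pi0 : pi 0 = 0. Proof. by []. Qed.

Definition lt_quot_base_set : set (set Q) :=
  [set [set pi x | x in J] | J in @open_ideal R].

Lemma lt_quot_base_ideal K : lt_quot_base_set K -> is_ideal K.
Proof.
move=> [J [[J0 JD Jl Jr] _] <-]; split.
- by exists 0.
- move=> _ _ [x Jx <-] [y Jy <-]; exists (x + y); last exact: piD.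
  exact: JD.
- move=> a _ [x Jx <-]; exists (repr (a : quot_ring I) * x); first exact: Jl.
  by rewrite piM pi_repr.
- move=> _ a [x Jx <-]; exists (x * repr (a : quot_ring I)); first exact: Jr.
  by rewrite piM pi_repr.
Qed.

Lemma lt_quot_base_neq0 : lt_quot_base_set !=set0.
Proof. by exists [set pi x | x in setT], setT => //; exact: open_idealT. Qed.

Lemma lt_quot_base_directed K L : lt_quot_base_set K -> lt_quot_base_set L ->
  exists2 M, lt_quot_base_set M & M `<=` K `&` L.
Proof.
move=> [J oJ <-] [J' oJ' <-]; exists [set pi x | x in J `&` J'].
  by exists (J `&` J') => //; exact: open_idealI.
by move=> _ [x [Jx J'x] <-]; split; exists x.
Qed.

Definition lt_quot_base : ideal_base Q :=
  IdealBase lt_quot_base_ideal lt_quot_base_neq0 lt_quot_base_directed.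

Lemma lt_quot_openE (U : set Q) : open U <-> linear_open lt_quot_base U.
Proof.
have -> : open U = open (pi @^-1` U) by [].
rewrite lt_openP; split=> oU x Ux.
  have : (pi @^-1` U) (repr (x : quot_ring I)) by rewrite /= pi_repr.
  move=> /oU[J oJ JU]; exists [set pi x | x in J]; first by exists J.
  by move=> _ [y Jy <-]; have /= := JU y Jy; rewrite piD pi_repr.
have [_ [J oJ <-] JU] := oU (pi x) Ux; exists J => // j Jj.
by rewrite /= piD; apply: JU; exists j.
Qed.

HB.instance Definition _ := isLinearlyTopologized.Build Q lt_quot_openE.
End LtQuot.

Section LtMatrix.
Variables (R : ltRingType) (n : nat).

Definition matrix_base_set : set (set 'M[R]_n) :=
  [set [set a : 'M[R]_n | forall i j, J (a i j)] | J in @open_ideal R].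

Lemma matrix_base_ideal K : matrix_base_set K -> is_ideal K.
Proof.
move=> [J [[J0 JD Jl Jr] _] <-].
have Jsum (F : 'I_n -> R) : (forall k, J (F k)) -> J (\sum_k F k).
  by move=> JF; elim/big_ind: _.
split=> /=.
- by move=> i j; rewrite mxE.
- by move=> a b Ja Jb i j; rewrite mxE; exact: JD.
- by move=> a b Jb i j; rewrite mxE; apply: Jsum => k; exact: Jl.
- by move=> a b Ja i j; rewrite mxE; apply: Jsum => k; exact: Jr.
Qed.

Lemma matrix_base_neq0 : matrix_base_set !=set0.
Proof. by eexists; exists setT; first exact: open_idealT. Qed.

Lemma matrix_base_directed K L : matrix_base_set K -> matrix_base_set L ->
  exists2 M, matrix_base_set M & M `<=` K `&` L.
Proof.
move=> [J oJ <-] [J' oJ' <-]; eexists.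
  by exists (J `&` J'); first exact: open_idealI.
by move=> a /= Ja; split=> i j; have [] := Ja i j.
Qed.

Definition matrix_base : ideal_base 'M[R]_n :=
  IdealBase matrix_base_ideal matrix_base_neq0 matrix_base_directed.

Definition lt_matrix : ltRingType := lt_top matrix_base.
End LtMatrix.

Record idempotent (A : pzRingType) :=
  Idempotent { idem_val :> A; idem_mul : idem_val * idem_val = idem_val }.

Section Corner.
Variables (A : pzRingType) (e : idempotent A).

Definition in_corner : pred A := fun x => idem_val e * x * idem_val e == x.

Lemma in_corner_zmod : zmod_closed in_corner.
Proof.
split; first by rewrite unfold_in /in_corner mulr0 mul0r.
move=> x y; rewrite !unfold_in /in_corner => /eqP ex /eqP ey.
by rewrite mulrBr mulrBl ex ey.
Qed.

HB.instance Definition _ := GRing.isZmodClosed.Build A in_corner in_corner_zmod.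

Record corner := Corner { corner_val :> A; cornerP : corner_val \in in_corner }.
HB.instance Definition _ := [isSub for corner_val].
HB.instance Definition _ := [Choice of corner by <:].
HB.instance Definition _ := [SubChoice_isSubZmodule of corner by <:].

Lemma corner_idl (x : corner) : idem_val e * corner_val x = corner_val x.
Proof.
by have /eqP <- := cornerP x; rewrite !mulrA idem_mul.
Qed.

Lemma corner_idr (x : corner) : corner_val x * idem_val e = corner_val x.
Proof.
by have /eqP <- := cornerP x; rewrite -!mulrA idem_mul.
Qed.

Let one_subproof : idem_val e \in in_corner.
Proof. by rewrite unfold_in /in_corner !idem_mul. Qed.

Let mul_subproof (x y : corner) : corner_val x * corner_val y \in in_corner.
Proof. by rewrite unfold_in /in_corner mulrA corner_idl -mulrA corner_idr. Qed.

Definition corner_one := Corner one_subproof.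
Definition corner_mul (x y : corner) := Corner (mul_subproof x y).

Let mulA : associative corner_mul.
Proof. by move=> x y z; apply: val_inj; rewrite /= mulrA. Qed.
Let mul1 : left_id corner_one corner_mul.
Proof. by move=> x; apply: val_inj; exact: corner_idl. Qed.
Let mul_1 : right_id corner_one corner_mul.
Proof. by move=> x; apply: val_inj; exact: corner_idr. Qed.
Let mulDl : left_distributive corner_mul +%R.
Proof. by move=> x y z; apply: val_inj; rewrite /= mulrDl. Qed.
Let mulDr : right_distributive corner_mul +%R.
Proof. by move=> x y z; apply: val_inj; rewrite /= mulrDr. Qed.

HB.instance Definition _ := GRing.Zmodule_isPzRing.Build corner
  mulA mul1 mul_1 mulDl mulDr.
End Corner.

Definition lt_corner (R : ltRingType) (e : idempotent R) : Type := corner e.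

Section LtCorner.
Variables (R : ltRingType) (e : idempotent R).
Local Notation C := (lt_corner e).
HB.instance Definition _ := GRing.PzRing.on C.
HB.instance Definition _ :=
  Topological.copy C (initial_topology (@corner_val R e)).

Definition corner_base_set : set (set C) :=
  [set [set x : C | J (corner_val x)] | J in @open_ideal R].

Lemma corner_base_ideal K : corner_base_set K -> is_ideal K.
Proof.
move=> [J [[J0 JD Jl Jr] _] <-]; split=> //=.
- by move=> x y; exact: JD.
- by move=> a x; exact: Jl.
- by move=> x a; exact: Jr.
Qed.

Lemma corner_base_neq0 : corner_base_set !=set0.
Proof. by eexists; exists setT; first exact: open_idealT. Qed.

Lemma corner_base_directed K L : corner_base_set K -> corner_base_set L ->
  exists2 M, corner_base_set M & M `<=` K `&` L.
Proof.
move=> [J oJ <-] [J' oJ' <-]; eexists.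
  by exists (J `&` J'); first exact: open_idealI.
by [].
Qed.

Definition corner_base : ideal_base C :=
  IdealBase corner_base_ideal corner_base_neq0 corner_base_directed.

Lemma corner_openE (U : set C) : open U <-> linear_open corner_base U.
Proof.
split=> [[V oV <-] x Vx|oU].
  have /lt_openP/(_ _ Vx)[J oJ JV] := oV.
  by exists [set x : C | J (corner_val x)]; [exists J|move=> j /JV].
exists (\bigcup_(V in [set V : set R | open V /\
  (@corner_val R e) @^-1` V `<=` U]) V).
  by apply: bigcup_open => V [].
apply/seteqP; split=> [x [V [_ VU] Vx]|x /oU[_ [J oJ <-] JU]]; first exact: VU.
have [[J0 JD Jl Jr] _] := oJ.
exists [set y | J (y - corner_val x)]; last by rewrite /= subrr.
split.
  apply/lt_openP => y /= Jyx; exists J => // j Jj.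
  by rewrite /= addrAC; exact: JD.
by move=> y /= /(JU (y - x)); rewrite addrC subrK.
Qed.

HB.instance Definition _ := isLinearlyTopologized.Build C corner_openE.
End LtCorner.

Section Modules.
Variable S : pzRingType.

Record submodule (V : lmodType S) := Submodule {
  subm_set :> set V;
  subm0 : subm_set 0;
  submD : forall x y, subm_set x -> subm_set y -> subm_set (x + y);
  submZ : forall a x, subm_set x -> subm_set (a *: x) }.

Definition in_subm (V : lmodType S) (W : submodule V) : pred V :=
  fun x => `[< subm_set W x >].

Record subm_type (V : lmodType S) (W : submodule V) :=
  SubmType { subm_val : V; subm_valP : in_subm W subm_val }.

Section SubmType.
Variables (V : lmodType S) (W : submodule V).

Lemma in_subm_closed : submod_closed (in_subm W).
Proof.
split; first by apply/asboolP; exact: subm0.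
move=> a x y /asboolP Wx /asboolP Wy; apply/asboolP.
by apply: submD => //; exact: submZ.
Qed.

HB.instance Definition _ := [isSub for @subm_val V W].
HB.instance Definition _ := [Choice of subm_type W by <:].
HB.instance Definition _ := GRing.SubChoice_isSubLmodule.Build S V (in_subm W)
  (subm_type W) in_subm_closed.
End SubmType.

Definition finitely_generated (M : lmodType S) := exists n (x : 'I_n -> M),
  forall m, exists a : 'I_n -> S, m = \sum_i a i *: x i.

Definition projective (P : lmodType S) :=
  forall (B C : lmodType S) (g : {linear B -> C}) (f : {linear P -> C}),
  (forall c, exists b, g b = c) ->
  exists h : {linear P -> B}, forall x, g (h x) = f x.

(* The functor Hom(M, -) is faithful. *)
Definition generator (M : lmodType S) :=
  forall (B C : lmodType S) (g : {linear B -> C}),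
  (exists b, g b != 0) -> exists f : {linear M -> B}, exists x, g (f x) != 0.

Definition progenerator (M : lmodType S) :=
  [/\ finitely_generated M, projective M & generator M].

Definition finitely_presented (M : lmodType S) := exists (m n : nat)
  (d : {linear 'rV[S]_m -> 'rV[S]_n}) (eps : {linear 'rV[S]_n -> M}),
  (forall x, exists y, eps y = x) /\ range d = [set y | eps y = 0].

Section Lift.
Variables (P B C : lmodType S) (g : {linear B -> C}) (f : {linear P -> C}).

Definition linear_range : submodule C.
Proof.
exists (range g).
- by exists 0 => //; rewrite linear0.
- by move=> _ _ [x _ <-] [y _ <-]; exists (x + y) => //; rewrite linearD.
- by move=> a _ [x _ <-]; exists (a *: x) => //; rewrite linearZ.
Defined.

Section Corestrict.
Variables (D : lmodType S) (h : {linear D -> C}).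
Hypothesis hg : range h `<=` range g.

Let corestrict_subproof x : in_subm linear_range (h x).
Proof. by apply/asboolP; apply: hg; exists x. Qed.

Definition corestrict x : subm_type linear_range :=
  SubmType (corestrict_subproof x).

Let corestrict_linear : linear corestrict.
Proof. by move=> a x y; apply: val_inj; rewrite /= linearP. Qed.

HB.instance Definition _ := GRing.isLinear.Build S D (subm_type linear_range)
  _ corestrict corestrict_linear.
End Corestrict.

Lemma projective_lift : projective P -> range f `<=` range g ->
  exists h : {linear P -> B}, forall x, g (h x) = f x.
Proof.
move=> prP fg.
have [[c cP]|h GhF] := prP _ _ (corestrict (@subset_refl _ (range g)))
  (corestrict fg).
  have /asboolP[b _ gb] := cP; exists b; exact/val_inj.
by exists h => x; have /(congr1 val) := GhF x.
Qed.
End Lift.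

End Modules.

Section Endomorphisms.
Variables (S : pzRingType) (M : lmodType S).

(* Endomorphisms act on the left and multiply by composition. *)
Definition endo : Type := {linear M -> M}.
HB.instance Definition _ := gen_eqMixin endo.
HB.instance Definition _ := gen_choiceMixin endo.

Definition endo_fun (f : endo) : {linear M -> M} := f.
Coercion endo_fun : endo >-> GRing.Linear.type.

Lemma endoP (f g : endo) : (forall x, f x = g x) -> f = g.
Proof.
case: f g => [f [[fA] [fZ]]] [g [[gA] [gZ]]] /= /funext fg.
by case: _ / fg in gA gZ *; congr GRing.Linear.Pack; congr GRing.Linear.Class;
  congr (_ _); exact: Prop_irrelevance.
Qed.

Local Notation L := {linear M -> M}.
Let mul (f g : L) : L := f \o g.
Let add (f g : L) : L := f \+ g.
Let opp (f : L) : L := \- f.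
Let zero : L := \0.
Let one : L := idfun.

Let addA : @associative endo add.
Proof. by move=> f g h; apply/endoP => x /=; rewrite addrA. Qed.
Let addC : @commutative endo endo add.
Proof. by move=> f g; apply/endoP => x /=; rewrite addrC. Qed.
Let add0 : @left_id endo endo zero add.
Proof. by move=> f; apply/endoP => x /=; rewrite add0r. Qed.
Let addN : @left_inverse endo endo endo zero opp add.
Proof. by move=> f; apply/endoP => x /=; rewrite addNr. Qed.
Let mulA : @associative endo mul.
Proof. by move=> f g h; apply/endoP. Qed.
Let mul1 : @left_id endo endo one mul.
Proof. by move=> f; apply/endoP. Qed.
Let mul_1 : @right_id endo endo one mul.
Proof. by move=> f; apply/endoP. Qed.
Let mulDl : @left_distributive endo endo mul add.
Proof. by move=> f g h; apply/endoP. Qed.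
Let mulDr : @right_distributive endo endo mul add.
Proof. by move=> f g h; apply/endoP => x /=; rewrite linearD. Qed.

HB.instance Definition _ := GRing.isPzRing.Build endo
  addA addC add0 addN mulA mul1 mul_1 mulDl mulDr.
End Endomorphisms.

Section MulIdeal.
Variable R : pzRingType.

(* M J, the subgroup generated by the products x a with x in M and a in J. *)
Definition mul_ideal (M : lmodType R^c) (J : set R) : set M :=
  [set x | exists k (m : 'I_k -> M) (a : 'I_k -> R),
    (forall i, J (a i)) /\ x = \sum_i (a i : R^c) *: m i].

Arguments mul_ideal : clear implicits.

Lemma mul_ideal0 (M : lmodType R^c) (J : set R) : mul_ideal M J 0.
Proof. by exists 0%N, (fun=> 0), (fun=> 0); split; [case|rewrite big_ord0]. Qed.

Lemma mul_idealD (M : lmodType R^c) (J : set R) (x y : M) :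
  mul_ideal M J x -> mul_ideal M J y -> mul_ideal M J (x + y).
Proof.
move=> [k [m [a [Ja ->]]]] [k' [m' [a' [Ja' ->]]]].
exists (k + k')%N,
  (fun i => match fintype.split i with inl j => m j | inr j => m' j end),
  (fun i => match fintype.split i with inl j => a j | inr j => a' j end).
split=> [i|]; first by case: (fintype.split i).
rewrite big_split_ord /=; congr (_ + _); apply: eq_bigr => i _.
  by rewrite (unsplitK (inl i : 'I_k + 'I_k')).
by rewrite (unsplitK (inr i : 'I_k + 'I_k')).
Qed.

Lemma mul_ideal_sub (M : lmodType R^c) (I J : set R) :
  I `<=` J -> mul_ideal M I `<=` mul_ideal M J.
Proof.
by move=> IJ x [k [m [a [Ia ->]]]]; exists k, m, a; split=> // i; exact: IJ.
Qed.

Lemma mul_ideal_linear (M N : lmodType R^c) (f : {linear M -> N}) (J : set R)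
  x :
  mul_ideal M J x -> mul_ideal N J (f x).
Proof.
move=> [k [m [a [Ja ->]]]]; exists k, (fun i => f (m i)), a; split=> //.
by rewrite linear_sum; apply: eq_bigr => i _; rewrite linearZ.
Qed.

End MulIdeal.
Arguments mul_ideal {R} M J _.

(* An exact sequence P_(n-1) -> ... -> P_0 -> M -> 0 with P_0, ..., P_(n-1)
   projective and n >= 1. The modules P_i and the maps out of them are junk for
   i >= n. *)
Record proj_resolution (S : pzRingType) (M : lmodType S) (n : nat) :=
  ProjResolution {
    res_obj :> nat -> lmodType S;
    res_aug : {linear res_obj 0%N -> M};
    res_diff : forall i, {linear res_obj i.+1 -> res_obj i};
    res_gt0 : (0 < n)%N;
    res_proj : forall i, (i < n)%N -> projective (res_obj i);
    res_aug_surj : forall x, exists y, res_aug y = x;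
    res_exact0 : (1 < n)%N -> range (res_diff 0) = [set y | res_aug y = 0];
    res_exactS : forall i, (i.+2 < n)%N ->
      range (res_diff i.+1) = [set y | res_diff i y = 0] }.

Section ChainMaps.
Variables (S : pzRingType) (M : lmodType S) (n : nat).
Implicit Types P Q : proj_resolution M n.

(* (f, g_0, ..., g_(n-1)) is a chain map from P -> M to Q -> M. *)
Definition chain_map P Q (f : {linear M -> M})
    (g : forall i, {linear P i -> Q i}) :=
  (forall x, f (res_aug P x) = res_aug Q (g 0%N x)) /\
  (forall i, (i.+1 < n)%N ->
    forall x, g i (res_diff P i x) = res_diff Q i (g i.+1 x)).

Definition cycles P i : set (P i) :=
  match i with
  | 0 => [set y | res_aug P y = 0]
  | j.+1 => [set y | res_diff P j y = 0]
  end.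
Arguments cycles : clear implicits.

Lemma res_exact P i : (i.+1 < n)%N -> range (res_diff P i) = cycles P i.
Proof. by case: i => [|i]; [exact: res_exact0|exact: res_exactS]. Qed.

Definition preserves_cycles P Q i (g : {linear P i -> Q i}) :=
  forall x, cycles P i x -> cycles Q i (g x).

Lemma chain_map_exists P Q (f : {linear M -> M}) :
  exists g : forall i, {linear P i -> Q i}, chain_map f g.
Proof.
pose T i := {g : {linear P i -> Q i} | (i < n)%N -> preserves_cycles g}.
have [g0 g0P] : exists g : {linear P 0%N -> Q 0%N},
    forall x, res_aug Q (g x) = f (res_aug P x).
  apply: (@projective_lift _ _ _ _ (res_aug Q)
      (f \o res_aug P : {linear _ -> _})).
    exact: res_proj (res_gt0 P).
  by move=> y _; have [x <-] := res_aug_surj Q y; exists x.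
have t0 : (0 < n)%N -> preserves_cycles g0.
  by move=> _ x /= x0; rewrite g0P x0 linear0.
have step i (t : T i) : {t' : T i.+1 | (i.+1 < n)%N ->
    forall x, sval t (res_diff P i x) = res_diff Q i (sval t' x)}.
  case: t => g gP; apply: cid => /=.
  have [ltin|geni] := EM (i.+1 < n)%N; last first.
    have junk : (i.+1 < n)%N ->
        preserves_cycles (\0 : {linear P i.+1 -> Q i.+1}).
      by [].
    by exists (exist _ _ junk).
  have [] := @projective_lift _ _ _ _ (res_diff Q i)
      (g \o res_diff P i : {linear _ -> _}) (res_proj ltin).
    move=> _ [x _ <-]; rewrite res_exact//; apply: gP; first exact: ltnW.
    by rewrite -res_exact//; exists x.
  move=> h hP.
  have hc : (i.+1 < n)%N -> preserves_cycles h.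
    by move=> _ x /= x0; rewrite hP /= x0 linear0.
  by exists (exist _ h hc) => _ x /=; rewrite hP.
pose F := nat_rect T (exist _ g0 t0) (fun i t => sval (step i t)).
exists (fun i => sval (F i)); split=> [x|i ltin x]; first by rewrite -g0P.
exact: (svalP (step i (F i)) ltin x).
Qed.

End ChainMaps.

Definition B_nbhs (R : ltRingType) (M : lmodType R^c) (n : nat)
    (P : proj_resolution M n) (J : set R) : set (endo M) := [set f : endo M |
  (forall x, mul_ideal M J (f x)) /\
  exists g : forall i, {linear P i -> P i}, chain_map f g /\
    forall i, (i < n)%N -> forall x, mul_ideal (P i) J (g i x)].

(* B(J, P) depends on P only through its length, so the topology defined below
   is the same for all resolutions of length n. *)
Lemma B_nbhs_indep (R : ltRingType) (M : lmodType R^c) (n : nat)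
  (P Q : proj_resolution M n) (J : set R) : B_nbhs P J = B_nbhs Q J.
Proof.
suff sub (P' Q' : proj_resolution M n) : B_nbhs P' J `<=` B_nbhs Q' J.
  by apply/seteqP; split; exact: sub.
move=> f [fJ [g [[g0 gS] gJ]]].
have [u [u0 uS]] := chain_map_exists Q' P' (idfun : {linear M -> M}).
have [v [v0 vS]] := chain_map_exists P' Q' (idfun : {linear M -> M}).
split=> //; exists (fun i => v i \o (g i \o u i)); split.
  by split=> [x|i ltin x] /=; rewrite ?uS ?gS ?vS// -v0 -g0 -u0.
by move=> i ltin x; exact: mul_ideal_linear (gJ i ltin _).
Qed.

Section EndoTopology.
Variables (R : ltRingType) (M : lmodType R^c) (n : nat).
Variable P : proj_resolution M n.

Definition endo_base_set : set (set (endo M)) :=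
  [set B_nbhs P J | J in @open_ideal R].

Lemma endo_base_ideal K : endo_base_set K -> is_ideal K.
Proof.
move=> [J _ <-]; split.
- split=> [x|]; first exact: mul_ideal0.
  exists (fun i => \0); split=> [|i _ x]; last exact: mul_ideal0.
  by split=> [x|i _ x] /=; rewrite linear0.
- move=> f f' [fJ [g [[g0 gS] gJ]]] [f'J [g' [[g'0 g'S] g'J]]]; split.
    by move=> x; apply: mul_idealD; [exact: fJ|exact: f'J].
  exists (fun i => g i \+ g' i); split.
    split=> [x|i ltin x] /=; first by rewrite linearD -g0 -g'0.
    by rewrite linearD -gS// -g'S.
  by move=> i ltin x; apply: mul_idealD; [exact: gJ|exact: g'J].
- move=> h f [fJ [g [[g0 gS] gJ]]]; have [k [k0 kS]] := chain_map_exists P P h.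
  split=> [x|]; first exact: (mul_ideal_linear (endo_fun h) (fJ x)).
  exists (fun i => k i \o g i); split.
    by split=> [x|i ltin x] /=; rewrite ?gS ?kS// -k0 -g0.
  by move=> i ltin x; exact: mul_ideal_linear (gJ i ltin _).
- move=> f h [fJ [g [[g0 gS] gJ]]]; have [k [k0 kS]] := chain_map_exists P P h.
  split=> [x|]; first exact: fJ.
  exists (fun i => g i \o k i); split.
    by split=> [x|i ltin x] /=; rewrite ?kS ?gS// -g0 -k0.
  by move=> i ltin x; exact: gJ.
Qed.

Lemma endo_base_neq0 : endo_base_set !=set0.
Proof. by exists (B_nbhs P setT), setT => //; exact: open_idealT. Qed.

Lemma endo_base_directed K L : endo_base_set K -> endo_base_set L ->
  exists2 N, endo_base_set N & N `<=` K `&` L.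
Proof.
move=> [J oJ <-] [J' oJ' <-]; exists (B_nbhs P (J `&` J')).
  by exists (J `&` J') => //; exact: open_idealI.
move=> f [fJ [g [gc gJ]]]; split; split.
- by move=> x; apply: mul_ideal_sub (fJ x); exact: subIsetl.
- exists g; split=> // i ltin x; apply: mul_ideal_sub (gJ i ltin x).
  exact: subIsetl.
- by move=> x; apply: mul_ideal_sub (fJ x); exact: subIsetr.
- exists g; split=> // i ltin x; apply: mul_ideal_sub (gJ i ltin x).
  exact: subIsetr.
Qed.

Definition endo_base : ideal_base (endo M) :=
  IdealBase endo_base_ideal endo_base_neq0 endo_base_directed.

(* End(M) with the topology tau_n^M, computed from the resolution P. *)
Definition endo_tau : ltRingType := lt_top endo_base.

End EndoTopology.

Section FreeResolution.
Variable S : pzRingType.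

Lemma projective_rV n : projective 'rV[S]_n.
Proof.
move=> B C g f gsurj.
pose b i := sval (cid (gsurj (f (delta_mx 0 i)))).
have bP i : g (b i) = f (delta_mx 0 i).
  exact: (svalP (cid (gsurj (f (delta_mx 0 i))))).
pose h (x : 'rV[S]_n) := \sum_i x 0 i *: b i.
have hlin : linear h.
  move=> a x y; rewrite /h scaler_sumr -big_split; apply: eq_bigr => i _.
  by rewrite !mxE scalerDl scalerA.
pose H : {linear 'rV[S]_n -> B} :=
  HB.pack h (GRing.isLinear.Build S 'rV[S]_n B _ h hlin).
exists H => x /=.
rewrite /h linear_sum [in RHS](row_sum_delta x) linear_sum.
apply: eq_bigr => i _.
by rewrite !linearZ /= bP.
Qed.

(* A finitely presented module has resolutions of lengths 1 and 2. *)
Lemma finitely_presented_resolution (M : lmodType S) n : n = 1%N \/ n = 2%N ->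
  finitely_presented M -> inhabited (proj_resolution M n).
Proof.
move=> n12 [m [p [d [eps [eps_surj d_ker]]]]].
pose P i : lmodType S := if i is 0%N then 'rV[S]_p else 'rV[S]_m.
pose D i : {linear P i.+1 -> P i} := if i is 0%N then d else \0.
apply: inhabits; apply: (@ProjResolution _ _ _ P eps D) => //.
- by case: n12 => ->.
- by case=> [|i] _; exact: projective_rV.
- by move=> i; case: n12 => ->.
Qed.

End FreeResolution.

Section StandardTopology.
Variables (R : ltRingType) (M : lmodType R^c).

Definition std_top : Type := M.
HB.instance Definition _ := GRing.Zmodule.on std_top.

Definition std_base : set (set M) := [set mul_ideal M J | J in @open_ideal R].

Lemma std_base_neq0 : std_base !=set0.
Proof. by exists (mul_ideal M setT), setT => //; exact: open_idealT. Qed.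

Lemma std_base_directed K L : std_base K -> std_base L ->
  exists2 N, std_base N & N `<=` K `&` L.
Proof.
move=> [J oJ <-] [J' oJ' <-]; exists (mul_ideal M (J `&` J')).
  by exists (J `&` J') => //; exact: open_idealI.
rewrite subsetI; split; apply: mul_ideal_sub; first exact: subIsetl.
exact: subIsetr.
Qed.

HB.instance Definition _ := isOpenTopological.Build std_top
  (linear_openT std_base_neq0) (linear_openI std_base_directed)
  (@linear_open_bigU M std_base).

End StandardTopology.

(* e R as a submodule of the right module R_R: in (R^c)^o, a *: x is x a. *)
Section RightIdeal.
Variables (R : pzRingType) (e : idempotent R).

Definition eR_submodule : submodule (R^c)^o.
Proof.
exists [set x : (R^c)^o | exists r : R, x = idem_val e * r].
- by exists 0; rewrite mulr0.
- by move=> _ _ [r ->] [s ->]; exists (r + s); rewrite mulrDr.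
- by move=> a _ [r ->]; exists (r * (a : R)); rewrite mulrA.
Defined.

Definition eR : lmodType R^c := subm_type eR_submodule.
End RightIdeal.

Record inverse_system d (I : porderType d) := InverseSystem {
  inv_obj :> I -> pzRingType;
  inv_map : forall i j, (i <= j)%O -> {rmorphism inv_obj j -> inv_obj i};
  inv_map_id : forall i (ii : (i <= i)%O) x, inv_map ii x = x;
  inv_map_comp : forall i j k (ij : (i <= j)%O) (jk : (j <= k)%O)
    (ik : (i <= k)%O) x, inv_map ij (inv_map jk x) = inv_map ik x;
  inv_neq0 : inhabited I;
  inv_directed : forall i j : I, exists k, (i <= k)%O /\ (j <= k)%O }.

Section InverseLimit.
Variables (d : Order.disp_t) (I : porderType d) (X : inverse_system I).

Record inv_lim := InvLim {
  inv_fam : forall i, X i;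
  inv_famP : forall i j (ij : (i <= j)%O),
    inv_map X ij (inv_fam j) = inv_fam i }.

HB.instance Definition _ := gen_eqMixin inv_lim.
HB.instance Definition _ := gen_choiceMixin inv_lim.

Lemma inv_limP (x y : inv_lim) :
  (forall i, inv_fam x i = inv_fam y i) -> x = y.
Proof.
case: x y => [x xP] [y yP] /= xy.
have {}xy : x = y by exact: functional_extensionality_dep.
by subst y; congr InvLim; exact: Prop_irrelevance.
Qed.

Let add (x y : inv_lim) : inv_lim.
Proof.
exists (fun i => inv_fam x i + inv_fam y i) => i j ij.
by rewrite rmorphD !inv_famP.
Defined.
Let opp (x : inv_lim) : inv_lim.
Proof.
by exists (fun i => - inv_fam x i) => i j ij; rewrite rmorphN inv_famP.
Defined.
Let zero : inv_lim.
Proof. by exists (fun i => 0) => i j ij; rewrite rmorph0. Defined.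
Let one : inv_lim.
Proof. by exists (fun i => 1) => i j ij; rewrite rmorph1. Defined.
Let mul (x y : inv_lim) : inv_lim.
Proof.
exists (fun i => inv_fam x i * inv_fam y i) => i j ij.
by rewrite rmorphM !inv_famP.
Defined.

Let addA : associative add.
Proof. by move=> x y z; apply: inv_limP => i /=; rewrite addrA. Qed.
Let addC : commutative add.
Proof. by move=> x y; apply: inv_limP => i /=; rewrite addrC. Qed.
Let add0 : left_id zero add.
Proof. by move=> x; apply: inv_limP => i /=; rewrite add0r. Qed.
Let addN : left_inverse zero opp add.
Proof. by move=> x; apply: inv_limP => i /=; rewrite addNr. Qed.
Let mulA : associative mul.
Proof. by move=> x y z; apply: inv_limP => i /=; rewrite mulrA. Qed.
Let mul1 : left_id one mul.
Proof. by move=> x; apply: inv_limP => i /=; rewrite mul1r. Qed.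
Let mul_1 : right_id one mul.
Proof. by move=> x; apply: inv_limP => i /=; rewrite mulr1. Qed.
Let mulDl : left_distributive mul add.
Proof. by move=> x y z; apply: inv_limP => i /=; rewrite mulrDl. Qed.
Let mulDr : right_distributive mul add.
Proof. by move=> x y z; apply: inv_limP => i /=; rewrite mulrDr. Qed.

HB.instance Definition _ := GRing.isPzRing.Build inv_lim
  addA addC add0 addN mulA mul1 mul_1 mulDl mulDr.

(* The topology induced by the product of the discrete rings X i: the basic
   neighbourhoods of 0 constrain finitely many coordinates to vanish. *)
Definition inv_base_set : set (set inv_lim) :=
  [set [set x | forall i, i \in s -> inv_fam x i = 0] | s in [set: seq I]].

Lemma inv_base_ideal K : inv_base_set K -> is_ideal K.
Proof.
move=> [s _ <-]; split=> //=.
- by move=> x y x0 y0 i si /=; rewrite x0// y0// addr0.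
- by move=> a x x0 i si /=; rewrite x0// mulr0.
- by move=> x a x0 i si /=; rewrite x0// mul0r.
Qed.

Lemma inv_base_neq0 : inv_base_set !=set0.
Proof. by eexists; exists [::]. Qed.

Lemma inv_base_directed K L : inv_base_set K -> inv_base_set L ->
  exists2 N, inv_base_set N & N `<=` K `&` L.
Proof.
move=> [s _ <-] [t _ <-]; eexists; first by exists (s ++ t).
by move=> x /= x0; split=> i si; apply: x0; rewrite mem_cat si ?orbT.
Qed.

Definition inv_base : ideal_base inv_lim :=
  IdealBase inv_base_ideal inv_base_neq0 inv_base_directed.

Definition lt_inv_lim : ltRingType := lt_top inv_base.
End InverseLimit.

Definition top_ring_iso (R S : ltRingType) := exists (f : {rmorphism R -> S})
  (g : S -> R), [/\ cancel f g, cancel g f, continuous f & continuous g].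

Definition pro (Q : pzRingType -> Prop) (R : ltRingType) : Prop :=
  exists d (I : porderType d) (X : inverse_system I),
    (forall i, Q (X i)) /\ top_ring_iso R (lt_inv_lim X).

Definition quasi_pi_regular (R : ltRingType) : Prop :=
  hausdorff_space R /\
  forall a : R, exists e : R, let f := 1 - e in
    [/\ e * e = e, a = e * a * e + f * a * f,
        exists b : R,
          [/\ e * b * e = b, e * a * e * b = e & b * (e * a * e) = e] &
        (fun n => (f * a * f) ^+ n) @ \oo --> (0 : R)].

Definition quasi_pi_infty_regular (R : ltRingType) : Prop :=
  hausdorff_space R /\ forall n, quasi_pi_regular (lt_matrix R n.+1).

Inductive P_top : (ltRingType -> Prop) -> Prop :=
| top_pro Q : P_disc Q -> P_top (pro Q)
| top_pro_semiperfect Q : P_disc Q -> P_top (fun R => pro Q R /\ semiperfect R)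
| top_quasi_pi_infty_regular : P_top quasi_pi_infty_regular
| top_quasi_pi_infty_regular_semiperfect :
    P_top (fun R => quasi_pi_infty_regular R /\ semiperfect R)
| top_quasi_pi_regular : P_top quasi_pi_regular
| top_quasi_pi_regular_semiperfect :
    P_top (fun R => quasi_pi_regular R /\ semiperfect R).

Definition Morita_preserved (Pr : ltRingType -> Prop) :=
  forall R : ltRingType, hausdorff_space R -> Pr R ->
  (forall n, Pr (lt_matrix R n.+1)) /\
  (forall e : idempotent R, progenerator (eR e) -> Pr (lt_corner e)).

(* Main.v *)
(* The main tool is a topological Drazin inverse: b is one of a if ab = ba,
   bab = b and (a - aab)^n -> 0. A Hausdorff linearly topologized ring is
   quasi-pi-regular iff all its elements have one. A Drazin inverse of a is
   unique and commutes with everything commuting with a, so centralizers,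
   Hausdorff quotients and inverse limits inherit quasi-pi-regularity.

   If R^m -> R^n -> M -> 0 is a presentation with matrix D, the endomorphisms of
   the complex R^m -> R^n form the centralizer E, in the ring of square matrices
   of size n + m over R, of a block idempotent and of D viewed as an off-diagonal
   block.
   E maps onto End(M), and tau_2 is the quotient topology. This gives the
   quasi-pi-regular cases.

   In a quasi-pi-regular ring without infinite sets of orthogonal idempotents,
   1 is a sum of orthogonal local idempotents, so the ring is semiperfect; E has
   no such sets if the matrix ring is semilocal, and quotients of semiperfect
   rings are semiperfect.

   For pro-Q, write the matrix ring as the limit of rings X_i satisfying Q. The
   image of E in X_i is a pi-regular subring. Its Jacobson radical is nil, and a
   nil multiplicative subset of a semisimple ring is nilpotent, so nilpotence
   and T-nilpotence pass from X_i to it. The quotients of End(M) by the images of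
   the kernels of E -> X_i thus satisfy Q, and first countability makes End(M)
   complete, i.e. the limit of these quotients. *)

Require Import Defs.
From HB Require Import structures.
From mathcomp Require Import all_boot all_order all_algebra generic_quotient.
From mathcomp Require Import all_classical.
From mathcomp Require Import topology tvs.
From Stdlib Require RelationClasses Ncring Ncring_tac.

Set Implicit Arguments.
Unset Strict Implicit.
Unset Printing Implicit Defensive.

Import GRing.Theory.
Local Open Scope classical_set_scope.
Local Open Scope ring_scope.

(** Pi-regularity passes to quotients but not to subrings, and E is only a subring of the matrix
    ring. A Drazin inverse is given by equations and is canonical, so it stays inside every
    centralizer and follows every continuous morphism. In the discrete topology its existence
    amounts to pi-regularity, by Dischinger's theorem.

    The parts of the theorem differ in what they ask of the map from E to End(M). Continuity
    suffices to push Drazin inverses forward, and it holds for tau_1 and tau_2 alike, whence both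
    cases of (ii). The pro-properties in (i) also require openness, so that the images of the
    kernels of E -> X_i are open ideals; this holds for tau_2, which controls a chain map on
    generators and on relations. A compatible family of classes in the resulting quotients must then
    be lifted to E through surjections with varying kernels, a Mittag-Leffler problem that is solved
    along a sequence. Part (iii) is algebraic: E is semiperfect, and so is its quotient End(M). *)

#[local] Instance pz_ring_ops (A : pzRingType) :
  @Ncring.Ring_ops A 0 1 +%R *%R (fun x y => x - y) (@GRing.opp A) eq := {}.

#[local] Instance pz_ring_ncring (A : pzRingType) :
  Ncring.Ring (Ro := pz_ring_ops A).
Proof.
split; first exact: RelationClasses.eq_equivalence.
- by move=> x y -> z t ->.
- by move=> x y -> z t ->.
- by move=> x y -> z t ->.
- by move=> x y ->.
- exact: add0r.
- exact: addrC.
- exact: addrA.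
- exact: mul1r.
- exact: mulr1.
- exact: mulrA.
- exact: mulrDl.
- by move=> x y z; exact: mulrDr.
- by [].
- exact: subrr.
Qed.

Ltac ncring := Ncring_tac.non_commutative_ring.

(** * Topological Drazin inverses *)

Section Drazin.
Variable A : pzRingType.
Implicit Types (F : set (set A)) (a b x : A).

(** An abstract Hausdorff linear topology. It stands for the open ideals, for the zero ideal alone
    (the discrete topology), for the kernels of a limit cone, and for preimages of these under
    embeddings. *)
Definition separating F :=
  (forall J, F J -> is_ideal J) /\ forall x, (forall J, F J -> J x) -> x = 0.

Definition top_nilpotent F x := forall J, F J -> exists n, J (x ^+ n).

(* The topological analogue of a Drazin inverse: e := a b is the idempotent of
   the Fitting decomposition of a, and b is the inverse of e a e in e A e. *)
Definition drazin F a b :=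
  [/\ a * b = b * a, b * a * b = b & top_nilpotent F (a - a * a * b)].

Lemma ideal_exp_le (J : set A) x m n :
  is_ideal J -> (m <= n)%N -> J (x ^+ m) -> J (x ^+ n).
Proof.
by move=> [_ _ Jl _] mn Jx; rewrite -(subnK mn) exprD; exact: Jl.
Qed.

Lemma comm_expM_idem a e n :
  e * e = e -> GRing.comm a e -> (a * e) ^+ n.+1 = a ^+ n.+1 * e.
Proof.
move=> ee ae; rewrite exprMn_comm//; congr (_ * _).
by elim: n => // n IH; rewrite exprS IH.
Qed.

Lemma idem_compl (e : A) : e * e = e -> (1 - e) * (1 - e) = 1 - e.
Proof. by move=> ee; rewrite mulrBr mulr1 mulrBl mul1r ee subrr subr0. Qed.

Section DrazinTheory.
Variables (F : set (set A)) (a b : A).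
Hypothesis ab : drazin F a b.

Lemma drazin_idem : (a * b) * (a * b) = a * b.
Proof. by case: ab => _ bab _; rewrite -mulrA (mulrA b) bab. Qed.

Lemma drazin_el : a * b * b = b.
Proof. by case: ab => -> ->. Qed.

Lemma drazin_er : b * (a * b) = b.
Proof. by case: ab => _ bab _; rewrite mulrA. Qed.

Lemma drazin_exp n : a ^+ n.+1 * b ^+ n.+1 = a * b.
Proof.
case: ab => abC bab _; elim: n => // n IH.
by rewrite exprS [b ^+ _]exprSr -mulrA (mulrA (a ^+ _)) IH drazin_el.
Qed.

Lemma drazin_expC n : b ^+ n * a ^+ n = a ^+ n * b ^+ n.
Proof.
by case: ab => abC _ _; apply: commrX; apply: commr_sym; apply: commrX.
Qed.

Hypothesis sepF : separating F.

Let nil_l J : F J -> exists n, J (a ^+ n.+1 * (1 - a * b)).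
Proof.
move=> FJ; have [abC bab /(_ J FJ)[n Jn]] := ab; exists n.
have fE : a - a * a * b = a * (1 - a * b) by ncring.
rewrite -comm_expM_idem; first 1 last.
- exact/idem_compl/drazin_idem.
- by rewrite /GRing.comm mulrBr mulrBl mulr1 mul1r {1}abC mulrA.
by rewrite -fE; apply: ideal_exp_le (leqnSn n) Jn; exact: sepF.1.
Qed.

(* If x commutes with a, then e x (1 - e) = b^n e x a^n (1 - e), and the right
   hand side tends to 0. *)
Lemma drazin_comm x : a * x = x * a -> b * x = x * b.
Proof.
case: ab => abC bab _ ax.
have axn n : x * a ^+ n = a ^+ n * x by apply: commrX.
have fan n : (1 - a * b) * a ^+ n = a ^+ n * (1 - a * b).
  apply: commrX; apply: commr_sym; apply: commrB; first exact: commr1.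
  by rewrite /GRing.comm {1}abC mulrA.
have exf : a * b * x * (1 - a * b) = 0.
  apply: sepF.2 => J FJ; have [n Jn] := nil_l FJ.
  have [_ _ Jl _] := sepF.1 J FJ.
  have -> : a * b * x * (1 - a * b) =
      b ^+ n.+1 * x * (a ^+ n.+1 * (1 - a * b)).
    rewrite -(drazin_exp n) -drazin_expC -!mulrA; congr (_ * _).
    by rewrite !mulrA axn.
  exact: Jl.
have fxe : (1 - a * b) * x * (a * b) = 0.
  apply: sepF.2 => J FJ; have [n Jn] := nil_l FJ.
  have [_ _ _ Jr] := sepF.1 J FJ.
  have -> : (1 - a * b) * x * (a * b) =
      a ^+ n.+1 * (1 - a * b) * (x * b ^+ n.+1).
    by rewrite -fan -!mulrA; congr (_ * _); rewrite -(drazin_exp n) !mulrA axn.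
  exact: Jr.
have ex : a * b * x = x * (a * b).
  apply/eqP; rewrite -subr_eq0; apply/eqP.
  transitivity (a * b * x * (1 - a * b) - (1 - a * b) * x * (a * b)).
    by ncring.
  by rewrite exf fxe subr0.
transitivity (b * (a * b * x)); first by rewrite mulrA drazin_er.
rewrite ex; have -> : b * (x * (a * b)) = b * (x * a) * b by ncring.
by rewrite -ax [b * (a * x)]mulrA -abC ex -mulrA drazin_el.
Qed.

End DrazinTheory.

(** For positive [n], [a * b = b ^+ n * a ^+ n], while [a ^+ n * (1 - a * b')] tends to 0; so the
    idempotents [a * b] and [a * b'] absorb each other. They commute by [drazin_comm], hence agree,
    and the idempotent determines the inverse. *)
Lemma drazin_unique F a b b' :
  separating F -> drazin F a b -> drazin F a b' -> b = b'.
Proof.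
move=> sF.
have ee' c c' : drazin F a c -> drazin F a c' ->
    a * c * (1 - a * c') = 0.
  move=> dc dc'; apply: sF.2 => J FJ.
  have [acC' _ /(_ J FJ)[n Jn]] := dc'.
  have [_ _ Jl _] := sF.1 J FJ.
  rewrite -(drazin_exp dc n) -(drazin_expC dc) -mulrA; apply: Jl.
  rewrite -comm_expM_idem; first 1 last.
  - exact/idem_compl/drazin_idem/dc'.
  - by rewrite /GRing.comm mulrBr mulrBl mulr1 mul1r {1}acC' mulrA.
  have -> : a * (1 - a * c') = a - a * a * c' by ncring.
  by apply: ideal_exp_le (leqnSn n) Jn; exact: sF.1.
move=> dc dc'; have [abC bab _] := dc; have [abC' bab' _] := dc'.
have bb' : b * b' = b' * b by apply: (drazin_comm dc sF).
have eC : a * b * (a * b') = a * b' * (a * b).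
  rewrite abC' abC.
  by transitivity (b * a * (a * b')); rewrite -?abC -?abC' // -!mulrA;
    congr (_ * _); rewrite !mulrA -abC -?abC' -!mulrA; congr (_ * _).
have eE : a * b = a * b'.
  apply/eqP; rewrite -subr_eq0; apply/eqP.
  transitivity (a * b * (1 - a * b') - a * b' * (1 - a * b) +
    (a * b * (a * b') - a * b' * (a * b))); first by ncring.
  by rewrite !ee'// eC !subrr addr0.
by rewrite -(drazin_er dc) eE mulrA -abC eE (drazin_el dc').
Qed.
End Drazin.

(** The hypothesis on [F] and [G] is continuity of [f] at 0. *)
Lemma drazin_rmorph (A B : pzRingType) (f : {rmorphism A -> B})
    (F : set (set A)) (G : set (set B)) (a b : A) :
  (forall K, G K -> exists2 J, F J & forall x, J x -> K (f x)) ->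
  drazin F a b -> drazin G (f a) (f b).
Proof.
move=> FG [abC bab anil]; split.
- by rewrite -!rmorphM abC.
- by rewrite -!rmorphM bab.
- move=> K /FG[J /anil[n Jn] JK]; exists n.
  by rewrite -!rmorphM -rmorphB -rmorphXn; exact: JK.
Qed.

(** * Pi-regularity as Drazin invertibility in the discrete topology *)

Section PiRegular.
Variable A : pzRingType.

Definition null_filtration : set (set A) := [set [set 0]].

Lemma separating_null : separating null_filtration.
Proof.
split=> [_ ->|x /(_ [set 0] erefl)//].
split=> //= [x y -> ->|a x ->|x a ->]; first exact: addr0.
- exact: mulr0.
- exact: mul0r.
Qed.

Lemma drazinP (a b : A) : drazin null_filtration a b <->
  [/\ a * b = b * a, b * a * b = b & exists n, (a - a * a * b) ^+ n = 0].
Proof.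
split=> [[abC bab /(_ [set 0] erefl)[n /= n0]]|[abC bab [n n0]]].
  by split=> //; exists n.
by split=> // _ ->; exists n.
Qed.

Definition right_pi_regular_at (a : A) := exists n r, a ^+ n = a ^+ n.+1 * r.

Lemma right_pi_regularP :
  pi_regular A <-> forall a, right_pi_regular_at a.
Proof.
split=> [preg a|preg a].
  have [n /(_ n.+1 (leqnSn n)) aE] := preg a; exists n.
  have : principal_right_ideal (a ^+ n) (a ^+ n).
    by exists 1 => //; rewrite mulr1.
  by rewrite -aE => -[r _ <-]; exists r.
have [n [r anr]] := preg a; exists n => m nm.
have step k : (n <= k)%N -> a ^+ k = a ^+ k.+1 * r.
  move=> nk; rewrite -(subnK nk) -addnS [in LHS]exprD [in RHS]exprD -mulrA.
  by rewrite -anr.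
apply/seteqP; split=> _ [s _ <-].
  by exists (a ^+ (m - n) * s) => //; rewrite mulrA -exprD subnKC.
rewrite -(subnKC nm); elim: (m - n)%N => [|k [t _ tE]].
  by rewrite addn0; exists s.
by exists (r * t) => //; rewrite mulrA addnS -step ?leq_addr.
Qed.

Lemma right_pi_regular_at_pow (a : A) n r :
  a ^+ n = a ^+ n.+1 * r -> forall k, a ^+ n = a ^+ (n + k) * r ^+ k.
Proof.
move=> anr; elim=> [|k IH]; first by rewrite addn0 mulr1.
have st : a ^+ (n + k) = a ^+ (n + k).+1 * r.
  by rewrite addnC -addnS !exprD -mulrA -anr.
by rewrite addnS [r ^+ _]exprS mulrA -st.
Qed.

(* Dischinger's theorem. After replacing a by a power, b = b^2 x; choose y with
   x^m = x^(m+1) y and put z := y - b, so that b z = 0; choose u with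
   z^l = z^(l+1) u and put g := 1 - z u. Then x^m g = x^(m+1) b, whence
   b = b x b. So b is right invertible in the corner ring of the idempotent
   b x, hence invertible there, right pi-regular rings being Dedekind-finite. *)
Lemma square_regular (b x : A) : (forall a, right_pi_regular_at a) ->
  b = b * b * x -> b = b * x * b.
Proof.
move=> preg bbx.
have bpow k : b ^+ k.+1 * x ^+ k = b.
  elim: k => [|k IH]; first by rewrite mulr1.
  transitivity (b ^+ k * (b * b * x) * x ^+ k).
    by rewrite [x ^+ _]exprS !exprSr !mulrA.
  by rewrite -bbx -exprSr.
have [m [y xmy]] := preg x.
have bxy : b = b * x * y.
  by rewrite -{2}(bpow m) -[_ * x]mulrA -exprSr -mulrA -xmy bpow.
have by_ : b * y = b * b by rewrite {3}bxy !mulrA -bbx.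
pose z := y - b.
have bz : b * z = 0 by rewrite mulrBr by_ subrr.
have zpow j : z ^+ j.+1 = y ^+ j * z.
  elim: j => [|j IH]; first by rewrite mul1r.
  by rewrite exprSr IH exprSr -!mulrA {1}/z mulrBl bz subr0.
have [l [u zl]] := preg z.
pose g := 1 - z * u.
have bg : b * g = b by rewrite mulrBr mulr1 mulrA bz mul0r subr0.
have ylg : y ^+ l * (y * g) = y ^+ l * b.
  apply/eqP; rewrite -subr_eq0 -mulrBr; apply/eqP.
  have -> : y * g - b = z * g by rewrite mulrBl bg.
  rewrite mulrA -zpow mulrBr mulr1 mulrA -exprSr [in X in _ - X]exprS.
  by rewrite -mulrA -zl -exprS subrr.
have xmg : x ^+ m * g = x ^+ m.+1 * b.
  have xmb : x ^+ m * (y * g) = x ^+ m * b.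
    by rewrite (right_pi_regular_at_pow xmy l) -!mulrA ylg.
  by rewrite {1}xmy exprS -!mulrA xmb.
by rewrite -{1}bg -{1}(bpow m) -mulrA xmg [x ^+ _.+1]exprSr !mulrA bpow.
Qed.

Lemma square_left (b x : A) : (forall a, right_pi_regular_at a) ->
  b = b * b * x -> exists y, b = y * b * b.
Proof.
move=> preg bbx; have bxb := square_regular preg bbx.
have [p pE] : {p | p = b * x} by exists (b * x).
have pp : p * p = p by rewrite pE mulrA -bxb.
have pb : p * b = b by rewrite pE.
have bp : b * p = b by rewrite pE mulrA -bbx.
pose v := p * (b * x * x) * p.
have bv : b * v = p by rewrite /v mulrA (mulrA b) bp !mulrA -bbx -pE pp.
have pv : p * v = v by rewrite /v mulrA (mulrA p) pp.
have [n [w vn]] := preg v.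
have bvn k : b ^+ k.+1 * v ^+ k.+1 = p.
  elim: k => // k IH; rewrite [b ^+ _]exprSr [v ^+ _]exprS -mulrA (mulrA b) bv.
  by rewrite [v ^+ _]exprS (mulrA p) pv -exprS.
(* Multiplying on the left by [b ^+ n.+1] cancels [v ^+ n.+1], by [bvn]. So the right inverse [v] of
   [b] in the corner ring of [p] is itself right invertible, hence a two-sided inverse of [b]. *)
have vn1 : v ^+ n.+1 = v ^+ n.+1 * (v * w).
  by rewrite mulrA -exprSr exprS {1}vn mulrA -exprS.
have pvw : p = v * w.
  by rewrite -(bvn n) {1}vn1 mulrA bvn mulrA pv.
have bw : b = p * w by rewrite -bv -mulrA -pvw bp.
have vp : v * p = v by rewrite /v -mulrA pp.
exists v; have -> : v * b = p by rewrite bw mulrA vp -pvw.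
by rewrite pb.
Qed.

(** By Dischinger's theorem the power [b := a ^+ n.+1] has a group inverse [c]. Being a Drazin
    inverse of [b], it commutes with [a], so [a ^+ n * c] is a Drazin inverse of [a]. This criterion
    is left-right symmetric, unlike the definition of [pi_regular]. *)
Lemma pi_regularP :
  pi_regular A <-> forall a, exists b, drazin null_filtration a b.
Proof.
have idemC (a b : A) : (a * b) * (a * b) = a * b -> a * b = b * a ->
    forall n, (a - a * a * b) ^+ n.+1 = a ^+ n.+1 * (1 - a * b).
  move=> ee abC n; have -> : a - a * a * b = a * (1 - a * b) by ncring.
  apply: comm_expM_idem.
    exact: idem_compl.
  by rewrite /GRing.comm mulrBr mulrBl mulr1 mul1r {1}abC mulrA.
rewrite right_pi_regularP; split=> preg a; last first.
  have [b dab] := preg a; have /drazinP[abC bab [n an]] := dab.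
  have := idemC a b (drazin_idem dab) abC n; rewrite exprS an mulr0.
  move=> /esym/eqP; rewrite mulrBr mulr1 subr_eq0 mulrA -exprSr => /eqP.
  by exists n.+1, b.
have [n [r anr]] := preg a.
pose b := a ^+ n.+1; pose s := r ^+ n.+1.
have bbs : b = b * b * s.
  rewrite /b -exprD addSn [LHS]exprS [in RHS]exprS -mulrA; congr (_ * _).
  exact: right_pi_regular_at_pow.
have [y byb] := square_left preg bbs.
pose p := b * s; pose c := p * s.
have pE : p = y * b.
  by rewrite {1}/p {1}byb -!mulrA; congr (_ * _); rewrite mulrA.
have pb : p * b = b by rewrite pE -byb.
have bp : b * p = b by rewrite /p mulrA -bbs.
have pp : p * p = p by rewrite {2}/p mulrA pb.
have bc : b * c = p by rewrite mulrA bp.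
have cE : c = y * p by rewrite /c {1}pE -mulrA.
have cb : c * b = p by rewrite cE -mulrA pb pE.
have cp : c * p = c by rewrite cE -mulrA pp.
have dbc : drazin null_filtration b c.
  apply/drazinP; split; first by rewrite bc cb.
    by rewrite -mulrA bc cp.
  by exists 1; rewrite expr1 -mulrA bc bp subrr.
have ac : c * a = a * c.
  by apply: (drazin_comm dbc separating_null); rewrite /b -exprS -exprSr.
pose d := a ^+ n * c.
have ad : a * d = p by rewrite mulrA -exprS bc.
have da : d * a = p by rewrite -mulrA ac mulrA -exprSr bc.
exists d; apply/drazinP; split; first by rewrite ad da.
  by rewrite -mulrA ad -mulrA cp.
exists n.+1; rewrite idemC ?ad ?da//.
by rewrite mulrBr mulr1 bp subrr.
Qed.

End PiRegular.

(** * Jacobson radical and semisimple rings *)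

Section QuotientMorphisms.

Lemma rmorph_factor (A B C : pzRingType) (f : {rmorphism A -> B})
    (g : {rmorphism A -> C}) :
  (forall y, exists x, f x = y) -> (forall x, f x = 0 -> g x = 0) ->
  exists h : {rmorphism B -> C}, forall x, h (f x) = g x.
Proof.
move=> fsurj fg.
pose s y := sval (cid (fsurj y)); have sK y : f (s y) = y.
  exact: svalP (cid (fsurj y)).
have gE x y : f x = f y -> g x = g y.
  by move=> fxy; apply/eqP; rewrite -subr_eq0 -rmorphB fg// rmorphB fxy subrr.
pose h := g \o s.
have hf x : h (f x) = g x by apply: gE; rewrite sK.
have hB : zmod_morphism h.
  by move=> x y; rewrite -[x]sK -[y]sK -rmorphB !hf rmorphB.
have hM : monoid_morphism h.
  split=> [|x y]; first by rewrite -(rmorph1 f) hf rmorph1.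
  by rewrite -[x]sK -[y]sK -rmorphM !hf rmorphM.
pose H : {rmorphism B -> C} := HB.pack h
  (GRing.isZmodMorphism.Build B C h hB) (GRing.isMonoidMorphism.Build B C h hM).
by exists H.
Qed.

Local Open Scope quotient_scope.
Variables (A : pzRingType) (I : ideal A).

Definition quot_proj (x : A) : quot_ring I := \pi_(quot_ring I) x.

Let quot_projB : zmod_morphism quot_proj.
Proof.
move=> x y; apply/eqP; rewrite eq_sym subr_eq; apply/eqP.
by rewrite /quot_proj -quot_piD subrK.
Qed.
Let quot_projM : monoid_morphism quot_proj.
Proof. by split=> // x y; exact: quot_piM. Qed.

HB.instance Definition _ :=
  GRing.isZmodMorphism.Build A (quot_ring I) quot_proj quot_projB.
HB.instance Definition _ :=
  GRing.isMonoidMorphism.Build A (quot_ring I) quot_proj quot_projM.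

Lemma quot_proj_surj y : exists x, quot_proj x = y.
Proof. by exists (repr y); rewrite /quot_proj reprK. Qed.

Lemma quot_proj_eq0 x : quot_proj x = 0 <-> ideal_set I x.
Proof. by rewrite -(rmorph0 quot_proj) quot_eqP subr0. Qed.

End QuotientMorphisms.

Lemma is_ideal_ker (A B : pzRingType) (f : {rmorphism A -> B}) :
  is_ideal [set x | f x = 0].
Proof.
split=> /= [|x y fx fy|a x fx|x a fx].
- exact: rmorph0.
- by rewrite rmorphD fx fy addr0.
- by rewrite rmorphM fx mulr0.
- by rewrite rmorphM fx mul0r.
Qed.

Section RightIdeals.
Variable A : pzRingType.
Implicit Types I J : set A.

Lemma right_idealN I x : is_right_ideal I -> I x -> I (- x).
Proof. by move=> [_ _ Ir] Ix; rewrite -mulrN1; exact: Ir. Qed.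

Lemma right_idealB I x y : is_right_ideal I -> I x -> I y -> I (x - y).
Proof.
by move=> rI Ix Iy; have [_ ID _] := rI; apply: ID => //; exact: right_idealN.
Qed.

Lemma ideal_right I : is_ideal I -> is_right_ideal I.
Proof. by case=> I0 ID _ Ir; split. Qed.

Definition ideal_sum I J : set A :=
  [set z | exists x y, [/\ I x, J y & z = x + y]].

Lemma is_right_ideal_sum I J :
  is_right_ideal I -> is_right_ideal J -> is_right_ideal (ideal_sum I J).
Proof.
move=> [I0 ID Ir] [J0 JD Jr]; split.
- by exists 0, 0; rewrite addr0.
- move=> _ _ [x [y [Ix Jy ->]]] [x' [y' [Ix' Jy' ->]]].
  by exists (x + x'), (y + y'); split; [exact: ID|exact: JD|rewrite addrACA].
- move=> _ a [x [y [Ix Jy ->]]].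
  by exists (x * a), (y * a); split; [exact: Ir|exact: Jr|rewrite mulrDl].
Qed.

Lemma ideal_sum_subl I J : is_right_ideal J -> I `<=` ideal_sum I J.
Proof. by move=> [J0 _ _] x Ix; exists x, 0; rewrite addr0. Qed.

Lemma ideal_sum_subr I J : is_right_ideal I -> J `<=` ideal_sum I J.
Proof. by move=> [I0 _ _] x Jx; exists 0, x; rewrite add0r. Qed.

Lemma is_right_ideal_principal (a : A) :
  is_right_ideal (principal_right_ideal a).
Proof.
split=> [|_ _ [r _ <-] [s _ <-]|_ b [r _ <-]].
- by exists 0; rewrite ?mulr0.
- by exists (r + s); rewrite ?mulrDr.
- by exists (r * b); rewrite ?mulrA.
Qed.

Lemma maximal_right_ideal_exists I : is_right_ideal I -> ~ I 1 ->
  exists2 m, is_maximal_right_ideal m & I `<=` m.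
Proof.
move=> rI nI1; have [I0 _ _] := rI.
pose P X := X = set0 \/ [/\ is_right_ideal X, I `<=` X & ~ X 1].
have [F FP totF|M [[M0|[rM IM nM1]] Mmax]] := @Zorn_bigcup A P.
- have [[X FX X0]|nX] := pselect (exists2 X, F X & X !=set0); last first.
    left; apply/seteqP; split=> // x [X FX Xx].
    by apply: nX; exists X => //; exists x.
  have [XE|[rX IX nX1]] := FP X FX.
    by rewrite XE in X0; case: X0.
  have good Y y : F Y -> Y y -> [/\ is_right_ideal Y, I `<=` Y & ~ Y 1].
    by move=> FY Yy; have [YE|//] := FP Y FY; rewrite YE in Yy.
  right; split.
  + split.
    * by exists X => //; case: rX.
    * move=> x y [Y FY Yx] [Z FZ Zy].
      have [[Y0 YD Yr] _ _] := good Y x FY Yx.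
      have [[Z0 ZD Zr] _ _] := good Z y FZ Zy.
      have [YZ|ZY] := totF Y Z FY FZ.
        by exists Z => //; apply: ZD => //; exact: YZ.
      by exists Y => //; apply: YD => //; exact: ZY.
    * move=> x a [Y FY Yx]; exists Y => //.
      by have [[_ _ Yr] _ _] := good Y x FY Yx; exact: Yr.
  + by move=> x Ix; exists X => //; exact: IX.
  + by move=> [Y FY Y1]; have [_ _] := good Y 1 FY Y1.
- exfalso; apply: (Mmax I); last by right; split.
  by rewrite M0; split=> // /(_ 0 I0).
- exists M => //; split=> // n rn Mn nn1; apply/seteqP; split=> //.
  apply: contrapT => nM; apply: (Mmax n); first by split.
  by right; split=> //; exact: subset_trans Mn.
Qed.

Lemma JacP (x : A) : Jac x <-> forall a, exists b, (1 - x * a) * b = 1.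
Proof.
split=> [Jx a|xP m mm].
- apply: contrapT => nb.
  have [|m mm Im] := maximal_right_ideal_exists
    (is_right_ideal_principal (1 - x * a)).
    by move=> [b _ b1]; apply: nb; exists b.
  have [rm nm1 _] := mm; apply: nm1; rewrite -(subrK (x * a) 1).
  have [_ mD mr] := rm; apply: mD; last by apply: mr; exact: Jx.
  by apply: Im; exists 1; rewrite ?mulr1.
- apply: contrapT => nmx; have [rm nm1 mmax] := mm.
  have rI := is_right_ideal_sum rm (is_right_ideal_principal x).
  have [[b [_ [mb [a _ <-] E]]]|nI1] :=
    pselect (ideal_sum m (principal_right_ideal x) 1).
    have [c bc] := xP a; apply: nm1; rewrite -bc.
    have [_ _ mr] := rm; apply: mr.
    by rewrite E addrK.
  apply: nmx; rewrite -(mmax _ rI _ nI1).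
    by apply: ideal_sum_subr => //; exists 1; rewrite ?mulr1.
  by apply: ideal_sum_subl; exact: is_right_ideal_principal.
Qed.

Lemma Jac_idempotent (e : A) : e * e = e -> Jac e -> e = 0.
Proof.
move=> ee /JacP/(_ 1)[b]; rewrite mulr1 => eb.
by rewrite -[LHS]mulr1 -eb mulrA mulrBr mulr1 ee subrr mul0r.
Qed.

End RightIdeals.

Lemma Jac_rmorph (A B : pzRingType) (f : {rmorphism A -> B}) (x : A) :
  (forall y, exists x, f x = y) -> Jac x -> Jac (f x).
Proof.
move=> fsurj /JacP Jx; apply/JacP => a; have [a' <-] := fsurj a.
have [b xb] := Jx a'; exists (f b).
by rewrite -rmorphM -(rmorph1 f) -rmorphB -rmorphM xb.
Qed.

Section Semisimple.
Variable A : pzRingType.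
Hypothesis ssA : semisimple_artinian A.
Implicit Types I : set A.

Lemma semisimple_idem I : is_right_ideal I ->
  exists e, [/\ I e, e * e = e & forall x, I x -> e * x = x].
Proof.
move=> rI; have [I' [rI' AE II']] := ssA rI.
have [e [e' [Ie I'e' E]]] := AE 1; have [_ ID Ir] := rI.
have eI x : I x -> e * x = x.
  move=> Ix; apply/eqP; rewrite eq_sym -subr_eq0; apply/eqP; apply: II'.
    by apply: right_idealB => //; exact: Ir.
  rewrite -{1}[x]mul1r E mulrDl addrC addKr.
  by have [_ _ I'r] := rI'; exact: I'r.
by exists e; split=> //; exact: eI.
Qed.

Lemma semisimple_Jac (x : A) : Jac x -> x = 0.
Proof.
move=> Jx.
have [e [Je ee eJ]] := semisimple_idem (ideal_right (is_ideal_Jac A)).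
by rewrite -(eJ x Jx) (Jac_idempotent ee Je) mul0r.
Qed.

(** The union is generated by an idempotent, which already lies in some [f n]. *)
Lemma semisimple_acc (f : nat -> set A) : (forall n, is_right_ideal (f n)) ->
  (forall n, f n `<=` f n.+1) -> exists n, forall m, f m `<=` f n.
Proof.
move=> rf fS; have fle m n : (m <= n)%N -> f m `<=` f n.
  by move=> /subnK <-; elim: (n - m)%N => // k IH; exact: subset_trans (fS _).
have [|e [[n _ ne] _ eI]] := @semisimple_idem (\bigcup_n f n).
  split.
  - by exists 0%N => //; case: (rf 0%N).
  - move=> x y [m _ mx] [n _ ny]; exists (maxn m n) => //.
    have [_ fD _] := rf (maxn m n).
    apply: fD; first by apply: fle mx; exact: leq_maxl.
    by apply: fle ny; exact: leq_maxr.
  - by move=> x a [m _ mx]; exists m => //; have [_ _ fr] := rf m; exact: fr.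
exists n => m x mx; rewrite -(eI x); last by exists m.
by have [_ _ fr] := rf n; exact: fr.
Qed.

(** The chain is reversed by passing to annihilators. The product [d n := e n * ... * e 0] lies in
    [f n] and is a left identity on it, and [d n.+1 * d n = d n.+1], so the right annihilators of
    the [d n] ascend. Where they stabilize, [d n = d n.+1]. *)
Lemma semisimple_dcc (f : nat -> set A) : (forall n, is_right_ideal (f n)) ->
  (forall n, f n.+1 `<=` f n) -> exists n, f n `<=` f n.+1.
Proof.
move=> rf fS; pose e n := sval (cid (semisimple_idem (rf n))).
have eP n : [/\ f n (e n), e n * e n = e n & forall x, f n x -> e n * x = x].
  exact: svalP (cid (semisimple_idem (rf n))).
pose d := fix d n := if n is m.+1 then e m.+1 * d m else e 0%N.
have dI n x : f n x -> d n * x = x.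
  elim: n => [|n IH] nx /=; first by have [_ _ ->] := eP 0%N.
  by rewrite -mulrA IH; [have [_ _ ->] := eP n.+1|exact: fS].
have fd n : f n (d n).
  case: n => [|n] /=; first by case: (eP 0%N).
  by have [en _ _] := eP n.+1; have [_ _ fr] := rf n.+1; exact: fr.
have dS n : d n.+1 * d n = d n.+1 by rewrite /= -mulrA dI.
have [||n nE] := @semisimple_acc (fun n => [set x | d n * x = 0]).
- move=> n; split=> /= [|x y x0 y0|x a x0]; first exact: mulr0.
    by rewrite mulrDr x0 y0 addr0.
  by rewrite mulrA x0 mul0r.
- by move=> n x /= x0; rewrite -mulrA x0 mulr0.
exists n => x nx; rewrite -(dI n x nx).
have : d n * (1 - d n.+1) = 0.
  apply: (nE n.+1); change (d n.+1 * (1 - d n.+1) = 0).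
  by rewrite mulrBr mulr1 dI ?subrr.
rewrite mulrBr mulr1 => /eqP; rewrite subr_eq0 => /eqP ->.
have dd : d n * d n.+1 = d n.+1 by apply: dI; apply: fS; exact: fd.
by rewrite dd; have [_ _ fr] := rf n.+1; apply: fr; exact: fd.
Qed.

Lemma semisimple_max (P : set (set A)) I :
  (forall I, P I -> is_right_ideal I) -> P I ->
  exists2 M, P M & forall N, P N -> M `<=` N -> N `<=` M.
Proof.
move=> Pr PI; apply: contrapT => nM.
have step (X : {X | P X}) : {Y : {Y | P Y} | sval X `<=` sval Y /\
    ~ sval Y `<=` sval X}.
  case: X => X PX; apply: cid => /=; apply: contrapT => nY; apply: nM.
  exists X => // N PN XN; apply: contrapT => nNX; apply: nY.
  by exists (exist _ N PN).
have [f [_ fS]] := dependent_choice step (exist _ I PI).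
have [n|n|n nmax] := @semisimple_acc (fun n => sval (f n)).
- exact/Pr/svalP.
- by have [] := fS n.
by have [_] := fS n; apply; exact: nmax.
Qed.

Lemma semisimple_min (P : set (set A)) I :
  (forall I, P I -> is_right_ideal I) -> P I ->
  exists2 M, P M & forall N, P N -> N `<=` M -> M `<=` N.
Proof.
move=> Pr PI; apply: contrapT => nM.
have step (X : {X | P X}) : {Y : {Y | P Y} | sval Y `<=` sval X /\
    ~ sval X `<=` sval Y}.
  case: X => X PX; apply: cid => /=; apply: contrapT => nY; apply: nM.
  exists X => // N PN XN; apply: contrapT => nNX; apply: nY.
  by exists (exist _ N PN).
have [f [_ fS]] := dependent_choice step (exist _ I PI).
have [n|n|n nmin] := @semisimple_dcc (fun n => sval (f n)).
- exact/Pr/svalP.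
- by have [] := fS n.
by have [_] := fS n; apply.
Qed.

Lemma semisimple_pi_regular : pi_regular A.
Proof.
apply/right_pi_regularP => a.
have [n|n|n an] := @semisimple_dcc (fun n => principal_right_ideal (a ^+ n)).
- exact: is_right_ideal_principal.
- by move=> _ [r _ <-]; exists (a * r) => //; rewrite exprSr mulrA.
have [|r _ rE] := an (a ^+ n); first by exists 1; rewrite ?mulr1.
by exists n, r.
Qed.

End Semisimple.

Lemma semisimple_surj (A B : pzRingType) (f : {rmorphism A -> B}) :
  (forall y, exists x, f x = y) ->
  semisimple_artinian A -> semisimple_artinian B.
Proof.
move=> fsurj ssA I [I0 ID Ir].
have [|C [rC AE IC]] := ssA (f @^-1` I).
  split=> /= [|x y Ix Iy|x a Ix]; first by rewrite rmorph0.
    by rewrite rmorphD; exact: ID.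
  by rewrite rmorphM; exact: Ir.
have [C0 CD Cr] := rC.
exists (f @` C); split.
- split.
  + by exists 0 => //; rewrite rmorph0.
  + move=> _ _ [x Cx <-] [y Cy <-]; exists (x + y); first exact: CD.
    by rewrite rmorphD.
  + move=> _ a [x Cx <-]; have [b <-] := fsurj a.
    by exists (x * b); [exact: Cr|rewrite rmorphM].
- move=> b; have [a <-] := fsurj b; have [x [y [Ix Cy ->]]] := AE a.
  by exists (f x), (f y); rewrite rmorphD; split=> //; exists y.
- by move=> x Ix [y Cy fy]; rewrite -fy (IC y) ?rmorph0//= fy.
Qed.

(** * Orthogonal and local idempotents *)

Section OrthogonalIdempotents.
Variable A : pzRingType.

Definition no_infinite_idempotents := ~ exists e : nat -> A,
  (forall i, e i * e i = e i /\ e i != 0) /\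
  (forall i j, i != j -> e i * e j = 0).

Definition corner_unit (e x : A) := exists y, [/\ e * y * e = y, x * y = e &
  y * x = e].

(** This says that the ring [e A e] is local, without forming it. *)
Definition local_idempotent (e : A) := [/\ e * e = e, e != 0 &
  forall x, e * x * e = x -> corner_unit e x \/ corner_unit e (e - x)].

Inductive local_sum : A -> Prop :=
| local_sum0 : local_sum 0
| local_sumD e g : local_sum e -> local_idempotent g ->
    e * g = 0 -> g * e = 0 -> local_sum (e + g).

Lemma local_sum_idem e : local_sum e -> e * e = e.
Proof.
elim=> [|{}e g _ ee [gg _ _] eg ge]; first by rewrite mulr0.
by rewrite mulrDl !mulrDr ee gg eg ge add0r addr0.
Qed.

Lemma local_sum1 g : local_idempotent g -> local_sum g.
Proof.
move=> lg; rewrite -[g]add0r; apply: local_sumD => //; first exact: local_sum0.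
- by rewrite mul0r.
- by rewrite mulr0.
Qed.

Lemma local_sum_add e e' : local_sum e -> local_sum e' ->
  e * e' = 0 -> e' * e = 0 -> local_sum (e + e').
Proof.
move=> le; elim=> [|{}e' g le' IH lg e'g ge'] ee' e'e; first by rewrite addr0.
have e'i := local_sum_idem le'; have [gg _ _] := lg.
have E x y : x * (e + (e' + g)) * y = x * e * y + x * (e' + g) * y by ncring.
have h1 : e * e' = 0.
  by rewrite -[RHS](mul0r e') -ee' -mulrA mulrDl e'i ge' addr0.
have h2 : e * g = 0.
  by rewrite -[RHS](mul0r g) -ee' -mulrA mulrDl e'g gg add0r.
have h3 : e' * e = 0.
  by rewrite -[RHS](mulr0 e') -e'e mulrA mulrDr e'i e'g addr0.
have h4 : g * e = 0.
  by rewrite -[RHS](mulr0 g) -e'e mulrA mulrDr ge' gg add0r.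
rewrite addrA; apply: local_sumD => //; first exact: IH.
- by rewrite mulrDl h2 e'g addr0.
- by rewrite mulrDr h4 ge' addr0.
Qed.

(** Injectivity on idempotents is enough, so both the quotient by the Jacobson radical and ring
    embeddings are covered. *)
Lemma no_infinite_idempotents_sub (B : pzRingType) (f : {rmorphism A -> B}) :
  (forall e, e * e = e -> f e = 0 -> e = 0) ->
  ~ (exists e : nat -> B, (forall i, e i * e i = e i /\ e i != 0) /\
      (forall i j, i != j -> e i * e j = 0)) ->
  no_infinite_idempotents.
Proof.
move=> f0 nB [e [eP eo]]; apply: nB; exists (f \o e); split=> [i|i j ij] /=.
  have [ei e0] := eP i; rewrite -rmorphM ei; split=> //.
  by apply: contra_neq e0; exact: f0.
by rewrite -rmorphM eo// rmorph0.
Qed.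

End OrthogonalIdempotents.

(** The partial sums [E n] generate a strictly increasing chain of right ideals. *)
Lemma semisimple_no_infinite_idempotents (A : pzRingType) :
  semisimple_artinian A -> no_infinite_idempotents A.
Proof.
move=> ssA [e [eP eo]]; pose E n := \sum_(i < n) e i.
have eE m n : (m <= n)%N -> e n * E m = 0.
  move=> mn; rewrite mulr_sumr big1// => i _; rewrite eo//.
  by rewrite gtn_eqF// (leq_trans (ltn_ord i)).
have Ee m n : (m <= n)%N -> E m * e n = 0.
  move=> mn; rewrite mulr_suml big1// => i _; rewrite eo//.
  by rewrite ltn_eqF// (leq_trans (ltn_ord i)).
have [||n nE] := @semisimple_acc A ssA (fun n => [set x | E n * x = x]).
- move=> n; split=> /= [|x y xE yE|x a xE]; first by rewrite mulr0.
    by rewrite mulrDr xE yE.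
  by rewrite mulrA xE.
- move=> n x /= xE; rewrite /E big_ord_recr /= -/(E n) mulrDl xE.
  by rewrite -xE mulrA eE// mul0r addr0.
have [en] := eP n; case/eqP; rewrite -(nE n.+1 (e n)) /=.
  exact: Ee.
by rewrite /E big_ord_recr /= -/(E n) mulrDl Ee// add0r en.
Qed.

Lemma semilocal_no_infinite_idempotents (A : pzRingType) :
  semilocal A -> no_infinite_idempotents A.
Proof.
move=> slA; apply: (@no_infinite_idempotents_sub _ _ (quot_proj (Jac_ideal A))).
  by move=> e ee /quot_proj_eq0; exact: Jac_idempotent.
exact: semisimple_no_infinite_idempotents.
Qed.

Section LocalSemilocal.
Variable A : pzRingType.
Local Notation proj := (quot_proj (Jac_ideal A)).
Local Notation B := (quot_ring (Jac_ideal A)).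

(** As [g a c g] is not a unit of the local ring [g A g], the element [g - g a c g] has an inverse
    [u] there, and [1 + u g a c] is a right inverse of [1 - g a c]. *)
Lemma local_idempotent_Jac (g a : A) : local_idempotent g ->
  (forall c, ~ corner_unit g (g * a * c * g)) -> Jac (g * a).
Proof.
move=> [gg _ loc] na; apply/JacP => c.
have gE : g * (g * a * c * g) * g = g * a * c * g.
  by rewrite !mulrA gg -mulrA gg.
have [/na//|[u [uE zu _]]] := loc _ gE.
exists (1 + u * (g * a * c)); apply/eqP; rewrite -subr_eq0; apply/eqP.
have gu : g * u = u by rewrite -uE !mulrA gg.
transitivity ((g - g * a * c * g) * u * (g * a * c) - (g * g) * a * c
  + (u - g * u) * (g * a * c) + g * a * c * (g * u - u) * (g * a * c)
  + (g * g - g) * a * c); first by ncring.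
by rewrite zu gu gg !subrr !(mulr0, mul0r) !addr0 !mulrA gg subrr.
Qed.

(** In other words, the image of a local idempotent generates a simple right ideal modulo the
    radical. *)
Lemma local_idempotent_simple (g : A) (y : B) : local_idempotent g ->
  proj g * y != 0 -> exists b, proj g * y * b = proj g.
Proof.
have [a <-] := quot_proj_surj y; move=> lg gy0.
have [[c [u [_ zu _]]]|na] := pselect (exists c, corner_unit g (g * a * c * g)).
  by exists (proj (c * g * u)); rewrite -!rmorphM !mulrA zu.
case/eqP: gy0; rewrite -rmorphM; apply/quot_proj_eq0.
by apply: local_idempotent_Jac => // c cu; apply: na; exists c.
Qed.

(** A complement of [I] is built by going through the simple right ideals [proj g B]: each is either
    contained in [I + C] already or meets it in 0, and in the latter case it is added to [C]. *)
Lemma local_sum_semilocal : local_sum (1 : A) -> semilocal A.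
Proof.
suff H (e : A) : local_sum e -> forall I : set B, is_right_ideal I ->
    exists C, [/\ is_right_ideal C, forall x, I x -> C x -> x = 0 &
      forall x, ideal_sum I C (proj e * x)].
  move=> l1 I rI; have [C [rC IC CE]] := H 1 l1 I rI.
  exists C; split=> // x; have := CE x.
  by rewrite rmorph1 mul1r.
elim=> [|{}e g _ IH lg _ _] I rI.
  exists [set 0]; split; first split=> //=.
  - by move=> x y -> ->; rewrite addr0.
  - by move=> x a ->; rewrite mul0r.
  - by move=> x _ ->.
  - move=> x; rewrite rmorph0 mul0r; exists 0, 0; rewrite addr0.
    by case: rI.
have [C [rC IC CE]] := IH I rI.
have rIC := is_right_ideal_sum rI rC; have [_ ICD ICr] := rIC.
have [[y [gy0 ICgy]]|ngy] :=
    pselect (exists y, proj g * y != 0 /\ ideal_sum I C (proj g * y)).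
  have [b gb] := local_idempotent_simple lg gy0.
  exists C; split=> // x; rewrite rmorphD mulrDl; apply: ICD => //.
  by rewrite /= -gb; do 2 apply: (ICr).
have rg := is_right_ideal_principal (proj g).
exists (ideal_sum C (principal_right_ideal (proj g))); split.
- exact: is_right_ideal_sum.
- move=> x Ix [c [_ [Cc [y _ <-] xE]]].
  have gy : proj g * y = 0.
    apply: contrapT => /eqP gy0; apply: ngy; exists y; split=> //.
    exists x, (- c); split=> //; first exact: right_idealN.
    by rewrite xE addrC addKr.
  by apply: IC => //; rewrite xE gy addr0.
- move=> x; rewrite rmorphD mulrDl; have [i [c [Ii Cc ->]]] := CE x.
  exists i, (c + proj g * x); split=> //; last by rewrite addrA.
  by exists c, (proj g * x); split=> //; exists x.
Qed.

End LocalSemilocal.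

(** * Decomposing 1 and lifting idempotents by means of Drazin inverses *)

Section Fitting.
Variables (A : pzRingType) (F : set (set A)).
Hypothesis sepF : separating F.
Hypothesis drA : forall a, exists b, drazin F a b.

(** Every term in the binomial expansion of [(u + v) ^+ (p + q).+1] contains [u ^+ p] or
    [v ^+ q]. *)
Lemma top_nilpotent_sum (u v : A) : u * v = v * u ->
  (u + v) * (u + v) = u + v -> top_nilpotent F u -> top_nilpotent F v ->
  u + v = 0.
Proof.
move=> uv ww nu nv; apply: sepF.2 => J FJ; have iJ := sepF.1 J FJ.
have [J0 JD Jl Jr] := iJ; have [p Jp] := nu J FJ; have [q Jq] := nv J FJ.
have -> : u + v = (u + v) ^+ (p + q).+1.
  by elim: (p + q)%N => // n IH; rewrite exprS -IH.
rewrite exprDn_comm//; elim/big_ind: _ => // i _.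
have Jmul n x : J x -> J (x *+ n).
  by move=> Jx; elim: n => // n IH; rewrite mulrS; exact: JD.
apply: Jmul; have [qi|iq] := leqP q i.
  by apply: Jl; exact: ideal_exp_le qi _.
apply: Jr; apply: ideal_exp_le Jp => //.
by apply: leq_trans (leq_sub2l _ (ltnW iq)); rewrite -addSn addnK leqnSn.
Qed.

Lemma top_nilpotent_idemM (x f : A) : x * f = f * x -> f * f = f ->
  top_nilpotent F x -> top_nilpotent F (x * f).
Proof.
move=> xf ff nx J FJ; have [n Jn] := nx J FJ; exists n.+1.
have [_ _ _ Jr] := sepF.1 J FJ.
rewrite comm_expM_idem//; apply: Jr.
exact: ideal_exp_le (sepF.1 J FJ) (leqnSn n) Jn.
Qed.

(** For [x] in [e A e] with Drazin inverse [b], the idempotent [x * b] lies in [e A e]. Without a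
    proper [g] it is 0 or [e], that is, [x] is topologically nilpotent or a unit of [e A e]. By
    [top_nilpotent_sum], [x] and [e - x] cannot both be topologically nilpotent, so [e] is local. *)
Lemma split_idempotent (e : A) : e * e = e -> e != 0 -> ~ local_idempotent e ->
  exists g, [/\ g * g = g, e * g = g, g * e = g, g != 0 & g != e].
Proof.
move=> ee e0 nloc; apply: contrapT => ng.
have corner x : e * x * e = x -> e * x = x /\ x * e = x.
  by move=> <-; rewrite !mulrA ee -!mulrA ee.
have fit x : e * x * e = x -> corner_unit e x \/ top_nilpotent F x.
  move=> xE; have [ex xe] := corner x xE; have [b db] := drA x.
  have [xb bxb nil] := db.
  have be : b * e = e * b by apply: (drazin_comm db sepF); rewrite ex xe.
  have eb : e * b = b.
    by rewrite -[in LHS]bxb !mulrA -be -(mulrA b e) ex bxb.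
  have [xb0|xb0] := eqVneq (x * b) 0.
    by right; move: nil; rewrite -mulrA xb0 mulr0 subr0.
  left; have [xbe|xbe] := eqVneq (x * b) e.
    by exists b; rewrite -xb eb be eb.
  exfalso; apply: ng; exists (x * b); split=> //.
  - exact: drazin_idem db.
  - by rewrite mulrA ex.
  - by rewrite -mulrA be eb.
apply: nloc; split=> // x xE; have [ex xe] := corner x xE.
have [|nx] := fit x xE; first by left.
have [||ny] := fit (e - x); first by rewrite mulrBr mulrBl ee ex ee xe.
  by right.
case/eqP: e0; rewrite -(subrK x e) addrC; apply: top_nilpotent_sum => //.
- by rewrite mulrBl mulrBr ex xe.
- by rewrite addrC subrK.
Qed.

(** When a bad idempotent [e] splits into [g] and [e - g], at least one of the two is bad. So if 1
    is bad there is a strictly decreasing sequence of idempotents, and the differences of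
    consecutive terms are nonzero and orthogonal. *)
Lemma no_infinite_idempotents_local_sum :
  no_infinite_idempotents A -> local_sum (1 : A).
Proof.
move=> nA; apply: contrapT => n1; apply: nA.
pose bad (e : A) := e * e = e /\ ~ local_sum e.
have step (e : {e : A | bad e}) : {e' : {e' : A | bad e'} |
    [/\ sval e * sval e' = sval e', sval e' * sval e = sval e' &
        sval e' != sval e]}.
  case: e => e [ee ne]; apply: cid => /=.
  have e0 : e != 0 by apply: contra_notN ne => /eqP ->; exact: local_sum0.
  have [|g [gg eg ge g0 gne]] := split_idempotent ee e0.
    by apply: contra_not ne; exact: local_sum1.
  have hh : (e - g) * (e - g) = e - g.
    by rewrite mulrBr !mulrBl ee eg ge gg subrr subr0.
  have [lg|ng] := pselect (local_sum g); last first.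
    by exists (exist _ g (conj gg ng)).
  have nh : ~ local_sum (e - g).
    move=> lh; apply: ne; rewrite -(subrK g e); apply: local_sum_add => //.
      by rewrite mulrBl eg gg subrr.
    by rewrite mulrBr ge gg subrr.
  exists (exist _ (e - g) (conj hh nh)); split=> /=.
  - by rewrite mulrBr ee eg.
  - by rewrite mulrBl ee ge.
  - by rewrite -subr_eq0 addrAC subrr sub0r oppr_eq0.
have bad1 : bad 1 by split; rewrite ?mulr1.
have [f [_ fS]] := dependent_choice step (exist _ 1 bad1).
pose e n := sval (f n).
have ei n : e n * e n = e n by case: (svalP (f n)).
have ele m n : (m <= n)%N -> e m * e n = e n /\ e n * e m = e n.
  move=> /subnK <-; elim: (n - m)%N => [|k [IHl IHr]]; first by rewrite ei.
  have [h1 h2 _] := fS (k + m)%N; rewrite addSn; split.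
    by rewrite /e -h1 mulrA IHl.
  by rewrite /e -h2 -mulrA IHr.
exists (fun n => e n - e n.+1); split=> [n|i j ij].
  have [h1 h2 h3] := fS n; split; last by rewrite subr_eq0 eq_sym.
  by rewrite mulrBr !mulrBl !ei h1 h2 subrr subr0.
pose d n := e n - e n.+1; rewrite -!/(d _).
suff {i j ij} H i j : (i < j)%N -> d i * d j = 0 /\ d j * d i = 0.
  by case: (ltngtP i j) ij => // /H[].
move=> ij; rewrite /d.
have [h1 h1'] := ele _ _ (ltnW ij); have [h2 h2'] := ele _ _ ij.
have [h3 h3'] := ele _ _ (leqW (ltnW ij)); have [h4 h4'] := ele _ _ (leqW ij).
rewrite !mulrBl !mulrBr h1 h2 h3 h4 h1' h2' h3' h4'.
by rewrite !subrr.
Qed.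

(** The lift is the Drazin idempotent [a * b]. The rest [g := a - a * a * b] is idempotent modulo
    the radical and topologically nilpotent. Hence [1 - g] is invertible: on the idempotent [f]
    where [1 - g] is topologically nilpotent, so is [g], and [f = 0] by [top_nilpotent_sum]. Then
    [g = - c * (g * g - g)] lies in the radical. *)
Lemma idempotents_lift_Jac : idempotents_lift (@Jac A).
Proof.
have [J0 JD Jl Jr] := is_ideal_Jac A.
have JN (x : A) : Jac x -> Jac (- x).
  by move=> Jx; exact: is_idealN (is_ideal_Jac A) Jx.
move=> a Ja; have [b db] := drA a; have [ab bab nil] := db.
exists (a * b); split; first exact: drazin_idem db.
pose g := a - a * a * b.
have ga : GRing.comm a g.
  by apply: commrB => //; apply: commrM => //; apply: commrM.
have gg : Jac (g * g - g).
  have -> : g * g - g = (1 - a * b) * (a * a - a).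
    have fa : a * (1 - a * b) = (1 - a * b) * a.
      by rewrite mulrBr mulrBl mulr1 mul1r {1}ab mulrA.
    have ff : (1 - a * b) * (1 - a * b) = 1 - a * b.
      exact/idem_compl/drazin_idem/db.
    have gE : g = (1 - a * b) * a by rewrite -fa /g; ncring.
    have fg : (1 - a * b) * g = g by rewrite gE mulrA ff.
    have -> : g * g = g * a by rewrite {1}gE -mulrA ga mulrA fg.
    by rewrite mulrBr mulrA -gE.
  exact: Jl.
have Jg : Jac g.
  have [c dc] := drA (1 - g); have [gc cgc nilc] := dc.
  have gC : g * c = c * g.
    symmetry; apply: (drazin_comm dc sepF).
    by apply: commr_sym; apply: commrB => //; exact: commr1.
  pose f := 1 - (1 - g) * c.
  have ff : f * f = f.
    exact/idem_compl/drazin_idem/dc.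
  have gf : GRing.comm g f.
    apply: commrB; first exact: commr1.
    by apply: commrM => //; apply: commrB => //; exact: commr1.
  have f0 : (1 - g) * f + g * f = 0.
    have fE : (1 - g) * f + g * f = f by rewrite -mulrDl subrK mul1r.
    apply: top_nilpotent_sum; rewrite ?fE//.
    - have C1 : GRing.comm (1 - g) g.
        by apply: commr_sym; apply: commrB => //; exact: commr1.
      have C2 : GRing.comm (1 - g) f.
        by apply: commr_sym; apply: commrB; [exact: commr1|].
      apply: commrM; apply: commr_sym; apply: commrM => //; exact: commr_sym.
    - have -> : (1 - g) * f = 1 - g - (1 - g) * (1 - g) * c.
        by rewrite /f; ncring.
      by [].
    - exact: top_nilpotent_idemM.
  have : 1 - (1 - g) * c = 0 by rewrite -/f -f0 -mulrDl subrK mul1r.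
  move=> /eqP; rewrite subr_eq0 gc => /eqP c1.
  have -> : g = - (c * (g * g - g)).
    by rewrite -[LHS]mul1r c1; ncring.
  by apply: JN; exact: Jl.
have -> : a * b - a = - (b * (a * a - a)) - g + (b * a * a - a * a * b)
    + (a * b - b * a) by rewrite /g; ncring.
rewrite -ab -(mulrA a b) -ab mulrA !subrr !addr0.
by apply: JD; apply: JN => //; exact: Jl.
Qed.

End Fitting.

Lemma semiperfect_of_drazin (A : pzRingType) (F : set (set A)) :
  separating F -> (forall a, exists b, drazin F a b) ->
  no_infinite_idempotents A -> semiperfect A.
Proof.
move=> sepF drA nA; split; last exact: idempotents_lift_Jac drA.
apply: local_sum_semilocal.
exact: no_infinite_idempotents_local_sum drA nA.
Qed.

(** * Quotients and matrix rings *)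

Section Quotients.
Variables (A B : pzRingType) (f : {rmorphism A -> B}).
Hypothesis fsurj : forall y, exists x, f x = y.

Lemma semilocal_surj : semilocal A -> semilocal B.
Proof.
move=> slA; 
pose pA : {rmorphism A -> quot_ring (Jac_ideal A)} := quot_proj _.
pose pB : {rmorphism B -> quot_ring (Jac_ideal B)} := quot_proj _.
have [|x /quot_proj_eq0 Jx|h hE] := @rmorph_factor _ _ _ pA (pB \o f).
- exact: quot_proj_surj.
- by apply/quot_proj_eq0; exact: Jac_rmorph.
apply: (semisimple_surj (f := h)) slA => y.
have [b <-] := quot_proj_surj y; have [a <-] := fsurj b.
by exists (pA a); rewrite hE.
Qed.

(* The ideal f^-1(Jac B) is generated modulo Jac A by some z in ker f. *)
Lemma Jac_preimage : semilocal A -> exists z, [/\ f z = 0, Jac (z * z - z) &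
  forall x, Jac (f x) -> Jac (x - z * x)].
Proof.
move=> slA; pose pA : {rmorphism A -> quot_ring (Jac_ideal A)} := quot_proj _.
have JpA x : pA x = 0 <-> Jac x by exact: quot_proj_eq0 (Jac_ideal A) x.
have [J0 JD Jl Jr] := is_ideal_Jac A.
pose I := [set y | exists2 x, f x = 0 & pA x = y].
have rI : is_right_ideal I.
  split=> [|_ _ [x fx <-] [y fy <-]|_ a [x fx <-]].
  - by exists 0; rewrite rmorph0.
  - by exists (x + y); rewrite !rmorphD// fx fy addr0.
  - have [b <-] := quot_proj_surj a.
    by exists (x * b); rewrite !rmorphM// fx mul0r.
have [_ [[z fz <-] zz zI]] := semisimple_idem slA rI.
have Jker x : f x = 0 -> Jac (x - z * x).
  move=> fx; apply/JpA; rewrite rmorphB rmorphM.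
  by apply/eqP; rewrite subr_eq0 eq_sym; apply/eqP; apply: zI; exists x.
exists z; split=> //.
  apply/JpA; rewrite rmorphB rmorphM.
  by apply/eqP; rewrite subr_eq0; apply/eqP.
move=> x Jfx.
(* [K] is [Jac A + ker f]. The ring [A / K] is a quotient of [A / Jac A], hence semisimple, and it
   is a quotient of [B], so [Jac B] vanishes in it. Therefore [x] lies in [K]. *)
pose K : set A := [set x | exists2 k, f k = 0 & Jac (x - k)].
have iK : is_ideal K.
  split=> [|u v [k fk Jk] [l fl Jl']|a u [k fk Jk]|u a [k fk Jk]].
  - by exists 0; rewrite ?rmorph0 ?subr0.
  - exists (k + l); first by rewrite rmorphD fk fl addr0.
    by rewrite opprD addrACA; exact: JD.
  - exists (a * k); first by rewrite rmorphM fk mulr0.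
    by rewrite -mulrBr; exact: Jl.
  - exists (k * a); first by rewrite rmorphM fk mul0r.
    by rewrite -mulrBl; exact: Jr.
pose q : {rmorphism A -> quot_ring (Ideal iK)} := quot_proj _.
have qE u : q u = 0 <-> K u by exact: quot_proj_eq0 (Ideal iK) u.
have [|u /JpA Ju|h hE] := @rmorph_factor _ _ _ pA q.
- exact: quot_proj_surj.
- by apply/qE; exists 0; rewrite ?rmorph0 ?subr0.
have ssq : semisimple_artinian (quot_ring (Ideal iK)).
  apply: (semisimple_surj (f := h)) slA => y.
  by have [a <-] := quot_proj_surj y; exists (pA a); rewrite hE.
have [|u fu|g gE] := @rmorph_factor _ _ _ f q.
- exact: fsurj.
- by apply/qE; exists u; rewrite ?subrr.
have : q x = 0.
  apply: semisimple_Jac ssq _ _; rewrite -gE; apply: Jac_rmorph Jfx.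
  by move=> y; have [a <-] := quot_proj_surj y; exists (f a); rewrite gE.
move=> /qE[k fk Jk].
have -> : x - z * x = (x - k) - z * (x - k) + (k - z * k) by ncring.
apply: (JD); last exact: Jker.
by apply: JD => //; apply: is_idealN (is_ideal_Jac A) _; exact: Jl.
Qed.

Lemma Jac_surj (y : B) : semilocal A -> Jac y -> exists2 x, Jac x & f x = y.
Proof.
move=> slA Jy; have [x fx] := fsurj y; have [z [fz _ zJ]] := Jac_preimage slA.
exists (x - z * x); first by apply: zJ; rewrite fx.
by rewrite rmorphB rmorphM fz mul0r subr0.
Qed.

Lemma semiperfect_surj : semiperfect A -> semiperfect B.
Proof.
move=> [slA liftA]; split; first exact: semilocal_surj.
move=> b Jb; have [a fa] := fsurj b; have [z [fz zz zJ]] := Jac_preimage slA.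
have [J0 JD Jl Jr] := is_ideal_Jac A.
have zero_z x : Jac (f x) -> Jac ((1 - z) * x).
  by move=> /zJ; rewrite mulrBl mul1r.
(* A preimage [a] of [b] need not be idempotent modulo [Jac A]. The preimage [(1 - z) * a] is,
   because [1 - z] multiplies the preimage of [Jac B] into [Jac A]. *)
have [|e [ee Je]] := liftA ((1 - z) * a).
  have -> : (1 - z) * a * ((1 - z) * a) - (1 - z) * a =
      (1 - z) * (a * a - a) - (1 - z) * (a * z * a) by ncring.
  apply: (JD); first by apply: zero_z; rewrite rmorphB rmorphM fa.
  apply: is_idealN (is_ideal_Jac A) _; apply: zero_z.
  by rewrite !rmorphM fz mulr0 mul0r; have [] := is_ideal_Jac B.
exists (f e); split; first by rewrite -rmorphM ee.
have <- : f ((1 - z) * a) = b by rewrite rmorphM rmorphB rmorph1 fz subr0 mul1r.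
by rewrite -rmorphB; exact: Jac_rmorph.
Qed.

End Quotients.

Section LocalMatrix.
Variables (A : pzRingType) (n : nat).

Let sd (j : 'I_n) (x : A) : 'M[A]_n := x *: delta_mx j j.

Let sdE j x i k : sd j x i k = if (i == j) && (k == j) then x else 0.
Proof. by rewrite !mxE; case: ifP; rewrite ?mulr1 ?mulr0. Qed.

Let sdM j x y : sd j x * sd j y = sd j (x * y).
Proof.
apply/matrixP => i k; rewrite mxE (bigD1 j)//= !sdE eqxx andbT big1.
  by rewrite addr0; do 2 case: (_ == j); rewrite ?mulr0 ?mul0r.
by move=> l lj; rewrite sdE (negbTE lj) andbF mul0r.
Qed.

Let sdM0 i j x y : i != j -> sd i x * sd j y = 0.
Proof.
move=> ij; apply/matrixP => k l; rewrite !mxE big1// => m _.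
rewrite !sdE; have [->|mi] := eqVneq m i; last by rewrite andbF mul0r.
by rewrite (negbTE ij) mulr0.
Qed.

Let sdMM j x y (X : 'M[A]_n) : sd j x * X * sd j y = sd j (x * X j j * y).
Proof.
apply/matrixP => i k; rewrite mxE (bigD1 j)//= !sdE eqxx big1; last first.
  by move=> l lj; rewrite sdE (negbTE lj) mulr0.
rewrite addr0 mxE (bigD1 j)//= !sdE eqxx andbT big1; last first.
  by move=> l lj; rewrite sdE (negbTE lj) andbF mul0r.
by rewrite addr0; case: (i == j); case: (k == j); rewrite ?mulr0 ?mul0r.
Qed.

Let sd_inj j x y : sd j x = sd j y -> x = y.
Proof. by move=> /matrixP/(_ j j); rewrite !sdE eqxx. Qed.

Let sd0 j : sd j 0 = 0. Proof. exact: scale0r. Qed.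

(** The corner of the matrix ring at [sd j g] is a copy of [g A g], embedded by [sd j]. *)
Lemma local_idempotent_matrix j (g : A) :
  local_idempotent g -> local_idempotent (sd j g).
Proof.
move=> [gg g0 loc]; split; first by rewrite sdM gg.
  by apply: contra_neq g0; rewrite -(sd0 j); exact: sd_inj.
move=> X XE; rewrite sdMM in XE; set x := g * X j j * g in XE.
have gx : g * x * g = x by rewrite /x !mulrA gg -!mulrA gg.
have unit_sd y : corner_unit g y -> corner_unit (sd j g) (sd j y).
  by move=> [u [gu yu uy]]; exists (sd j u); rewrite !sdM gu yu uy.
rewrite -XE; have [ux|ux] := loc x gx; first by left; exact: unit_sd.
right; have -> : sd j g - sd j x = sd j (g - x) by rewrite /sd scalerBl.
exact: unit_sd.
Qed.

(** Every [sd j 1] decomposes as 1 does in [A]. Together with [local_sum_semilocal] this makes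
    matrix rings semilocal. *)
Lemma local_sum_matrix : local_sum (1 : A) -> local_sum (1 : 'M[A]_n).
Proof.
move=> l1.
have lsd j e : local_sum e -> local_sum (sd j e).
  elim=> [|{}e g le IH lg eg ge]; first by rewrite sd0; exact: local_sum0.
  have -> : sd j (e + g) = sd j e + sd j g by rewrite /sd scalerDl.
  apply: local_sumD; rewrite ?sdM ?eg ?ge//.
  exact: local_idempotent_matrix.
have -> : (1 : 'M[A]_n) = \sum_j sd j 1.
  apply/matrixP => i k; rewrite summxE (bigD1 i)//= big1.
    by rewrite sdE eqxx addr0 mxE eq_sym; case: eqVneq.
  by move=> j ji; rewrite sdE eq_sym (negbTE ji).
have : forall s : seq 'I_n, uniq s -> local_sum (\sum_(j <- s) sd j 1).
  elim=> [|j s IH] /=; first by rewrite big_nil => _; exact: local_sum0.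
  move=> /andP[js us]; rewrite big_cons; apply: local_sum_add.
  - exact: lsd.
  - exact: IH.
  - rewrite mulr_sumr big_seq big1// => i si; rewrite sdM0//.
    by apply: contraNneq js => ->.
  - rewrite mulr_suml big_seq big1// => i si; rewrite sdM0//.
    by apply: contraNneq js => <-.
by move=> /(_ _ (index_enum_uniq _)).
Qed.

End LocalMatrix.

(** * Nil subsets and T-nilpotence *)

Section NilSubset.
Variable A : pzRingType.
Hypothesis ssA : semisimple_artinian A.
Variable N : set A.
Hypothesis NM : forall x y, N x -> N y -> N (x * y).
Hypothesis Nnil : forall x, N x -> exists n, x ^+ n = 0.
Implicit Types W : set A.

Let stable W := is_right_ideal W /\ forall x w, N x -> W w -> W (x * w).

(** The right ideal generated by [N W], as an intersection: an inclusion is then proved by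
    exhibiting a single right ideal [U]. *)
Definition span_mul W : set A := [set z | forall U, is_right_ideal U ->
  (forall x w, N x -> W w -> U (x * w)) -> U z].

Lemma span_mulP W x w : N x -> W w -> span_mul W (x * w).
Proof. by move=> Nx Ww U rU; exact. Qed.

Lemma is_right_ideal_span_mul W : is_right_ideal (span_mul W).
Proof.
split=> [U [U0 _ _] //|x y Wx Wy U rU NW|x a Wx U rU NW]; have [_ UD Ur] := rU.
- by apply: UD; [exact: Wx|exact: Wy].
- by apply: Ur; exact: Wx.
Qed.

Lemma stable_span_mul W : stable (span_mul W).
Proof.
split; first exact: is_right_ideal_span_mul.
move=> x w Nx Sw; apply: (Sw [set s | span_mul W (x * s)]); last first.
  by move=> y v Ny Wv /=; rewrite mulrA; apply: span_mulP => //; exact: NM.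
have [S0 SD Sr] := is_right_ideal_span_mul W.
split=> /= [|u v Su Sv|u a Su]; first by rewrite mulr0.
  by rewrite mulrDr; exact: SD.
by rewrite mulrA; exact: Sr.
Qed.

Let principal_image (a : A) W : set A := [set a * w | w in W].

Let right_image a W : is_right_ideal W -> is_right_ideal (principal_image a W).
Proof.
move=> [W0 WD Wr]; split=> [|_ _ [x Wx <-] [y Wy <-]|_ b [x Wx <-]].
- by exists 0; rewrite ?mulr0.
- by exists (x + y); rewrite ?mulrDr//; exact: WD.
- by exists (x * b); rewrite ?mulrA//; exact: Wr.
Qed.

(* Let V be maximal among the N-stable right ideals properly inside W, choose a
   in N with a W + V minimal subject to a W not inside V. As a y is nilpotent,
   a y a W + V < a W + V for y in N, so a N a W <= V by minimality. Then
   N a W <= V by maximality of V, hence W = a W + V and N W <= V. *)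
Lemma span_mul_proper W : stable W -> W `<=` span_mul W -> W `<=` [set 0].
Proof.
move=> [rW sW] WN; apply: contrapT => W0; have [W00 WD Wr] := rW.
pose P V := [/\ stable V, V `<=` W & ~ W `<=` V].
have Pr V : P V -> is_right_ideal V by case=> [[]].
have P0 : P [set 0].
  split=> [|_ ->|] //; split=> [|x _ _ ->]; last exact: mulr0.
  by split=> //= [x y -> ->|x b ->]; rewrite ?addr0 ?mul0r.
have [V [[rV sV] VW nWV] Vmax] := semisimple_max ssA Pr P0.
have [V0 VD Vr] := rV.
have maxE Z : stable Z -> V `<=` Z -> Z `<=` W -> ~ Z `<=` V -> W `<=` Z.
  move=> sZ VZ ZW nZV; apply: contrapT => nWZ; apply: nZV.
  exact: Vmax.
pose Q U := exists a, [/\ N a, ~ principal_image a W `<=` V &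
  U = ideal_sum (principal_image a W) V].
have Qr U : Q U -> is_right_ideal U.
  by move=> [a [_ _ ->]]; apply: is_right_ideal_sum => //; exact: right_image.
have [a0 Na0 na0] : exists2 a, N a & ~ principal_image a W `<=` V.
  apply: contrapT => na; apply: nWV; apply: subset_trans WN _ => z; apply=> //.
  move=> x w Nx Ww; apply: contrapT => nV; apply: na; exists x => // xV.
  by apply: nV; apply: xV; exists w.
have Q0 : Q (ideal_sum (principal_image a0 W) V) by exists a0.
have [_ [a [Na naV ->]] amin] := semisimple_min ssA Qr Q0.
have raW := right_image a rW.
(* Otherwise minimality gives [a W <= a y a W + V]. Iterating, [a W <= (a y)^n a W + V] for all n,
   and since [a y] is nilpotent [a W <= V], a contradiction. *)
have aya y w : N y -> W w -> V (a * y * a * w).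
  move=> Ny; move: w; apply: contrapT => nV.
  have Naya : N (a * y * a) by do 2 apply: (NM) => //.
  have sub : ideal_sum (principal_image a W) V `<=`
      ideal_sum (principal_image (a * y * a) W) V.
    apply: amin.
      exists (a * y * a); split=> // ayaV; apply: nV => w Ww.
      by apply: ayaV; exists w.
    move=> _ [_ [v [[w Ww <-] Vv ->]]]; exists (a * (y * (a * w))), v.
    split=> //; last by rewrite !mulrA.
    by exists (y * (a * w)) => //; do 2 apply: (sW) => //.
  have sVk k v : V v -> V ((a * y) ^+ k * v).
    move=> Vv; elim: k => [|k IH]; first by rewrite mul1r.
    by rewrite exprS -mulrA; apply: (sV) => //; exact: NM.
  have [n ayn] := Nnil (NM Na Ny).
  apply: naV => _ [w Ww <-].
  suff [w' [v [Ww' Vv ->]]] : exists w' v,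
      [/\ W w', V v & a * w = (a * y) ^+ n * (a * w') + v].
    by rewrite ayn mul0r add0r.
  elim: n {ayn} => [|k [w' [v [Ww' Vv ->]]]].
    by exists w, 0; rewrite mul1r addr0.
  have [|_ [v' [[w'' Ww'' <-] Vv' ->]]] := sub (a * w').
    by apply: ideal_sum_subl => //; exists w'.
  exists w'', ((a * y) ^+ k * v' + v); split=> //.
    by apply: (VD) => //; exact: sVk.
  by rewrite mulrDr addrA exprSr !mulrA.
have aN y w : N y -> W w -> V (y * (a * w)).
  move=> Ny Ww.
  pose Z := ideal_sum (span_mul (principal_image a W)) V.
  have [rS sS] := stable_span_mul (principal_image a W).
  have sZ : stable Z.
    split; first exact: is_right_ideal_sum.
    move=> x _ Nx [s [v [Ss Vv ->]]]; exists (x * s), (x * v).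
    by rewrite mulrDr; split=> //; [exact: sS|exact: sV].
  have [ZV|nZV] := pselect (Z `<=` V).
    by apply: ZV; apply: ideal_sum_subl => //; apply: span_mulP => //; exists w.
  exfalso; apply: naV => _ [u Wu <-].
  have WZ : W `<=` Z.
    apply: maxE => //; first exact: ideal_sum_subr.
    move=> _ [s [v [Ss Vv ->]]]; apply: (WD); last exact: VW.
    by apply: Ss => // x _ Nx [w' Ww' <-]; do 2 apply: (sW) => //.
  have [s [v [Ss Vv ->]]] := WZ u Wu.
  rewrite mulrDr; apply: (VD); last exact: sV.
  apply: (Ss [set s | V (a * s)]).
    split=> /= [|x y' Vx Vy'|x b Vx]; first by rewrite mulr0.
      by rewrite mulrDr; exact: VD.
    by rewrite mulrA; exact: Vr.
  by move=> x _ Nx [w' Ww' <-] /=; rewrite !mulrA; exact: aya.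
have WZ : W `<=` ideal_sum (principal_image a W) V.
  apply: maxE.
  - split; first exact: is_right_ideal_sum.
    move=> x _ Nx [_ [v [[w Ww <-] Vv ->]]].
    apply: ideal_sum_subr => //; rewrite mulrDr; apply: (VD); last exact: sV.
    exact: aN.
  - exact: ideal_sum_subr.
  - move=> _ [_ [v [[w Ww <-] Vv ->]]]; apply: (WD); last exact: VW.
    exact: sW.
  - move=> ZV; apply: naV; apply: subset_trans ZV; exact: ideal_sum_subl.
apply: nWV; apply: subset_trans WN _ => z; apply=> // x w Nx Ww.
have [_ [v [[w' Ww' <-] Vv ->]]] := WZ w Ww.
by rewrite mulrDr; apply: (VD); [exact: aN|exact: sV].
Qed.

(** The right ideals generated by [n]-fold products from [N] decrease, hence stabilize, and by
    [span_mul_proper] the stable value is 0. *)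
Lemma nil_subset_nilpotent : exists l, forall s : seq A,
  (forall x, x \in s -> N x) -> size s = l -> \prod_(x <- s) x = 0.
Proof.
pose W := fix W n := if n is m.+1 then span_mul (W m) else setT.
have sW n : stable (W n).
  elim: n => [|n [rW sW]]; first by split.
  exact: stable_span_mul.
have [n|n|n nW] := @semisimple_dcc _ ssA W.
- by case: (sW n).
- by move=> z /=; apply; [case: (sW n)|move=> x w Nx Ww; apply: (sW n).2].
have {}nW := span_mul_proper (sW n) nW.
exists n => s sN sn; apply: nW; rewrite -sn {sn}.
elim: s sN => [|x s IH] sN //=; rewrite big_cons; apply: span_mulP.
  by apply: sN; rewrite mem_head.
by apply: IH => y ys; apply: sN; rewrite inE ys orbT.
Qed.

End NilSubset.

Section ConverseRing.
Variable A : pzRingType.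

Lemma expr_conv (x : A) n : (x : A^c) ^+ n = x ^+ n.
Proof. by elim: n => // n IH; rewrite exprS [RHS]exprSr IH. Qed.

(** The equations of a Drazin inverse are self-dual. *)
Lemma pi_regular_conv : pi_regular A -> pi_regular A^c.
Proof.
move=> /pi_regularP drA; apply/pi_regularP => a.
have [b /drazinP[ab bab [n an]]] := drA a; exists b.
apply/drazinP; split; first exact: esym.
  by change ((b : A) * ((a : A) * (b : A)) = b); rewrite mulrA.
exists n; rewrite expr_conv.
change (((a : A) - (b : A) * ((a : A) * (a : A))) ^+ n = 0).
by rewrite mulrA -ab -mulrA -ab mulrA.
Qed.

End ConverseRing.

Section TNilpotence.

Definition rev_prod (A : pzRingType) (x : nat -> A) :=
  fix pr n := if n is m.+1 then x m * pr m else 1.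

Lemma rev_prodE (A : pzRingType) (x : nat -> A) n :
  \prod_(i < n) x (n - i.+1)%N = rev_prod x n.
Proof.
elim: n => [|n IH]; first by rewrite big_ord0.
by rewrite big_ord_recl /= subSS subn0 -IH.
Qed.

Lemma rev_prod_seq (A : pzRingType) (x : nat -> A) n :
  rev_prod x n = \prod_(y <- rev (mkseq x n)) y.
Proof.
elim: n => [|n IH]; first by rewrite big_nil.
by rewrite mkseqS rev_rcons big_cons -IH.
Qed.

Lemma rev_prodD (A : pzRingType) (x : nat -> A) m n :
  rev_prod x (m + n) = rev_prod (fun i => x (m + i)%N) n * rev_prod x m.
Proof.
elim: n => [|n IH]; first by rewrite addn0 mul1r.
by rewrite addnS /= IH mulrA.
Qed.

Lemma right_T_nilpotentP (A : pzRingType) (J : set A) : right_T_nilpotent J <->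
  forall x, (forall i, J (x i)) -> exists n, rev_prod x n = 0.
Proof.
split=> JT x Jx; have [N NE] := JT x Jx; exists N.
  by rewrite -rev_prodE NE.
by move=> n /subnKC <-; rewrite rev_prodE rev_prodD NE mulr0.
Qed.

Lemma left_T_nilpotent_conv (A : pzRingType) (J : set A) :
  left_T_nilpotent J <-> @right_T_nilpotent A^c J.
Proof.
have E (x : nat -> A) n :
    \prod_(i < n) (x (n - i.+1)%N : A^c) = \prod_(i < n) x i.
  rewrite (rev_prodE (x : nat -> A^c)).
  elim: n => [|n IH]; first by rewrite big_ord0.
  by rewrite big_ord_recr /= -IH.
split=> JT x Jx; have [N NE] := JT x Jx; exists N => n Nn.
  by rewrite E NE.
by rewrite -E NE.
Qed.

Lemma nilpotent_right_T (A : pzRingType) (J : set A) :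
  nilpotent_ideal J -> right_T_nilpotent J.
Proof.
move=> [n Jn] x Jx; exists n => m /subnKC <-.
by rewrite big_split_ord /= Jn ?mul0r.
Qed.

Lemma nilpotent_idealP (A : pzRingType) (J : set A) : nilpotent_ideal J <->
  exists n, forall s : seq A, (forall x, x \in s -> J x) -> size s = n ->
    \prod_(x <- s) x = 0.
Proof.
split=> [[n Jn]|[n Jn]]; exists n.
  move=> s Js sn; rewrite (big_nth 0) big_mkord sn; apply: Jn => i.
  by apply: Js; rewrite mem_nth// sn.
move=> x Jx; rewrite -(big_map x predT id) Jn//.
  by move=> _ /mapP[i _ ->].
by rewrite size_map /index_enum -enumT size_enum_ord.
Qed.

(* In the colimit of A -> A -> A -> ... along left multiplication by a, with
   [r]_j = [a r]_(j+1), the equation below reads [1]_j = [r]_0 + [z]_g: modulo J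
   the colimit is generated by its stage 0, hence so is the colimit, by the
   Nakayama lemma for T-nilpotent J. *)
Section Colimit.
Variables (A : pzRingType) (J : set A) (a b : A) (s : nat).
Hypotheses (iJ : is_ideal J) (Jab : J (a ^+ s - a ^+ s.+1 * b)).

Definition colimit_step j g z r := J z /\ exists T,
  [/\ (j <= T)%N, (g <= T)%N & a ^+ (T - j) = a ^+ T * r + a ^+ (T - g) * z].

(** Since [a ^+ s = a ^+ s.+1 * b + y] with [y] in [J], in the colimit [1]_(j+1) = [b]_j +
    [y]_(s+1+j). The induction hypothesis multiplied by [b] rewrites [b]_j, and [g'] is a stage at
    which both remainders live. *)
Lemma colimit_step_exists j : exists g z r, colimit_step j g z r.
Proof.
have [J0 JD Jl Jr] := iJ; pose y := a ^+ s - a ^+ s.+1 * b.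
elim: j => [|j [g [z [r [Jz [T [jT gT TE]]]]]]].
  by exists 0%N, 0, 1; split=> //; exists 0%N; rewrite mulr1 mulr0 addr0.
pose g' := maxn g (s.+1 + j).
exists g', (a ^+ (g' - g) * z * b + a ^+ (g' - (s.+1 + j)) * y), (r * b).
split; first by apply: JD; [apply: Jr|]; exact: Jl.
have g'T : (g' <= s.+1 + T)%N.
  by rewrite geq_max leq_add2l jT andbT (leq_trans gT)// leq_addl.
exists (s.+1 + T)%N; split=> //.
  by rewrite addSn ltnS (leq_trans jT)// leq_addl.
have -> : (s.+1 + T - j.+1 = (T - j) + s)%N.
  by rewrite addSn subSS addnC addnBAC.
have shift k : (k <= g')%N ->
    a ^+ (s.+1 + T - g') * a ^+ (g' - k) = a ^+ (s.+1 + T - k).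
  by move=> kg; rewrite -exprD addnBA// subnK.
rewrite mulrDr !mulrA !shift ?leq_maxl ?leq_maxr// subnDl.
have -> : a ^+ (T - j + s) = a ^+ (T - j) * (a ^+ s.+1 * b + y).
  by rewrite exprD; congr (_ * _); rewrite /y addrC subrK.
rewrite mulrDr addrA mulrA -exprD addnC exprD TE; congr (_ + _).
rewrite mulrDr mulrDl !mulrA -exprD; congr (_ + _ * _ * _).
by rewrite -exprD addnBA.
Qed.

(** Starting from [1]_1, the remainder is rewritten again and again; after [k] rounds it is a
    product of [k] elements of [J]. Once this product vanishes, [1]_1 = [rho]_0, which reads
    [a ^+ T.-1 = a ^+ T * rho]. *)
Lemma T_nilpotent_pi_regular_at : right_T_nilpotent J ->
  right_pi_regular_at a.
Proof.
move=> /right_T_nilpotentP JT.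
have /choice[G /choice[Z /choice[r GZ]]] := colimit_step_exists.
pose g := fix g n := if n is m.+1 then G (g m) else 1%N.
have [|N N0] := JT (Z \o g); first by move=> i; case: (GZ (g i)).
suff H k : exists rho T, [/\ (0 < T)%N, (g k <= T)%N &
    a ^+ T.-1 = a ^+ T * rho + a ^+ (T - g k) * rev_prod (Z \o g) k].
  have [rho [T [T0 _]]] := H N; rewrite N0 mulr0 addr0 => TE.
  by exists T.-1, rho; rewrite prednK.
elim: k => [|k [rho [T [T0 gT TE]]]].
  by exists 0, 1%N; rewrite /= mulr0 add0r mulr1.
have [_ [U [gU GU UE]]] := GZ (g k).
exists (rho + r (g k) * rev_prod (Z \o g) k), (U + T)%N; split.
- exact: leq_trans (leq_addl _ _).
- exact: leq_trans (leq_addr _ _).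
have -> : (U + T).-1 = (U + T.-1)%N by rewrite -!subn1 addnBA.
have shift : a ^+ U * a ^+ (T - g k) = a ^+ T * a ^+ (U - g k).
  by rewrite -!exprD !addnBA// addnC.
rewrite exprD TE mulrDr [a ^+ U * (a ^+ (T - _) * _)]mulrA shift UE.
rewrite !mulrDr mulrDl !mulrA -!exprD [(T + U)%N]addnC addrA; congr (_ + _).
by rewrite addnBA 1?addnC.
Qed.

End Colimit.
End TNilpotence.

(** * Subrings and quotients of perfect rings *)

Section PerfectPiRegular.
Variable A : pzRingType.
Hypothesis slA : semilocal A.
Local Notation proj :=
  (quot_proj (Jac_ideal A) : {rmorphism A -> quot_ring (Jac_ideal A)}).

Let projE x : proj x = 0 <-> Jac x.
Proof. exact: quot_proj_eq0 (Jac_ideal A) x. Qed.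

Lemma right_T_nilpotent_pi_regular : right_T_nilpotent (@Jac A) -> pi_regular A.
Proof.
move=> JT; apply/right_pi_regularP => a.
have /right_pi_regularP/(_ (proj a))[s [y]] := semisimple_pi_regular slA.
have [b <-] := quot_proj_surj y => aE.
apply: (T_nilpotent_pi_regular_at (s := s) (b := b)) (is_ideal_Jac A) _ JT.
by apply/projE; rewrite rmorphB rmorphM !rmorphXn -aE subrr.
Qed.

Lemma left_T_nilpotent_pi_regular : left_T_nilpotent (@Jac A) -> pi_regular A.
Proof.
move=> /left_T_nilpotent_conv JT; apply: (pi_regular_conv (A := A^c)).
apply/right_pi_regularP => a.
have /pi_regular_conv/right_pi_regularP/(_ (proj a))[s [y]] :=
  semisimple_pi_regular slA.
have [b <-] := quot_proj_surj y => aE.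
(* The colimit argument works for any T-nilpotent ideal, so [Jac A] serves as an ideal of [A^c]
   without being compared with the radical of [A^c]. *)
apply: (T_nilpotent_pi_regular_at (A := A^c) (s := s) (b := b)) _ _ JT.
  have [J0 JD Jl Jr] := is_ideal_Jac A.
  by split=> // [c x|x c] Jx; [exact: Jr|exact: Jl].
rewrite !expr_conv in aE *; change (Jac ((a : A) ^+ s - b * (a : A) ^+ s.+1)).
by apply/projE; rewrite rmorphB rmorphM !rmorphXn aE subrr.
Qed.

End PerfectPiRegular.

Lemma P_disc_pi_regular Q A : P_disc Q -> Q A -> pi_regular A.
Proof.
have pi1 : pi_infty_regular A -> pi_regular A.
  move=> /(_ 0%N)/pi_regularP drM; apply/pi_regularP => a.
  have [b /drazinP[ab bab [n an]]] := drM (a%:M).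
  have sE (x y : 'M[A]_1) : (x * y) 0 0 = x 0 0 * y 0 0.
    by rewrite mxE big_ord1.
  exists (b 0 0); apply/drazinP; split.
  - by have := congr1 (fun x : 'M_1 => x 0 0) ab; rewrite !sE mxE mulr1n.
  - by have := congr1 (fun x : 'M_1 => x 0 0) bab; rewrite !sE mxE mulr1n.
  - exists n; have := congr1 (fun x : 'M_1 => x 0 0) an.
    set X := _ - _; have XE : X 0 0 = a - a * a * b 0 0.
      have -> : X 0 0 = (a%:M : 'M[A]_1) 0 0 - (a%:M * a%:M * b) 0 0.
        by rewrite /X [LHS]mxE [X in _ + X]mxE.
      by rewrite !sE !mxE !mulr1n.
    rewrite [RHS]mxE -XE => <-; elim: n {an} => [|n IH].
      by rewrite !expr0 mxE eqxx.
    by rewrite !exprS sE IH.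
case=> [[sl Jn]|[sl Jn]|[sl Jn]|[piA _]|piA|[piA _]|piA] //; try exact: pi1.
- by apply: right_T_nilpotent_pi_regular => //; exact: nilpotent_right_T.
- exact: right_T_nilpotent_pi_regular.
- exact: left_T_nilpotent_pi_regular.
Qed.

Section Subring.
Variables (A B : pzRingType) (f : {rmorphism A -> B}).
Hypotheses (finj : forall x, f x = 0 -> x = 0) (piA : pi_regular A).

Lemma semiperfect_inj : semilocal B -> semiperfect A.
Proof.
move=> slB; apply: semiperfect_of_drazin (@separating_null A) _ _.
  exact/pi_regularP.
apply: (no_infinite_idempotents_sub (f := f)) => [e _|]; first exact: finj.
exact: semilocal_no_infinite_idempotents.
Qed.

(** [f] need not send [Jac A] into [Jac B]. But [Jac A] is nil: the Drazin idempotent of an element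
    of [Jac A] lies in [Jac A], hence is 0. So the image of [Jac A] in the semisimple quotient of
    [B] is a nil multiplicative set, and products of [l] elements die there. *)
Lemma Jac_pow_inj : semilocal B -> exists l, forall s : seq A,
  (forall x, x \in s -> Jac x) -> size s = l -> Jac (f (\prod_(x <- s) x)).
Proof.
move=> slB; have [J0 JD Jl Jr] := is_ideal_Jac A.
pose p : {rmorphism B -> quot_ring (Jac_ideal B)} := quot_proj _.
pose N := (p \o f) @` @Jac A.
have [_ _ [x Jx <-] [y Jy <-]|_ [x Jx <-]|l lP] :=
  @nil_subset_nilpotent _ slB N.
- by exists (x * y); [exact: Jl|rewrite rmorphM].
- have [b db] := (pi_regularP A).1 piA x; have /drazinP[xb bxb [n xn]] := db.
  exists n; rewrite -rmorphXn; suff -> : x ^+ n = 0 by rewrite rmorph0.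
  have xb0 : x * b = 0.
    by apply: Jac_idempotent (drazin_idem db) _; exact: Jr.
  by rewrite -xn -mulrA xb0 mulr0 subr0.
exists l => s Js sl; apply/(quot_proj_eq0 (Jac_ideal B)).
rewrite -/(p _) rmorph_prod rmorph_prod -(big_map (p \o f) predT id) lP//.
  by move=> _ /mapP[x /Js Jx ->]; exists x.
by rewrite size_map.
Qed.

Lemma nilpotent_inj : semilocal B -> nilpotent_ideal (@Jac B) ->
  nilpotent_ideal (@Jac A).
Proof.
move=> slB /nilpotent_idealP[n Bn]; have [l lP] := Jac_pow_inj slB.
(* There are [n] blocks of [l] factors, and [f] sends each block into [Jac B]. *)
apply/nilpotent_idealP; exists (n * l)%N => s Js sn; apply: finj.
have [t [Jt tn ->]] : exists t : seq B, [/\ forall y, y \in t -> Jac y,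
    size t = n & f (\prod_(x <- s) x) = \prod_(y <- t) y].
  elim: n s Js sn {Bn} => [|n IH] s Js sn.
    by exists [::]; rewrite (size0nil sn) !big_nil rmorph1.
  have [||t [Jt tn tE]] := IH (drop l s).
  - by move=> x /mem_drop; exact: Js.
  - by rewrite size_drop sn mulSn addKn.
  exists (f (\prod_(x <- take l s) x) :: t); split.
  - move=> y; rewrite inE => /predU1P[->|]; last exact: Jt.
    apply: lP; first by move=> x /mem_take; exact: Js.
    by rewrite size_takel// sn mulSn leq_addr.
  - by rewrite /= tn.
  - by rewrite big_cons -tE -rmorphM -big_cat cat_take_drop.
exact: Bn.
Qed.

Lemma right_T_nilpotent_inj : semilocal B -> right_T_nilpotent (@Jac B) ->
  right_T_nilpotent (@Jac A).
Proof.
move=> slB /right_T_nilpotentP BT; have [l lP] := Jac_pow_inj slB.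
apply/right_T_nilpotentP => x Jx.
pose y k := f (rev_prod (fun i => x (k * l + i)%N) l).
have [k|n yn] := BT y.
  rewrite /y rev_prod_seq; apply: lP; last by rewrite size_rev size_mkseq.
  by move=> z; rewrite mem_rev => /mapP[i _ ->].
exists (n * l)%N; apply: finj; rewrite -yn.
elim: n {yn} => [|n IH]; first by rewrite rmorph1.
by rewrite mulSn addnC rev_prodD rmorphM IH.
Qed.

Lemma left_T_nilpotent_inj : semilocal B -> left_T_nilpotent (@Jac B) ->
  left_T_nilpotent (@Jac A).
Proof.
move=> slB BT; have [l lP] := Jac_pow_inj slB; move=> x Jx.
pose y k := f (\prod_(i < l) x (k * l + i)%N).
have [k|N yN] := BT y.
  rewrite /y -(big_mkord predT (fun i => x (k * l + i)%N)).
  rewrite -(big_map _ predT id).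
  apply: lP; first by move=> z /mapP[i _ ->].
  by rewrite size_map size_iota subn0.
have fE n : f (\prod_(i < n * l) x i) = \prod_(i < n) y i.
  elim: n => [|n IH]; first by rewrite !big_ord0 rmorph1.
  rewrite mulSn addnC -!(big_mkord predT x).
  rewrite (@big_cat_nat _ _ _ (n * l))//=; last exact: leq_addr.
  rewrite rmorphM big_mkord IH big_ord_recr /=; congr (_ * f _).
  rewrite -{1}[(n * l)%N]add0n big_addn addKn big_mkord.
  by apply: eq_bigr => i _; rewrite addnC.
exists (N * l)%N => m /subnKC <-; rewrite big_split_ord /=.
suff -> : \prod_(i < N * l) x i = 0 by rewrite mul0r.
by apply: finj; rewrite fE yN.
Qed.

End Subring.

(* Only a hypothesis on all rings with Q can be used on the members of an
   inverse system, whence the form of the last hypothesis. *)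
Lemma P_disc_inj Q (A B : pzRingType) (f : {rmorphism A -> B}) :
  P_disc Q -> (forall x, f x = 0 -> x = 0) -> pi_regular A ->
  ((forall C, Q C -> pi_infty_regular C) -> pi_infty_regular A) ->
  Q B -> Q A.
Proof.
move=> PQ finj piA; case: PQ => [_ [sl Jn]|_ [sl Jn]|_ [sl Jn]|piQ|piQ _|_|//].
- split; first by case: (semiperfect_inj finj piA sl).
  exact: nilpotent_inj finj piA sl Jn.
- split; first by case: (semiperfect_inj finj piA sl).
  exact: right_T_nilpotent_inj finj piA sl Jn.
- split; first by case: (semiperfect_inj finj piA sl).
  exact: left_T_nilpotent_inj finj piA sl Jn.
- move=> [_ [sl _]]; split; last exact: semiperfect_inj finj piA sl.
  by apply: piQ => C [].
- exact: piQ.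
- by move=> [_ [sl _]]; split=> //; exact: semiperfect_inj finj piA sl.
Qed.

Section Surjective.

Lemma pi_regular_surj (A B : pzRingType) (f : {rmorphism A -> B}) :
  (forall y, exists x, f x = y) -> pi_regular A -> pi_regular B.
Proof.
move=> fsurj /right_pi_regularP piA; apply/right_pi_regularP => b.
have [a <-] := fsurj b; have [n [r aE]] := piA a.
by exists n, (f r); rewrite -!rmorphXn -rmorphM -aE.
Qed.

Lemma map_mx_surj (A B : pzRingType) (f : {rmorphism A -> B}) m n :
  (forall y, exists x, f x = y) ->
  forall Y : 'M[B]_(m, n), exists X, map_mx f X = Y.
Proof.
move=> fsurj Y; pose g y := sval (cid (fsurj y)).
exists (map_mx g Y); apply/matrixP => i j; rewrite !mxE.
exact: svalP (cid (fsurj _)).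
Qed.

Lemma P_disc_surj Q (A B : pzRingType) (f : {rmorphism A -> B}) :
  P_disc Q -> (forall y, exists x, f x = y) -> Q A -> Q B.
Proof.
move=> PQ fsurj.
have pis : pi_infty_regular A -> pi_infty_regular B.
  by move=> piA n; apply: pi_regular_surj (piA n); exact: map_mx_surj.
(* Whole families in [Jac B] lift to [Jac A] because [A] is semilocal, so the vanishing of products
   in [A] descends to [B]. *)
have lift (I : Type) (x : I -> B) : semilocal A -> (forall i, Jac (x i)) ->
    exists y : I -> A, (forall i, Jac (y i)) /\ forall i, f (y i) = x i.
  move=> slA Jx; have /choice[y yP] : forall i, exists y, Jac y /\ f y = x i.
    by move=> i; have [y Jy fy] := Jac_surj fsurj slA (Jx i); exists y.
  by exists y; split=> i; case: (yP i).
case: PQ => [[sl Jn]|[sl Jn]|[sl Jn]|[piA sp]|piA|[piA sp]|piA].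
- split; first exact: semilocal_surj fsurj sl.
  have [n nE] := Jn; exists n => x /(lift _ _ sl)[y [Jy yE]].
  by rewrite -(rmorph0 f) -(nE y Jy) rmorph_prod; apply: eq_bigr.
- split; first exact: semilocal_surj fsurj sl.
  move=> x /(lift _ _ sl)[y [Jy yE]]; have [N NE] := Jn y Jy.
  exists N => n nN; rewrite -(rmorph0 f) -(NE n nN) rmorph_prod.
  by apply: eq_bigr => i _; rewrite yE.
- split; first exact: semilocal_surj fsurj sl.
  move=> x /(lift _ _ sl)[y [Jy yE]]; have [N NE] := Jn y Jy.
  exists N => n nN; rewrite -(rmorph0 f) -(NE n nN) rmorph_prod.
  by apply: eq_bigr => i _; rewrite yE.
- by split; [exact: pis|exact: semiperfect_surj fsurj sp].
- exact: pis.
- by split; [exact: pi_regular_surj fsurj piA|exact: semiperfect_surj fsurj sp].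
- exact: pi_regular_surj fsurj piA.
Qed.

End Surjective.

(** * Linearly topologized rings *)

Section LinearTopology.
Variable R : ltRingType.

Lemma open_ideal_sup (J K : set R) :
  open_ideal J -> is_ideal K -> J `<=` K -> open_ideal K.
Proof.
move=> oJ iK JK; split=> //; apply: nbhs_ideal_open => //.
by apply/nbhs0_ltP; exists J.
Qed.

Lemma hausdorff_ltP : hausdorff_space R <->
  forall x : R, (forall J, open_ideal J -> J x) -> x = 0.
Proof.
split=> [hR x xJ|sepR p q pq].
  apply: hR => U V nU nV; exists 0; split; last exact: nbhs_singleton.
  by have [_ [-> U0]] := (closure0P x).2 xJ U nU.
apply/eqP; rewrite -subr_eq0; apply/eqP; apply: sepR => J oJ.
have [[J0 JD Jl Jr] _] := oJ.
have nb x : nbhs x [set y | J (y - x)].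
  have : nbhs (- x + x) J by rewrite addNr; apply/nbhs0_ltP; exists J.
  by move=> /nbhs_addl; apply: filterS => y /=; rewrite addrC.
have [y [/= Jyp Jyq]] := pq _ _ (nb p) (nb q).
have -> : p - q = (y - q) - (y - p) by ncring.
by apply: JD => //; apply: is_idealN Jyp; case: oJ.
Qed.

Lemma separating_open : hausdorff_space R -> separating (@open_ideal R).
Proof. by move=> /hausdorff_ltP sepR; split=> // J []. Qed.

Lemma cvg0_ltP (u : nat -> R) : u @ \oo --> (0 : R) <->
  forall J, open_ideal J -> exists N, forall n, (N <= n)%N -> J (u n).
Proof.
split=> [cu J oJ|uJ U nU].
  have nJ : nbhs (0 : R) J by apply/nbhs0_ltP; exists J.
  by have [N _ NJ] := cu J nJ; exists N => n Nn; exact: NJ.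
have [J oJ JU] := (nbhs0_ltP U).1 nU; have [N NJ] := uJ J oJ.
by exists N => // n Nn; apply: JU; exact: NJ.
Qed.

(** With [e := a * b], the Drazin inverse [b] is the inverse of [e a e] in the corner ring, and
    [a - a * a * b] is the component of [a] at [1 - e]. *)
Lemma quasi_pi_regularP : quasi_pi_regular R <-> hausdorff_space R /\
  forall a : R, exists b, drazin (@open_ideal R) a b.
Proof.
have topnil (x : R) : (fun n => x ^+ n) @ \oo --> (0 : R) <->
    top_nilpotent (@open_ideal R) x.
  rewrite cvg0_ltP; split=> nx J oJ; have [n Jn] := nx J oJ; exists n.
    exact: Jn.
  by move=> m nm; apply: ideal_exp_le nm Jn; case: oJ.
split=> -[hR drR]; split=> // a.
  have [e [ee aE [b [ebe eab bea]] nil]] := drR a; exists b.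
  have be : b * e = b by rewrite -ebe -!mulrA ee.
  have eb : e * b = b by rewrite -ebe !mulrA ee.
  (* Multiplying the decomposition of [a] by [e] on either side shows that [e] commutes with [a]. *)
  have X0 : a - (e * a * e + (1 - e) * a * (1 - e)) = 0.
    by rewrite -aE subrr.
  have eae : e * a * e = e * a.
    apply/eqP; rewrite eq_sym -subr_eq0; apply/eqP.
    transitivity (e * (a - (e * a * e + (1 - e) * a * (1 - e))) +
      (e * e - e) * a * e + (e - e * e) * a * (1 - e)); first by ncring.
    by rewrite X0 ee !subrr !(mulr0, mul0r) !addr0.
  have eae' : e * a * e = a * e.
    apply/eqP; rewrite eq_sym -subr_eq0; apply/eqP.
    transitivity ((a - (e * a * e + (1 - e) * a * (1 - e))) * e +
      e * a * (e * e - e) + (1 - e) * a * (e - e * e)); first by ncring.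
    by rewrite X0 ee !subrr !(mulr0, mul0r) !addr0.
  have ab : a * b = e by rewrite -eb mulrA -eae'.
  have ba : b * a = e by rewrite -be -mulrA -eae.
  split; rewrite ?ab ?ba//; apply/topnil.
  rewrite (_ : _ - _ = (1 - e) * a * (1 - e))//.
  rewrite -mulrA ab; transitivity ((1 - e) * a * (1 - e) + (e * a - e * a * e)).
    by ncring.
  by rewrite eae subrr addr0.
have [b db] := drR a; have [ab bab /topnil nil] := db; exists (a * b).
have ee := drazin_idem db.
have ae : a * (a * b) = a * b * a by rewrite {1}ab mulrA.
have fE : (1 - a * b) * a * (1 - a * b) = a - a * a * b.
  have -> : (1 - a * b) * a = a * (1 - a * b).
    by rewrite mulrBl mul1r -ae; ncring.
  by rewrite -[LHS]mulrA idem_compl//; ncring.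
split; rewrite ?fE//.
- have -> : a * b * a * (a * b) = a * (a * b * (a * b)) by rewrite -ae; ncring.
  by rewrite ee; ncring.
- exists b; split.
  + by rewrite (drazin_el db) (drazin_er db).
  + by rewrite -mulrA (drazin_el db) -ae -mulrA (drazin_el db).
  + by rewrite -ae -mulrA ee mulrA -ab ee.
Qed.

Lemma first_countableP : first_countable R -> exists J : nat -> set R,
  (forall n, open_ideal (J n)) /\ forall K, open_ideal K ->
  exists n, J n `<=` K.
Proof.
move=> [U [nU Ub]].
have /choice[J JP] : forall n, exists J, open_ideal J /\ J `<=` U n.
  by move=> n; have [J oJ JU] := (nbhs0_ltP (U n)).1 (nU n); exists J.
exists J; split=> [n|K oK]; first by case: (JP n).
have [|n UK] := Ub K; first by apply/nbhs0_ltP; exists K.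
by exists n; apply: subset_trans UK; case: (JP n).
Qed.

End LinearTopology.

Lemma open_ideal_top (A : pzRingType) (B : ideal_base A) (K : set A) :
  open_ideal (K : set (lt_top B)) <->
  is_ideal K /\ exists2 J, base_set B J & J `<=` K.
Proof.
split=> [[iK oK]|[iK [J BJ JK]]]; split=> //.
  have [K0 _ _ _] := iK; have [J BJ JK] := oK 0 K0.
  by exists J => // x /JK; rewrite add0r.
move=> x Kx; exists J => // j /JK Kj; have [_ KD _ _] := iK; exact: KD.
Qed.

Lemma open_ideal_matrix (R : ltRingType) n (J : set R) : open_ideal J ->
  open_ideal ([set a : 'M[R]_n | forall i j, J (a i j)] : set (lt_matrix R n)).
Proof.
move=> oJ; apply/open_ideal_top; split.
  by apply: (@matrix_base_ideal R n); exists J.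
by exists [set a : 'M[R]_n | forall i j, J (a i j)] => //; exists J.
Qed.

Lemma open_ideal_matrixE (R : ltRingType) n (K : set (lt_matrix R n)) :
  open_ideal K -> exists2 J, open_ideal J &
    forall a : 'M[R]_n, (forall i j, J (a i j)) -> K a.
Proof.
by move=> /open_ideal_top[_ [_ [J oJ <-] JK]]; exists J.
Qed.

Lemma hausdorff_matrix (R : ltRingType) n :
  hausdorff_space R -> hausdorff_space (lt_matrix R n).
Proof.
move=> /hausdorff_ltP sepR; apply/hausdorff_ltP => a aJ.
apply/matrixP => i j; rewrite [RHS]mxE; apply: sepR => J oJ.
exact: (aJ _ (open_ideal_matrix n oJ)).
Qed.

Lemma first_countable_matrix (R : ltRingType) n :
  first_countable R -> first_countable (lt_matrix R n).
Proof.
move=> /first_countableP[J [oJ JK]].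
exists (fun k => [set a : 'M[R]_n | forall i j, J k (a i j)]).
split=> [k|V /nbhs0_ltP[K /open_ideal_matrixE[I oI IK] KV]].
  apply/nbhs0_ltP; exists [set a : 'M[R]_n | forall i j, J k (a i j)] => //.
  exact: open_ideal_matrix.
have [k kI] := JK I oI; exists k => a Ja; apply: KV; apply: IK => i j.
exact: kI.
Qed.

(** * Transfer of properties through centralizers *)

Section Centralizer.

(** [E] is identified with the centralizer of [C] through [i] rather than defined as a subring:
    matrices over [E] then stand in the same relation to matrices over [S], and [C := set0] covers
    the identity of a ring. *)
Definition centralizer_embedding (S E : pzRingType) (i : {rmorphism E -> S})
    (C : set S) :=
  [/\ forall x, i x = 0 -> x = 0, forall x c, C c -> i x * c = c * i x &
    forall s, (forall c, C c -> s * c = c * s) -> exists x, i x = s].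

Lemma centralizer_embedding_matrix (S E : pzRingType) (i : {rmorphism E -> S})
    (C : set S) n : centralizer_embedding i C ->
  @centralizer_embedding 'M[S]_n 'M[E]_n (map_mx i) [set c%:M | c in C].
Proof.
have scE (c : S) (X : 'M[S]_n) k l :
    (X * c%:M) k l = X k l * c /\ (c%:M * X) k l = c * X k l.
  split; rewrite mxE.
    rewrite (bigD1 l)//= mxE eqxx mulr1n big1 ?addr0// => m ml.
    by rewrite mxE (negbTE ml) mulr0.
  rewrite (bigD1 k)//= mxE eqxx mulr1n big1 ?addr0// => m mk.
  by rewrite mxE eq_sym (negbTE mk) mul0r.
move=> [i0 iC Ci]; split.
- move=> x /matrixP x0; apply/matrixP => k l; rewrite [RHS]mxE; apply: i0.
  by have := x0 k l; rewrite !mxE.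
- move=> x _ [c Cc <-]; apply/matrixP => k l.
  by rewrite (scE _ _ _ _).1 (scE _ _ _ _).2 mxE iC.
- move=> s sC.
  have /choice[x xP] : forall kl : 'I_n * 'I_n, exists x, i x = s kl.1 kl.2.
    move=> kl; apply: Ci => c Cc.
    have /matrixP/(_ kl.1 kl.2) : s * c%:M = c%:M * s by apply: sC; exists c.
    by rewrite (scE _ _ _ _).1 (scE _ _ _ _).2.
  exists (\matrix_(k, l) x (k, l)); apply/matrixP => k l.
  by rewrite !mxE (xP (k, l)).
Qed.

Lemma centralizer_drazin (S E : pzRingType) (i : {rmorphism E -> S}) (C : set S)
    (F : set (set S)) :
  centralizer_embedding i C -> separating F ->
  (forall a, exists b, drazin F a b) ->
  separating [set i @^-1` J | J in F] /\
  forall x, exists y, drazin [set i @^-1` J | J in F] x y.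
Proof.
move=> [i0 iC Ci] sepF drS; split.
  split=> [_ [J FJ <-]|x xF].
    have [J0 JD Jl Jr] := sepF.1 J FJ; split=> /= [|x y Jx Jy|a x Jx|x a Jx].
    - by rewrite rmorph0.
    - by rewrite rmorphD; exact: JD.
    - by rewrite rmorphM; exact: Jl.
    - by rewrite rmorphM; exact: Jr.
  by apply/i0/sepF.2 => J FJ; apply: (xF (i @^-1` J)); exists J.
have inj x y : i x = i y -> x = y.
  move=> ixy; apply/eqP; rewrite -subr_eq0; apply/eqP/i0.
  by rewrite rmorphB ixy subrr.
move=> x; have [b db] := drS (i x); have [xb bxb nil] := db.
have [y yE] : exists y, i y = b.
  by apply: Ci => c Cc; apply: (drazin_comm db sepF); exact: iC.
exists y; rewrite -yE in xb bxb nil; split.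
- by apply: inj; rewrite !rmorphM.
- by apply: inj; rewrite !rmorphM.
- move=> _ [J FJ <-]; have [n Jn] := nil J FJ; exists n.
  by rewrite /= rmorphXn rmorphB !rmorphM.
Qed.

End Centralizer.

Section Transfer.
Variables (S T : ltRingType) (E : pzRingType).
Variables (i : {rmorphism E -> S}) (C : set S) (f : {rmorphism E -> T}).
Hypothesis iC : centralizer_embedding i C.
Hypothesis fsurj : forall y, exists x, f x = y.
Hypothesis fcont : forall K, open_ideal K ->
  exists2 J, open_ideal J & forall x, J (i x) -> K (f x).
Hypothesis hT : hausdorff_space T.

Lemma quasi_pi_regular_transfer : quasi_pi_regular S -> quasi_pi_regular T.
Proof.
move=> /quasi_pi_regularP[/separating_open sepS drS].
apply/quasi_pi_regularP; split=> // t; have [x <-] := fsurj t.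
have [_ /(_ x)[y dy]] := centralizer_drazin iC sepS drS.
exists (f y); apply: drazin_rmorph dy => K /fcont[J oJ JK].
by exists (i @^-1` J) => //; exists J.
Qed.

Lemma semiperfect_transfer : quasi_pi_regular S -> semilocal S ->
  semiperfect T.
Proof.
move=> /quasi_pi_regularP[/separating_open sepS drS] slS.
have [sepE drE] := centralizer_drazin iC sepS drS.
apply: (semiperfect_surj fsurj); apply: semiperfect_of_drazin sepE drE _.
apply: (no_infinite_idempotents_sub (f := i)) => [e _|].
  by case: iC => + _ _; apply.
exact: semilocal_no_infinite_idempotents.
Qed.

End Transfer.

Lemma quasi_pi_infty_regular_transfer (S T : ltRingType) (E : pzRingType)
    (i : {rmorphism E -> S}) (C : set S) (f : {rmorphism E -> T}) :
  centralizer_embedding i C -> (forall y, exists x, f x = y) ->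
  (forall K, open_ideal K ->
    exists2 J, open_ideal J & forall x, J (i x) -> K (f x)) ->
  hausdorff_space T -> quasi_pi_infty_regular S -> quasi_pi_infty_regular T.
Proof.
move=> iC fsurj fcont hT [hS qS]; split=> // n.
apply: (@quasi_pi_regular_transfer (lt_matrix S n.+1) (lt_matrix T n.+1)
  'M[E]_n.+1 (map_mx i) [set c%:M | c in C] (map_mx f)).
- exact: centralizer_embedding_matrix.
- exact: map_mx_surj.
- move=> K /open_ideal_matrixE[J /fcont[I oI IJ] JK].
  exists [set a : 'M[S]_n.+1 | forall k l, I (a k l)].
    exact: open_ideal_matrix.
  move=> x xI; apply: JK => k l; rewrite mxE; apply: IJ.
  by have := xI k l; rewrite mxE.
- exact: hausdorff_matrix.
- exact: qS.
Qed.

(** * Inverse limits *)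

Lemma nbhs_coset (R : ltRingType) (J : set R) x :
  open_ideal J -> nbhs x [set y | J (y - x)].
Proof.
move=> oJ; have : nbhs (- x + x) J by rewrite addNr; apply/nbhs0_ltP; exists J.
by move=> /nbhs_addl; apply: filterS => y /=; rewrite addrC.
Qed.

Lemma lt_continuous (R S : ltRingType) (f : R -> S) :
  {morph f : x y / x - y} -> (forall K, open_ideal K ->
    exists2 J, open_ideal J & forall x, J x -> K (f x)) -> continuous f.
Proof.
move=> fB fK x U; rewrite -[f x]addr0 => /nbhs_addl/nbhs0_ltP[K oK KU].
have [J oJ JK] := fK K oK; apply: filterS (nbhs_coset x oJ) => y /= /JK.
by rewrite fB => /KU /=; rewrite addrC subrK.
Qed.

Section ProData.
Variables (d : Order.disp_t) (I : porderType d).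

(** The projections of a topological isomorphism with the limit: they are compatible, glue, are
    jointly injective, and their kernels form a basis of open ideals. They may fail to be
    surjective. *)
Definition limit_cone (X : inverse_system I) (S : ltRingType)
    (p : forall i, {rmorphism S -> X i}) :=
  [/\ forall i j (ij : (i <= j)%O) s, inv_map X ij (p j s) = p i s,
      forall x : (forall i, X i), (forall i j (ij : (i <= j)%O),
        inv_map X ij (x j) = x i) -> exists s, forall i, p i s = x i,
      forall s, (forall i, p i s = 0) -> s = 0,
      forall i, open_ideal [set s | p i s = 0] &
      forall J, open_ideal J -> exists i, [set s | p i s = 0] `<=` J].

Variable X : inverse_system I.

Lemma inv_seq_bound (s : seq I) : exists k, forall i, i \in s -> (i <= k)%O.
Proof.
elim: s => [|i s [k sk]]; first by have [k] := inv_neq0 X; exists k.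
have [l [il kl]] := inv_directed X i k; exists l => j; rewrite inE.
by move=> /predU1P[->|/sk jk] //; exact: Order.POrderTheory.le_trans kl.
Qed.

Section Projection.
Variable i : I.
Definition inv_proj (x : inv_lim X) : X i := inv_fam x i.
Let inv_projB : zmod_morphism inv_proj. Proof. by []. Qed.
Let inv_projM : monoid_morphism inv_proj. Proof. by []. Qed.
HB.instance Definition _ :=
  GRing.isZmodMorphism.Build (inv_lim X) (X i) inv_proj inv_projB.
HB.instance Definition _ :=
  GRing.isMonoidMorphism.Build (inv_lim X) (X i) inv_proj inv_projM.
End Projection.

Lemma limit_coneP (S : ltRingType) :
  top_ring_iso S (lt_inv_lim X) <-> exists p, @limit_cone X S p.
Proof.
split=> [[f [g [fK gK fc gc]]]|[p [pE plift p0 po pb]]].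
  exists (fun i => inv_proj i \o (f : {rmorphism S -> inv_lim X})); split.
  - by move=> i j ij s; exact: inv_famP.
  - move=> x xE; exists (g (InvLim xE)) => i /=.
    by rewrite gK.
  - move=> s s0; rewrite -[s]fK -[0]fK; congr g; apply: inv_limP => i.
    by rewrite rmorph0; exact: s0.
  - move=> i; split.
      exact: (is_ideal_ker (inv_proj i \o (f : {rmorphism S -> inv_lim X}))).
    have oi : open ([set x | inv_proj i x = 0] : set (lt_inv_lim X)).
      move=> x /= x0.
      exists [set y | forall j, j \in [:: i] -> inv_fam y j = 0].
        by exists [:: i].
      move=> y /(_ i (mem_head _ _)) y0.
      change (inv_fam (x : inv_lim X) i + inv_fam (y : inv_lim X) i = 0).
      by rewrite y0 addr0.
    by move/continuousP : fc => /(_ _ oi).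
  - move=> J [iJ oJ]; move/continuousP : gc => /(_ _ oJ) oJ'.
    have g0 : g 0 = 0 by rewrite -(rmorph0 f) fK.
    have [|_ [s _ <-] sJ] := oJ' 0; first by rewrite /= g0; case: iJ.
    have [k sk] := inv_seq_bound s; exists k => x /= x0.
    rewrite -[x]fK; have /= := sJ (f x); rewrite add0r; apply => i /sk ik.
    have <- := inv_famP (f x) ik.
    by rewrite [inv_fam _ _]x0 rmorph0.
pose F s : inv_lim X := InvLim (fun i j ij => pE i j ij s).
have FB : zmod_morphism F.
  by move=> s t; apply: inv_limP => i; exact: (rmorphB (p i)).
have FM : monoid_morphism F.
  by split=> [|s t]; apply: inv_limP => i; [exact: (rmorph1 (p i))|
    exact: (rmorphM (p i))].
pose f : {rmorphism S -> lt_inv_lim X} := HB.pack F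
  (GRing.isZmodMorphism.Build S (lt_inv_lim X) F FB)
  (GRing.isMonoidMorphism.Build S (lt_inv_lim X) F FM).
have finj s t : f s = f t -> s = t.
  move=> st; apply/eqP; rewrite -subr_eq0; apply/eqP/p0 => i.
  have /(congr1 (fun x : inv_lim X => inv_fam x i)) /= E := st.
  by rewrite rmorphB E subrr.
have fsurj x : exists s, f s = x.
  have [s sE] := plift (inv_fam x) (fun i j ij => inv_famP x ij).
  by exists s; apply: inv_limP.
pose g x := sval (cid (fsurj x)).
have gK : cancel g f by move=> x; exact: svalP (cid (fsurj x)).
have fK : cancel f g by move=> s; apply: finj; rewrite gK.
exists f, g; split=> //; apply: lt_continuous.
- exact: rmorphB.
- move=> K /open_ideal_top[iK [_ [s _ <-] sK]].
  have [k sk] := inv_seq_bound s; exists [set s | p k s = 0] => // t t0.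
  apply: sK => i /sk ik /=.
  by rewrite -(pE _ _ ik) t0 rmorph0.
- by move=> x y; apply: finj; rewrite rmorphB !gK.
- move=> J oJ; have [k kJ] := pb J oJ.
  exists [set x | inv_proj k x = 0].
    apply/open_ideal_top; split; first exact: (is_ideal_ker (inv_proj k)).
    exists [set y : inv_lim X | forall j, j \in [:: k] -> inv_fam y j = 0].
      by exists [:: k].
    by move=> y /(_ k (mem_head _ _)).
  by move=> x x0; apply: kJ; rewrite /= -[RHS]x0 -{2}[x]gK.
Qed.

End ProData.

Section LimitDrazin.
Variables (d : Order.disp_t) (I : porderType d) (Y : I -> pzRingType).
Variables (A : pzRingType) (p : forall i, {rmorphism A -> Y i}).
Variable t : forall i j, (i <= j)%O -> {rmorphism Y j -> Y i}.
Hypothesis pE : forall i j (ij : (i <= j)%O) a, t ij (p j a) = p i a.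
Hypothesis plift : forall y : (forall i, Y i), (forall i j (ij : (i <= j)%O),
  t ij (y j) = y i) -> exists a, forall i, p i a = y i.
Hypothesis p0 : forall a, (forall i, p i a = 0) -> a = 0.

Definition cone_kernels : set (set A) := [set [set a | p i a = 0] | i in setT].

Lemma separating_cone : separating cone_kernels.
Proof.
split=> [_ [i _ <-]|a aF]; first exact: is_ideal_ker.
by apply: p0 => i; apply: (aF [set a | p i a = 0]); exists i.
Qed.

(** By uniqueness, transition maps carry Drazin inverses to Drazin inverses, so the componentwise
    ones glue. The family [Y] is not packed as an [inverse_system], so that matrix rings over the
    members of a system fit directly. *)
Lemma drazin_cone : (forall i, pi_regular (Y i)) ->
  forall a, exists b, drazin cone_kernels a b.
Proof.
move=> piY a.
have bP i : exists b, drazin (@null_filtration (Y i)) (p i a) b.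
  exact: (pi_regularP (Y i)).1.
pose y i := sval (cid (bP i)).
have yP i : drazin (@null_filtration (Y i)) (p i a) (y i).
  exact: svalP (cid (bP i)).
have [i j ij|b bE] := plift (y := y).
  apply: (drazin_unique (@separating_null _) _ (yP i)).
  rewrite -(pE ij); apply: drazin_rmorph (yP j) => _ ->.
  by exists [set 0] => // x ->; exact: rmorph0.
have inj u v : (forall i, p i u = p i v) -> u = v.
  move=> uv; apply/eqP; rewrite -subr_eq0; apply/eqP/p0 => i.
  by rewrite rmorphB uv subrr.
exists b; split.
- by apply: inj => i; rewrite !rmorphM bE; case: (yP i).
- by apply: inj => i; rewrite !rmorphM bE; case: (yP i).
- move=> _ [i _ <-]; have [_ _ /(_ [set 0] erefl)[n yn]] := yP i; exists n.
  by rewrite /= rmorphXn rmorphB !rmorphM bE.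
Qed.

End LimitDrazin.

Section LimitCone.
Variables (d : Order.disp_t) (I : porderType d) (X : inverse_system I).
Variables (S : ltRingType) (p : forall i, {rmorphism S -> X i}).
Hypothesis cone : limit_cone p.

Lemma limit_cone_hausdorff : hausdorff_space S.
Proof.
have [_ _ p0 po _] := cone; apply/hausdorff_ltP => x xJ.
by apply: p0 => i; exact: xJ _ (po i).
Qed.

Let kernels_matrix n : set (set 'M[S]_n) :=
  cone_kernels (fun i => map_mx (p i) : {rmorphism 'M[S]_n -> 'M[X i]_n}).

Lemma limit_cone_matrix n : separating (@kernels_matrix n) /\
  ((forall i, pi_regular 'M[X i]_n) ->
   forall a, exists b, drazin (@kernels_matrix n) a b).
Proof.
have [pE plift p0 _ _] := cone.
have inj (a : 'M[S]_n) : (forall i, map_mx (p i) a = 0) -> a = 0.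
  move=> a0; apply/matrixP => k l; rewrite [RHS]mxE; apply: p0 => i.
  by have /matrixP/(_ k l) := a0 i; rewrite !mxE.
split; first exact: separating_cone inj.
apply: (drazin_cone (t := fun i j ij => map_mx (inv_map X ij)
  : {rmorphism 'M[X j]_n -> 'M[X i]_n})) => //.
  by move=> i j ij a; apply/matrixP => k l; rewrite !mxE pE.
move=> y yE.
have /choice[s sE] : forall kl : 'I_n * 'I_n, exists s,
    forall i, p i s = y i kl.1 kl.2.
  move=> kl; apply: plift => i j ij.
  by have /matrixP/(_ kl.1 kl.2) := yE i j ij; rewrite mxE.
exists (\matrix_(k, l) s (k, l)) => i; apply/matrixP => k l.
by rewrite !mxE (sE (k, l)).
Qed.

Lemma limit_cone_drazin : (forall i, pi_regular (X i)) ->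
  forall a, exists b, drazin (cone_kernels p) a b.
Proof. by have [pE plift p0 _ _] := cone; exact: drazin_cone. Qed.

Lemma limit_cone_quasi_pi_regular :
  (forall i, pi_regular (X i)) -> quasi_pi_regular S.
Proof.
move=> piX; apply/quasi_pi_regularP; split; first exact: limit_cone_hausdorff.
move=> a; have [b db] := limit_cone_drazin piX a; exists b.
have [_ _ _ _ pb] := cone.
apply: (drazin_rmorph (f := idfun : {rmorphism S -> S})) db => J /pb[i iJ].
by exists [set s | p i s = 0] => //; exists i.
Qed.

End LimitCone.

Lemma pro_quasi_pi_regular Q S : P_disc Q -> pro Q S -> quasi_pi_regular S.
Proof.
move=> PQ [d [I [X [QX /limit_coneP[p cone]]]]].
apply: limit_cone_quasi_pi_regular cone _ => i.
exact: P_disc_pi_regular PQ (QX i).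
Qed.

(** * Pro-properties of open quotients of centralizers *)

Section ProTransfer.
Variables (S T : ltRingType) (E : pzRingType).
Variables (e : {rmorphism E -> S}) (C : set S) (f : {rmorphism E -> T}).
Hypothesis eC : centralizer_embedding e C.
Hypothesis fsurj : forall y, exists x, f x = y.
Hypothesis fcont : forall K, open_ideal K ->
  exists2 J, open_ideal J & forall x, J (e x) -> K (f x).
Hypothesis fopen : forall J, open_ideal J -> open_ideal (f @` (e @^-1` J)).
Hypothesis hT : hausdorff_space T.
Hypothesis S_countable : first_countable S.

Variables (Q : pzRingType -> Prop) (PQ : P_disc Q).
Variables (d : Order.disp_t) (I : porderType d) (X : inverse_system I).
Hypothesis QX : forall i, Q (X i).
Variable p : forall i, {rmorphism S -> X i}.
Hypothesis cone : limit_cone p.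

Let K i : set T := f @` (e @^-1` [set s | p i s = 0]).

Let oK i : open_ideal (K i).
Proof. by have [_ _ _ po _] := cone; exact: fopen. Qed.

Let KI i : ideal T := Ideal (oK i).1.
Let q i : {rmorphism T -> quot_ring (KI i)} := quot_proj (KI i).
Let q_surj i y : exists x, q i x = y.
Proof. exact: quot_proj_surj. Qed.
Let q0 i x : q i x = 0 <-> K i x.
Proof. exact: quot_proj_eq0 (KI i) x. Qed.

Let K_le i j : (i <= j)%O -> K j `<=` K i.
Proof.
have [pE _ _ _ _] := cone; move=> ij _ [x /= px <-]; exists x => //=.
by rewrite -(pE _ _ ij) px rmorph0.
Qed.

(* E / ker (p_i e) embeds in X_i and maps onto T / K_i. *)
Lemma P_disc_quotient i : Q (quot_ring (KI i)).
Proof.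
pose pe : {rmorphism E -> X i} := p i \o e.
pose A := quot_ring (Ideal (is_ideal_ker pe)).
pose r : {rmorphism E -> A} := quot_proj _.
have r_surj y : exists x, r x = y by exact: quot_proj_surj.
have r0 x : r x = 0 <-> pe x = 0.
  exact: (quot_proj_eq0 (Ideal (is_ideal_ker pe)) x).
have [g gE] : exists g : {rmorphism A -> X i}, forall x, g (r x) = pe x.
  by apply: rmorph_factor => // x /r0.
have [h hE] : exists h : {rmorphism A -> quot_ring (KI i)},
    forall x, h (r x) = q i (f x).
  apply: (rmorph_factor (f := r) (g := q i \o f)) => // x /r0 px.
  by apply/q0; exists x.
apply: (P_disc_surj (f := h) PQ).
  move=> y; have [z <-] := q_surj y; have [x <-] := fsurj z.
  by exists (r x).
apply: (P_disc_inj (f := g) PQ) (QX i).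
- by move=> y; have [x <-] := r_surj y; rewrite gE => /r0.
(* A subring of a pi-regular ring need not be pi-regular. Here the topological Drazin inverse in the
   centralizer [E] becomes a genuine one in [A], because [r] kills the kernel of [pe]. *)
- apply/pi_regularP => y; have [x <-] := r_surj y.
  have [_ _ p0 _ _] := cone.
  have [|sepE drE] := centralizer_drazin eC (separating_cone p0).
    apply: limit_cone_drazin cone _ => j.
    exact: P_disc_pi_regular PQ (QX j).
  have [x' dx] := drE x; exists (r x').
  apply: drazin_rmorph dx => _ ->.
  exists (e @^-1` [set s | p i s = 0]); last by move=> z /r0.
  by exists [set s | p i s = 0] => //; exists i.
- move=> Qpi n; apply/pi_regularP => Y.
  have [x <-] := map_mx_surj r_surj Y.
  have [sepM drM] := limit_cone_matrix cone n.+1.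
  have eM := centralizer_embedding_matrix n.+1 eC.
  have [|sepE drE] := centralizer_drazin eM sepM.
    by apply: drM => j; exact: Qpi.
  have [x' dx] := drE x; exists (map_mx r x').
  apply: (drazin_rmorph (f := map_mx r)) dx => _ ->.
  exists (map_mx e @^-1` [set s | map_mx (p i) s = 0]).
    by exists [set s | map_mx (p i) s = 0] => //; exists i.
  move=> z /= /matrixP z0; apply/matrixP => k l; rewrite !mxE.
  by apply/r0; have := z0 k l; rewrite !mxE.
Qed.

Let trans i j (ij : (i <= j)%O) :
  {t : {rmorphism quot_ring (KI j) -> quot_ring (KI i)} |
    forall x, t (q j x) = q i x}.
Proof.
apply: cid; apply: rmorph_factor; first exact: q_surj.
by move=> x /q0 jx; apply/q0; exact: K_le jx.
Qed.

Let transE i j (ij : (i <= j)%O) x : sval (trans ij) (q j x) = q i x.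
Proof. exact: svalP (trans ij) x. Qed.

Let trans_id i (ii : (i <= i)%O) x : sval (trans ii) x = x.
Proof. by have [y <-] := q_surj x; rewrite transE. Qed.

Let trans_comp i j k (ij : (i <= j)%O) (jk : (j <= k)%O) (ik : (i <= k)%O) x :
  sval (trans ij) (sval (trans jk) x) = sval (trans ik) x.
Proof. by have [y <-] := q_surj x; rewrite !transE. Qed.

Definition quotient_system : inverse_system I :=
  InverseSystem trans_id trans_comp (inv_neq0 X) (inv_directed X).

(** This is where first countability enters. The sequence is cofinal for the kernels only: its
    indices need not dominate every [i] in [I]. *)
Let cofinal_sequence : exists k : nat -> I,
  (forall n, (k n <= k n.+1)%O) /\
  forall i, exists n, [set s | p (k n) s = 0] `<=` [set s | p i s = 0].
Proof.
have [pE _ _ po pb] := cone; have [J [oJ JK]] := first_countableP S_countable.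
have /choice[G GP] : forall in_ : I * nat, exists k,
    (in_.1 <= k)%O /\ [set s | p k s = 0] `<=` J in_.2.
  move=> [i n]; have [j jJ] := pb _ (oJ n).
  have [k [ik jk]] := inv_directed X i j.
  exists k; split=> // s /= ps; apply: jJ => /=.
  by rewrite -(pE _ _ jk) ps rmorph0.
have [i0] := inv_neq0 X.
pose k := fix k n := if n is m.+1 then G (k m, n) else G (i0, 0%N).
exists k; split=> [n|i]; first by have [] := GP (k n, n.+1).
have [n nJ] := JK _ (po i); exists n; apply: subset_trans nJ.
by case: n => [|n]; [have [_] := GP (i0, 0%N)|have [_] := GP (k n, n.+1)].
Qed.

(** Representatives [tau n] of [x (k n)] differ by elements [f (delta n)] with [delta n] killed by
    [p (k n) \o e]. Hence the partial sums [z n], which lift the [tau n], form a Cauchy sequence; it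
    converges in [S], the limit lies in [E], and its image under [f] is the element sought. *)
Lemma quotient_lift (x : forall i, quotient_system i) :
  (forall i j (ij : (i <= j)%O), inv_map quotient_system ij (x j) = x i) ->
  exists y, forall i, q i y = x i.
Proof.
move=> xE; have [pE plift p0 po pb] := cone; have [e0 eCom Ce] := eC.
have xtE i j (ij : (i <= j)%O) : sval (trans ij) (x j) = x i by exact: xE.
have [k [kS kcof]] := cofinal_sequence.
have kle m n : (m <= n)%N -> (k m <= k n)%O.
  move=> /subnKC <-; elim: (n - m)%N => [|l IH]; first by rewrite addn0.
  by rewrite addnS; exact: Order.POrderTheory.le_trans IH _.
have ker_le i j s : (i <= j)%O -> p j s = 0 -> p i s = 0.
  by move=> ij ps; rewrite -(pE _ _ ij) ps rmorph0.
have /choice[tau tauP] : forall n, exists t, q (k n) t = x (k n).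
  by move=> n; exact: q_surj.
have /choice[delta deltaP] : forall n, exists z,
    p (k n) (e z) = 0 /\ f z = tau n.+1 - tau n.
  move=> n; have /q0[z pz fz] : q (k n) (tau n.+1 - tau n) = 0.
    by rewrite rmorphB tauP -(transE (kS n)) tauP xtE subrr.
  by exists z.
have [z0 fz0] := fsurj (tau 0%N).
pose z n := z0 + \sum_(m < n) delta m.
have z_0 : z 0%N = z0 by rewrite /z big_ord0 addr0.
have zS n : z n.+1 = z n + delta n by rewrite /z big_ord_recr addrA.
have fz n : f (z n) = tau n.
  elim: n => [|n IH]; first by rewrite z_0.
  by rewrite zS rmorphD IH (deltaP n).2 addrC subrK.
clearbody z.
have zk m n : (m <= n)%N -> p (k m) (e (z n)) = p (k m) (e (z m)).
  move=> /subnKC <-; elim: (n - m)%N => [|l IH]; first by rewrite addn0.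
  rewrite addnS zS !rmorphD IH.
  by rewrite (ker_le _ _ _ (kle _ _ (leq_addr l m)) (deltaP _).1) addr0.
have /choice[N NP] := kcof.
have zN i n : (N i <= n)%N -> p i (e (z n)) = p i (e (z (N i))).
  move=> /zk zE; apply/eqP; rewrite -subr_eq0 -rmorphB; apply/eqP.
  by apply: (NP i); rewrite /= rmorphB zE subrr.
have [i j ij|s sE] := plift (fun i => p i (e (z (N i)))).
  rewrite pE -(zN i (maxn (N i) (N j))) ?leq_maxl//.
  by rewrite -!(pE _ _ ij) (zN j (maxn (N i) (N j)))// leq_maxr.
(* Commutation with [C] is checked in each [X i], where [s] agrees with some [e (z n)]. *)
have [y ey] : exists y, e y = s.
  apply: Ce => c Cc; apply/eqP; rewrite -subr_eq0; apply/eqP/p0 => i.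
  by rewrite rmorphB !rmorphM sE -!rmorphM -eCom// subrr.
exists (f y) => i.
have -> : q i (f y) = q i (tau (N i)).
  apply/eqP; rewrite -subr_eq0 -rmorphB -fz -rmorphB; apply/eqP/q0.
  by exists (y - z (N i)) => //=; rewrite !rmorphB ey sE subrr.
(* [i] and [k (N i)] need not be comparable although their kernels are, so [x i] and [x (k (N i))]
   are compared at a common upper bound. *)
have [l [il kl]] := inv_directed X i (k (N i)).
have [t tE] := q_surj (x l).
have -> : x i = q i t.
  by rewrite -(transE il) tE xtE.
have : q (k (N i)) (tau (N i) - t) = 0.
  by rewrite rmorphB tauP -(transE kl) tE xtE subrr.
move=> /q0[w pw fw]; apply/eqP; rewrite -subr_eq0 -rmorphB; apply/eqP/q0.
by exists w => //; exact: (NP i).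
Qed.

Lemma pro_transfer_cone : pro Q T.
Proof.
exists d, I, quotient_system; split; first exact: P_disc_quotient.
have [pE _ p0 po pb] := cone.
have Kb J : open_ideal J -> exists i, K i `<=` J.
  move=> /fcont[J' /pb[i iJ'] J'J]; exists i => _ [x px <-].
  by apply: J'J; exact: iJ'.
have qK i : [set s | q i s = 0] = K i.
  by apply/seteqP; split=> x /q0.
apply/limit_coneP; exists q; split.
- exact: transE.
- exact: quotient_lift.
- move=> t t0; apply: (hausdorff_ltP T).1 hT _ _ => J /Kb[i]; apply.
  by apply/q0; exact: t0.
- by move=> i; rewrite qK.
- by move=> J /Kb[i iJ]; exists i; rewrite qK.
Qed.

End ProTransfer.

Lemma centralizer_embedding_id (A : pzRingType) :
  centralizer_embedding (idfun : {rmorphism A -> A}) set0.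
Proof. by split=> // a _; exists a. Qed.

Lemma quasi_pi_infty_regularW (R : ltRingType) :
  quasi_pi_infty_regular R -> quasi_pi_regular R.
Proof.
move=> [hR /(_ 0%N)]; pose f (a : 'M[R]_1) : R := a 0 0.
have fB : zmod_morphism f by move=> a b; rewrite /f [LHS]mxE [X in _ + X]mxE.
have fM : monoid_morphism f.
  by split=> [|a b]; rewrite /f mxE ?eqxx// big_ord1.
pose F : {rmorphism 'M[R]_1 -> R} := HB.pack f
  (GRing.isZmodMorphism.Build 'M[R]_1 R f fB)
  (GRing.isMonoidMorphism.Build 'M[R]_1 R f fM).
apply: (@quasi_pi_regular_transfer (lt_matrix R 1) R 'M[R]_1 idfun set0 F)
  => //.
- exact: centralizer_embedding_id.
- by move=> y; exists (const_mx y); rewrite /F /= /f mxE.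
- move=> K oK; exists [set a : 'M[R]_1 | forall i j, K (a i j)].
    exact: open_ideal_matrix.
  by move=> x; apply.
Qed.

(** Matrices of matrices are larger matrices: reindexing by pairs is a continuous surjection, to
    which the transfer applies with the identity embedding. The predecessor in [l] serves to exhibit
    the size as a successor. *)
Lemma lt_matrixM_quasi (R : ltRingType) n :
  quasi_pi_infty_regular R -> quasi_pi_infty_regular (lt_matrix R n.+1).
Proof.
move=> [hR qR]; have hM := @hausdorff_matrix R n.+1 hR; split=> // m.
pose P := ('I_m.+1 * 'I_n.+1)%type.
have PE : #|{: P}| = (m.+1 * n.+1).-1.+1 by rewrite card_prod !card_ord.
pose l := (m.+1 * n.+1).-1.
pose ix (i : 'I_m.+1) (k : 'I_n.+1) : 'I_l.+1 := cast_ord PE (enum_rank (i, k)).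
pose f (A : 'M[R]_l.+1) : 'M['M[R]_n.+1]_m.+1 :=
  \matrix_(i, j) \matrix_(k, h) A (ix i k) (ix j h).
have ix_inj i k j h : (ix i k == ix j h) = (i == j) && (k == h).
  by rewrite /ix (inj_eq (@cast_ord_inj _ _ PE)) (inj_eq enum_rank_inj).
have fB : zmod_morphism f.
  move=> A B; apply/matrixP => i j; apply/matrixP => k h.
  by rewrite /f !mxE.
have fM : monoid_morphism f.
  split=> [|A B]; apply/matrixP => i j; apply/matrixP => k h.
    rewrite /f !mxE ix_inj; case: (i == j) => /=; last by rewrite !mxE.
    by rewrite !mxE.
  rewrite /f !mxE summxE.
  under [RHS]eq_bigr => a _ do rewrite !mxE.
  rewrite pair_big /=.
  rewrite (reindex (fun p : P => ix p.1 p.2)) /=; last first.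
    exists (fun u => enum_val (cast_ord (esym PE) u)) => [[a b] _|u _] /=.
      by rewrite /ix cast_ordK enum_rankK.
    rewrite /ix -surjective_pairing enum_valK cast_ordKV //.
  by apply: eq_bigr => -[a b] _; rewrite !mxE.
pose F : {rmorphism 'M[R]_l.+1 -> 'M['M[R]_n.+1]_m.+1} := HB.pack f
  (GRing.isZmodMorphism.Build 'M[R]_l.+1 'M['M[R]_n.+1]_m.+1 f fB)
  (GRing.isMonoidMorphism.Build 'M[R]_l.+1 'M['M[R]_n.+1]_m.+1 f fM).
apply: (@quasi_pi_regular_transfer (lt_matrix R l.+1)
  (lt_matrix (lt_matrix R n.+1) m.+1) 'M[R]_l.+1 idfun set0 F).
- exact: centralizer_embedding_id.
- move=> Y; pose r u := enum_val (cast_ord (esym PE) u).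
  exists (\matrix_(u, v) Y (r u).1 (r v).1 (r u).2 (r v).2).
  apply/matrixP => i j; apply/matrixP => k h.
  by rewrite /F /= /f !mxE /r /ix !cast_ordK !enum_rankK.
- move=> K /open_ideal_matrixE[K' /open_ideal_matrixE[J oJ JK'] K'K].
  exists [set a : 'M[R]_l.+1 | forall i j, J (a i j)].
    exact: open_ideal_matrix.
  move=> x Jx; apply: K'K => i j; apply: JK' => k h.
  by rewrite /F /= /f !mxE.
- exact: hausdorff_matrix.
- exact: qR.
Qed.

Section PropertyTransfer.
Variables (S T : ltRingType) (E : pzRingType).
Variables (e : {rmorphism E -> S}) (C : set S) (f : {rmorphism E -> T}).
Hypothesis eC : centralizer_embedding e C.
Hypothesis fsurj : forall y, exists x, f x = y.
Hypothesis fcont : forall K, open_ideal K ->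
  exists2 J, open_ideal J & forall x, J (e x) -> K (f x).
Hypothesis fopen : forall J, open_ideal J -> open_ideal (f @` (e @^-1` J)).
Hypothesis hT : hausdorff_space T.

Lemma P_top_transfer Pr : first_countable S -> P_top Pr -> Pr S -> Pr T.
Proof.
move=> cS; case=> [Q PQ|Q PQ||||].
- move=> [d [I [X [QX /limit_coneP[p cone]]]]].
  exact: pro_transfer_cone eC fsurj fcont fopen hT cS _ PQ _ _ _ QX _ cone.
- move=> [proS [slS _]]; split; last first.
    apply: semiperfect_transfer eC fsurj _ slS.
    exact: pro_quasi_pi_regular PQ proS.
  have [d [I [X [QX /limit_coneP[p cone]]]]] := proS.
  exact: pro_transfer_cone eC fsurj fcont fopen hT cS _ PQ _ _ _ QX _ cone.
- exact: quasi_pi_infty_regular_transfer eC fsurj fcont hT.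
- move=> [qS [slS _]]; split.
    exact: quasi_pi_infty_regular_transfer eC fsurj fcont hT qS.
  apply: semiperfect_transfer eC fsurj _ slS.
  exact: quasi_pi_infty_regularW.
- exact: quasi_pi_regular_transfer eC fsurj fcont hT.
- move=> [qS [slS _]]; split.
    exact: quasi_pi_regular_transfer eC fsurj fcont hT qS.
  exact: semiperfect_transfer eC fsurj qS slS.
Qed.
End PropertyTransfer.

(** * Endomorphisms of finitely presented modules *)

Section CentralizerRing.
Variables (A : pzRingType) (C : set A).

Definition in_centralizer : pred A :=
  fun x => `[< forall c, C c -> x * c = c * x >].

Lemma in_centralizer_subring : subring_closed in_centralizer.
Proof.
split=> [|x y /asboolP xC /asboolP yC|x y /asboolP xC /asboolP yC];
  apply/asboolP => c Cc.
- by rewrite mul1r mulr1.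
- by rewrite mulrBl mulrBr xC ?yC.
- by rewrite -mulrA yC// mulrA xC// mulrA.
Qed.

HB.instance Definition _ :=
  GRing.isSubringClosed.Build A in_centralizer in_centralizer_subring.

Record centralizer_ring := CentralizerRing {
  centralizer_val :> A; centralizerP : centralizer_val \in in_centralizer }.
HB.instance Definition _ := [isSub for centralizer_val].
HB.instance Definition _ := [Choice of centralizer_ring by <:].
HB.instance Definition _ := GRing.SubChoice_isSubPzRing.Build A in_centralizer
  centralizer_ring in_centralizer_subring.

Definition centralizer_incl : {rmorphism centralizer_ring -> A} := val.

Lemma centralizer_embedding_val : centralizer_embedding centralizer_incl C.
Proof.
split=> [x x0|x c Cc|s sC].
- exact: val_inj.
- by have /asboolP := centralizerP x; apply.
- have sP : s \in in_centralizer by apply/asboolP.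
  by exists (CentralizerRing sP).
Qed.

End CentralizerRing.

Lemma linear_factor (S : pzRingType) (V W U : lmodType S) (g : {linear V -> W})
    (h : {linear V -> U}) :
  (forall y, exists x, g x = y) -> (forall x, g x = 0 -> h x = 0) ->
  exists k : {linear W -> U}, forall x, k (g x) = h x.
Proof.
move=> gsurj gh; pose s y := sval (cid (gsurj y)).
have sK y : g (s y) = y by exact: svalP (cid (gsurj y)).
have hE x y : g x = g y -> h x = h y.
  move=> gxy; apply/eqP; rewrite -subr_eq0 -linearB; apply/eqP/gh.
  by rewrite linearB /= gxy subrr.
pose k y := h (s y).
have kg x : k (g x) = h x by apply: hE; rewrite sK.
have klin : linear k.
  by move=> a x y; rewrite -[x]sK -[y]sK -linearP !kg linearP.
pose K : {linear W -> U} := HB.pack k (GRing.isLinear.Build S W U _ k klin).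
by exists K.
Qed.

Section LinearMatrix.
Variable R : pzRingType.

(* Left multiplication of column vectors over R, written with rows over the
   converse ring. *)
Definition mxact m n (a : 'M[R]_(m, n)) :
  {linear 'rV[R^c]_n -> 'rV[R^c]_m} := mulmxr (a^T : 'M[R^c]_(n, m)).

Lemma mxactE m n (a : 'M[R]_(m, n)) x i :
  mxact a x 0 i = \sum_j (a i j * (x 0 j : R)).
Proof. by rewrite mxE; apply: eq_bigr => j _; rewrite mxE. Qed.

Lemma mxactM m n p (a : 'M[R]_(m, n)) (b : 'M[R]_(n, p)) x :
  mxact (a *m b) x = mxact a (mxact b x).
Proof.
rewrite /= -mulmxA; congr (_ *m _); apply/matrixP => i j; rewrite !mxE.
by apply: eq_bigr => k _; rewrite !mxE.
Qed.

Lemma mxactD m n (a b : 'M[R]_(m, n)) x :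
  mxact (a - b) x = mxact a x - mxact b x.
Proof. by rewrite /= linearB /= mulmxBr. Qed.

Lemma mxact1 n x : mxact (1%:M : 'M[R]_n) x = x.
Proof.
apply/matrixP => i j; rewrite ord1 mxactE (bigD1 j)//= mxE eqxx mul1r.
rewrite big1 ?addr0//.
by move=> k kj; rewrite mxE eq_sym (negbTE kj) mul0r.
Qed.

Definition mx_of m n (g : {linear 'rV[R^c]_n -> 'rV[R^c]_m}) : 'M[R]_(m, n) :=
  (lin1_mx g)^T.

Lemma mx_ofK m n (g : {linear 'rV[R^c]_n -> 'rV[R^c]_m}) x :
  mxact (mx_of g) x = g x.
Proof. by rewrite /= trmxK mul_rV_lin1. Qed.

Lemma mxact_inj m n (a b : 'M[R]_(m, n)) :
  (forall x, mxact a x = mxact b x) -> a = b.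
Proof.
move=> ab; apply/matrixP => i j; have /matrixP/(_ 0 i) := ab (delta_mx 0 j).
have E (c : 'M[R]_(m, n)) : mxact c (delta_mx 0 j) 0 i = c i j.
  rewrite mxactE (bigD1 j)//= mxE !eqxx mulr1 big1 ?addr0// => k kj.
  by rewrite mxE (negbTE kj) andbF mulr0.
by rewrite !E.
Qed.

Lemma mul_ideal_row n (J : set R) (x : 'rV[R^c]_n) : is_ideal J ->
  mul_ideal 'rV[R^c]_n J x <-> forall i, J (x 0 i).
Proof.
move=> [J0 JD Jl Jr]; split=> [[k [y [a [Ja ->]]]] i|Jx].
  rewrite summxE; elim/big_ind: _ => // l _; rewrite mxE.
  exact: Jl.
exists n, (fun i => delta_mx 0 i), (fun i => x 0 i); split=> //.
exact: row_sum_delta.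
Qed.

Lemma mul_ideal_mxact m n (J : set R) (a : 'M[R]_(m, n)) : is_ideal J ->
  (forall i j, J (a i j)) <-> forall x, mul_ideal 'rV[R^c]_m J (mxact a x).
Proof.
move=> iJ; have [J0 JD Jl Jr] := iJ; split=> [Ja x|Ja i j].
  apply/mul_ideal_row => // i; rewrite mxactE; elim/big_ind: _ => // j _.
  exact: Jr.
have /mul_ideal_row/(_ i) := Ja (delta_mx 0 j).
rewrite mxactE (bigD1 j)//= mxE !eqxx mulr1 big1 ?addr0; first exact.
by move=> k kj; rewrite mxE (negbTE kj) andbF mulr0.
Qed.

End LinearMatrix.

Lemma mul_idealT (R : pzRingType) (M : lmodType R^c) (x : M) :
  mul_ideal M setT x.
Proof.
by exists 1%N, (fun=> x), (fun=> 1); split=> //; rewrite big_ord1 scale1r.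
Qed.

(** The matrix rings to which the properties pass have successor size, so a presentation with no
    generators is replaced; its module is 0, the cokernel of the identity of [S]. *)
Lemma finitely_presented_pos (S : pzRingType) (M : lmodType S) :
  finitely_presented M -> exists m n (d : {linear 'rV[S]_m -> 'rV[S]_n.+1})
    (eps : {linear 'rV[S]_n.+1 -> M}),
  (forall x, exists y, eps y = x) /\ range d = [set y | eps y = 0].
Proof.
move=> [m [[|n] [d [eps [epss dE]]]]]; last by exists m, n, d, eps.
have M0 (x : M) : x = 0.
  by have [y <-] := epss x; rewrite (thinmx0 y) linear0.
exists 1%N, 0%N, (idfun : {linear 'rV[S]_1 -> 'rV[S]_1}), \0; split=> [x|].
  by exists 0; rewrite [RHS]M0.
by apply/seteqP; split=> // y _; exists y.
Qed.

Lemma block_centralizerP (R : pzRingType) p q (D : 'M[R]_(p, q))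
    (s : 'M[R]_(p + q)) :
  (forall c, [set block_mx 1%:M 0 0 0; block_mx 0 D 0 0 : 'M[R]_(p + q)] c ->
    s * c = c * s) <->
  [/\ ursubmx s = 0, dlsubmx s = 0 & ulsubmx s *m D = D *m drsubmx s].
Proof.
pose P : 'M[R]_(p + q) := block_mx 1%:M 0 0 0.
pose N : 'M[R]_(p + q) := block_mx 0 D 0 0.
set a := ulsubmx s; set b := ursubmx s; set c := dlsubmx s; set e := drsubmx s.
have sE : s = block_mx a b c e by rewrite submxK.
have sP : s *m P = block_mx a 0 c 0.
  by rewrite sE mulmx_block !mulmx1 !mulmx0 !addr0.
have Ps : P *m s = block_mx a b 0 0.
  by rewrite sE mulmx_block !mul1mx !mul0mx !addr0.
have sN : s *m N = block_mx 0 (a *m D) 0 (c *m D).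
  by rewrite sE mulmx_block !mulmx0 !addr0.
have Ns : N *m s = block_mx (D *m c) (D *m e) 0 0.
  by rewrite sE mulmx_block !mul0mx !add0r.
split=> [sC|[b0 c0 aD] _ [->|->]].
- have : s *m P = P *m s by apply: sC; left.
  have : s *m N = N *m s by apply: sC; right.
  rewrite sP Ps sN Ns => /eq_block_mx[_ aD _ _] /eq_block_mx[_ b0 c0 _].
  by split.
- by rewrite -[LHS]/(s *m P) -[RHS]/(P *m s) sP Ps b0 c0.
- by rewrite -[LHS]/(s *m N) -[RHS]/(N *m s) sN Ns c0 mul0mx mulmx0 aD.
Qed.

(** * Chain endomorphisms of a presentation and the topologies on End(M) *)

Section Presentation.
Variables (R : ltRingType) (M : lmodType R^c) (m n : nat).
Variables (d : {linear 'rV[R^c]_m -> 'rV[R^c]_n.+1}).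
Variable (eps : {linear 'rV[R^c]_n.+1 -> M}).
Hypothesis eps_surj : forall x, exists y, eps y = x.
Hypothesis d_ker : range d = [set y | eps y = 0].

Let Pobj (i : nat) : lmodType R^c :=
  if i is 0%N then 'rV[R^c]_n.+1 else 'rV[R^c]_m.
Let Pdiff (i : nat) : {linear Pobj i.+1 -> Pobj i} :=
  if i is 0%N then d else \0.

Definition free_resolution k (k12 : k = 1%N \/ k = 2%N) : proj_resolution M k.
Proof.
apply: (@ProjResolution _ _ _ Pobj eps Pdiff) => //.
- by case: k12 => ->.
- by case=> [|i] _; exact: projective_rV.
- by move=> i; case: k12 => ->.
Defined.

Local Notation S := (lt_matrix R (n.+1 + m)).

Let D : 'M[R]_(n.+1, m) := mx_of d.
Definition complex_structure : set 'M[R]_(n.+1 + m) :=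
  [set block_mx 1%:M 0 0 0; block_mx 0 D 0 0].

(* Matrices commuting with the first element of complex_structure are block
   diagonal; commuting with the second one as well amounts to being a chain
   endomorphism of d. *)
Definition complex_endo := centralizer_ring complex_structure.
HB.instance Definition _ := GRing.PzRing.on complex_endo.
Local Notation E := complex_endo.

Definition complex_endo_mx : {rmorphism E -> S} :=
  centralizer_incl complex_structure.
Local Notation incl := complex_endo_mx.

Lemma complex_endo_mx_centralizer :
  centralizer_embedding complex_endo_mx complex_structure.
Proof. exact: centralizer_embedding_val. Qed.

Let ul (s : E) : 'M[R]_n.+1 := ulsubmx (incl s : 'M_(n.+1 + m)).
Let dr (s : E) : 'M[R]_m := drsubmx (incl s : 'M_(n.+1 + m)).

Let E_P (s : E) : [/\ ursubmx (incl s : 'M_(n.+1 + m)) = 0,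
  dlsubmx (incl s : 'M_(n.+1 + m)) = 0 & ul s *m D = D *m dr s].
Proof. by apply/block_centralizerP; have /asboolP := centralizerP s. Qed.

Let E_of (a : 'M[R]_n.+1) (b : 'M[R]_m) : a *m D = D *m b ->
  exists s : E, [/\ ul s = a, dr s = b & incl s = block_mx a 0 0 b].
Proof.
move=> aDb; have sP : block_mx a 0 0 b \in in_centralizer complex_structure.
  apply/asboolP/block_centralizerP.
  by rewrite block_mxKur block_mxKdl block_mxKul block_mxKdr.
by exists (CentralizerRing sP); rewrite /ul /dr /= block_mxKul block_mxKdr.
Qed.

Let dE z : d z = mxact D z. Proof. by rewrite mx_ofK. Qed.

Let eps_d z : eps (d z) = 0.
Proof. by have : range d (d z); [exists z|rewrite d_ker]. Qed.

Lemma cokernel_endo_subproof (s : E) :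
  exists f : {linear M -> M}, forall y, f (eps y) = eps (mxact (ul s) y).
Proof.
apply: (linear_factor (h := eps \o mxact (ul s))) => // y y0.
have : range d y by rewrite d_ker.
move=> [z _ <-]; have [_ _ aD] := E_P s.
by rewrite /= -[_ *m _]/(mxact (ul s) (d z)) dE -mxactM aD mxactM -dE eps_d.
Qed.

Definition cokernel_endo (s : E) : endo M :=
  sval (cid (cokernel_endo_subproof s)).

Lemma cokernel_endoE s y : cokernel_endo s (eps y) = eps (mxact (ul s) y).
Proof. exact: svalP (cid (cokernel_endo_subproof s)) y. Qed.

Let endo_eps (f g : endo M) : (forall y, f (eps y) = g (eps y)) -> f = g.
Proof. by move=> fg; apply: endoP => x; have [y <-] := eps_surj x. Qed.

Let ulB s t : ul (s - t) = ul s - ul t.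
Proof. by rewrite /ul rmorphB; apply/matrixP => i j; rewrite !mxE. Qed.

Let ulM s t : ul (s * t) = ul s *m ul t.
Proof.
rewrite /ul rmorphM; have [s0 _ _] := E_P s.
rewrite -[X in ulsubmx X]/(_ *m _).
rewrite -[X in ulsubmx (X *m _)]submxK -[X in ulsubmx (_ *m X)]submxK.
by rewrite s0 mulmx_block block_mxKul mul0mx addr0.
Qed.

Let ul1 : ul 1 = 1%:M.
Proof.
rewrite /ul rmorph1; apply/matrixP => i j.
by rewrite !mxE (inj_eq (@lshift_inj _ _)).
Qed.

Let cokernel_endoB : zmod_morphism cokernel_endo.
Proof.
move=> s t; apply: endo_eps => y.
by rewrite cokernel_endoE ulB mxactD linearB /= -!cokernel_endoE.
Qed.

Let cokernel_endoM : monoid_morphism cokernel_endo.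
Proof.
split=> [|s t]; apply: endo_eps => y; rewrite cokernel_endoE.
  by rewrite ul1 mxact1.
by rewrite ulM mxactM -!cokernel_endoE.
Qed.

HB.instance Definition _ :=
  GRing.isZmodMorphism.Build E (endo M) cokernel_endo cokernel_endoB.
HB.instance Definition _ :=
  GRing.isMonoidMorphism.Build E (endo M) cokernel_endo cokernel_endoM.

(** The diagonal blocks of [s] form the chain map; this gives continuity for both lengths. *)
Lemma B_nbhs_cokernel_endo k (k12 : k = 1%N \/ k = 2%N) (J : set R) (s : E) :
  is_ideal J -> (forall i j, J (incl s i j)) ->
  B_nbhs (free_resolution k12) J (cokernel_endo s).
Proof.
move=> iJ Js; have [_ _ aD] := E_P s.
have Ja : forall x, mul_ideal 'rV[R^c]_n.+1 J (mxact (ul s) x).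
  by apply/mul_ideal_mxact => // i j; rewrite !mxE.
have Jb : forall x, mul_ideal 'rV[R^c]_m J (mxact (dr s) x).
  by apply/mul_ideal_mxact => // i j; rewrite !mxE.
split=> [x|].
  have [y <-] := eps_surj x; rewrite cokernel_endoE.
  exact: mul_ideal_linear.
pose g (i : nat) : {linear Pobj i -> Pobj i} :=
  if i is 0%N then mxact (ul s) else mxact (dr s).
exists g; split; last by case=> [|i] _ x; [exact: Ja|exact: Jb].
split=> [x|[|i] ik x]; first exact: cokernel_endoE.
  change (mxact (ul s) (d x) = d (mxact (dr s) x)).
  by rewrite !dE -!mxactM aD.
by exfalso; clear x; case: k12 ik => ->.
Qed.

(** This yields openness for tau_2. A resolution of length 2 bounds the chain map on both free
    modules, so that it is an element of [E] with all entries in [J]; length 1 would bound only the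
    component on the generators. *)
Lemma B_nbhs_cokernel_endoP (k2 : 2%N = 1%N \/ 2%N = 2%N) (J : set R)
    (f : endo M) : is_ideal J ->
  B_nbhs (free_resolution k2) J f ->
  exists2 s : E, (forall i j, J (incl s i j)) & cokernel_endo s = f.
Proof.
move=> iJ [_ [g [[g0 gS] gJ]]]; have [J0 _ _ _] := iJ.
have aD : mx_of (g 0%N) *m D = D *m mx_of (g 1%N).
  apply: mxact_inj => x; rewrite !mxactM !mx_ofK.
  exact: gS 0%N isT x.
have [s [ulE drE sE]] := E_of aD; exists s.
  have Ja : forall i j, J (mx_of (g 0%N) i j).
    by apply/mul_ideal_mxact => // x; rewrite mx_ofK; exact: gJ 0%N isT x.
  have Jb : forall i j, J (mx_of (g 1%N) i j).
    by apply/mul_ideal_mxact => // x; rewrite mx_ofK; exact: gJ 1%N isT x.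
  move=> i j; rewrite sE mxE.
  case: (fintype.split i) => i'; rewrite mxE; case: (fintype.split j) => j'.
  - exact: Ja.
  - by rewrite mxE.
  - by rewrite mxE.
  - exact: Jb.
apply: endo_eps => y; rewrite cokernel_endoE ulE mx_ofK.
by rewrite g0.
Qed.

(** The case [J = setT], in which any chain map lifting [f] will do. *)
Lemma cokernel_endo_surj f : exists s, cokernel_endo s = f.
Proof.
have [g gf] := chain_map_exists (free_resolution (or_intror (erefl 2%N)))
  (free_resolution (or_intror (erefl 2%N))) f.
have [|s _ sf] := @B_nbhs_cokernel_endoP (or_intror (erefl 2%N)) setT f
  (is_idealT R).
  split=> [x|]; first exact: mul_idealT.
  by exists g; split=> // i _ x; exact: mul_idealT.
by exists s.
Qed.

Section Topology.
Variables (k : nat) (k12 : k = 1%N \/ k = 2%N) (P : proj_resolution M k).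

Lemma open_ideal_B_nbhs J : open_ideal J ->
  open_ideal (B_nbhs P J : set (endo_tau P)).
Proof.
move=> oJ; apply/open_ideal_top; split.
  by apply: (@endo_base_ideal _ _ _ P); exists J.
by exists (B_nbhs P J) => //; exists J.
Qed.

Lemma cokernel_endo_continuous (K : set (endo_tau P)) : open_ideal K ->
  exists2 J : set S, open_ideal J & forall x, J (incl x) -> K (cokernel_endo x).
Proof.
move=> /open_ideal_top[_ [_ [J oJ <-] JK]].
exists [set a : 'M[R]_(n.+1 + m) | forall i j, J (a i j)].
  exact: open_ideal_matrix.
move=> x Jx; apply: JK; rewrite (B_nbhs_indep P (free_resolution k12)).
by apply: B_nbhs_cokernel_endo => //; case: oJ.
Qed.

End Topology.

Lemma cokernel_endo_open (P : proj_resolution M 2) (J : set S) :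
  open_ideal J ->
  open_ideal (cokernel_endo @` (incl @^-1` J) : set (endo_tau P)).
Proof.
move=> oJ; have [[J0 JD Jl Jr] _] := oJ; apply/open_ideal_top; split.
  split.
  - by exists 0; rewrite /= ?rmorph0.
  - move=> _ _ [x Jx <-] [y Jy <-]; exists (x + y); rewrite /= ?rmorphD//.
    exact: JD.
  - move=> a _ [x Jx <-]; have [b <-] := cokernel_endo_surj a.
    exists (b * x); last by rewrite rmorphM.
    by change (J (incl (b * x))); rewrite rmorphM; exact: Jl.
  - move=> _ a [x Jx <-]; have [b <-] := cokernel_endo_surj a.
    exists (x * b); last by rewrite rmorphM.
    by change (J (incl (x * b))); rewrite rmorphM; exact: Jr.
have [I oI IJ] := open_ideal_matrixE oJ.
exists (B_nbhs P I); first by exists I.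
move=> f; rewrite (B_nbhs_indep P (free_resolution (or_intror (erefl 2%N)))).
move=> /B_nbhs_cokernel_endoP[|s Is <-]; first by case: oI.
by exists s => //; exact: IJ.
Qed.

End Presentation.

Lemma hausdorff_std_top (R : ltRingType) (M : lmodType R^c) (x : M) :
  hausdorff_space (std_top M) ->
  (forall J : set R, open_ideal J -> mul_ideal M J x) -> x = 0.
Proof.
move=> hM xJ; apply: (hM x 0) => U V; rewrite nbhsE => -[W [oW Wx] WU] nV.
exists 0; split; last exact: nbhs_singleton.
have [_ [J oJ <-] JW] := oW x Wx; apply: WU; rewrite -(subrr x); apply: JW.
exact: (mul_ideal_linear (\- idfun : {linear M -> M}) (xJ J oJ)).
Qed.

Lemma hausdorff_endo_tau (R : ltRingType) (M : lmodType R^c) k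
    (P : proj_resolution M k) :
  hausdorff_space (std_top M) -> hausdorff_space (endo_tau P).
Proof.
move=> hM; apply/hausdorff_ltP => f fJ; apply: endoP => x.
apply: hausdorff_std_top hM _ => J oJ.
by have [fxJ _] := fJ _ (open_ideal_B_nbhs P oJ); exact: fxJ.
Qed.

Section LtQuotient.
Variables (R : ltRingType) (I : ideal R).
Local Notation proj :=
  (quot_proj I : {rmorphism R -> lt_quot I}).

Lemma open_ideal_quot_preimage (K : set (lt_quot I)) :
  open_ideal K -> open_ideal [set x | K (proj x)].
Proof.
move=> [[K0 KD Kl Kr] oK]; split; last exact: oK.
split=> [|x y Kx Ky|a x Kx|x a Kx] /=.
- by rewrite rmorph0.
- by rewrite rmorphD; exact: KD.
- by rewrite rmorphM; exact: Kl.
- by rewrite rmorphM; exact: Kr.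
Qed.

Lemma open_ideal_quot_image (J : set R) :
  open_ideal J -> open_ideal (proj @` J : set (lt_quot I)).
Proof.
move=> oJ; have iK : is_ideal (proj @` J : set (lt_quot I)).
  by apply: (@lt_quot_base_ideal R I); exists J.
split=> //; have [K0 KD Kl Kr] := iK.
suff [] : open_ideal [set x | (proj @` J) (proj x)] by [].
apply: open_ideal_sup oJ _ _; last by move=> x Jx; exists x.
split=> [|x y Kx Ky|a x Kx|x a Kx] /=.
- by rewrite rmorph0.
- by rewrite rmorphD; exact: KD.
- by rewrite rmorphM; exact: Kl.
- by rewrite rmorphM; exact: Kr.
Qed.

End LtQuotient.

Lemma hausdorff_quot_closure0 (R : ltRingType) :
  hausdorff_space (lt_quot (closure0_ideal R)).
Proof.
apply/hausdorff_ltP => x; have [y <-] := quot_proj_surj x => yK.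
apply/(quot_proj_eq0 (closure0_ideal R))/closure0P => J oJ.
have [z Jz zy] := yK _ (open_ideal_quot_image (closure0_ideal R) oJ).
have /closure0P/(_ J oJ) : Defs.closure0 (z - y).
  apply/(quot_proj_eq0 (closure0_ideal R)); rewrite rmorphB.
  by apply/eqP; rewrite subr_eq0; apply/eqP.
have [[_ JD _ _] _] := oJ; move=> Jzy; rewrite -[y](subKr z).
by apply: JD => //; apply: is_idealN Jzy; case: oJ.
Qed.

Theorem theorem8p3 (R : ltRingType) (M : lmodType R^c)
    (R_hausdorff : hausdorff_space R) (M_fp : finitely_presented M) :
  [/\
    (* (i) *)
    first_countable R ->
      forall Pr : ltRingType -> Prop, P_top Pr -> Morita_preserved Pr -> Pr R ->
      forall P : proj_resolution M 2,
        Pr (lt_quot (closure0_ideal (endo_tau P))) /\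
        (hausdorff_space (std_top M) -> Pr (endo_tau P)),
    (* (ii) *)
    quasi_pi_infty_regular R ->
      (forall i : nat, i = 1%N \/ i = 2%N -> forall P : proj_resolution M i,
        quasi_pi_infty_regular (lt_quot (closure0_ideal (endo_tau P)))) /\
      (hausdorff_space (std_top M) -> forall P : proj_resolution M 1,
        quasi_pi_infty_regular (endo_tau P)) &
    (* (iii) *)
    semiperfect R -> quasi_pi_infty_regular R -> semiperfect (endo M)].
Proof.
have [m [n [d [eps [eps_surj d_ker]]]]] := finitely_presented_pos M_fp.
pose phi : {rmorphism complex_endo d -> endo M} :=
  @cokernel_endo R M m n d eps eps_surj d_ker.
have phi_surj : forall f, exists s, phi s = f by exact: cokernel_endo_surj.
have phi_cent := complex_endo_mx_centralizer d.
pose psi k (P : proj_resolution M k) :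
    {rmorphism complex_endo d -> lt_quot (closure0_ideal (endo_tau P))} :=
  quot_proj (closure0_ideal (endo_tau P)) \o phi.
have quot_surj k (P : proj_resolution M k) :
    forall y : lt_quot (closure0_ideal (endo_tau P)),
    exists s, psi k P s = y.
  move=> y; have [f <-] := quot_proj_surj y; have [s <-] := phi_surj f.
  by exists s.
have quot_cont k (k12 : k = 1%N \/ k = 2%N) (P : proj_resolution M k)
    (K : set (lt_quot (closure0_ideal (endo_tau P)))) : open_ideal K ->
    exists2 J : set (lt_matrix R (n.+1 + m)), open_ideal J & forall x,
      J (complex_endo_mx d x) -> K (psi k P x).
  by move=> /open_ideal_quot_preimage; exact: cokernel_endo_continuous.
split.
- move=> cR Pr PPr /(_ R R_hausdorff) Pr_mor PrR P.
  have cS := first_countable_matrix (n.+1 + m) cR.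
  have PrS : Pr (lt_matrix R (n.+1 + m)).
    by have [PrM _] := Pr_mor PrR; exact: PrM (n + m)%N.
  split=> [|hM].
    apply: (P_top_transfer (f := psi _ P)
      phi_cent _ _ _ _ cS PPr PrS).
    + exact: quot_surj.
    + by move=> K oK; apply: quot_cont oK; right.
    + move=> J oJ.
      have := open_ideal_quot_image (closure0_ideal (endo_tau P))
        (cokernel_endo_open eps_surj d_ker P oJ).
      by rewrite image_comp.
    + exact: hausdorff_quot_closure0.
  apply: (P_top_transfer (f := phi : {rmorphism complex_endo d -> endo_tau P})
      phi_cent _ _ _ _ cS PPr PrS).
  + exact: phi_surj.
  + by move=> K oK; apply: cokernel_endo_continuous oK; right.
  + by move=> J oJ; exact: cokernel_endo_open.
  + exact: hausdorff_endo_tau.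
- move=> qR; have qS : quasi_pi_infty_regular (lt_matrix R (n.+1 + m)).
    exact: lt_matrixM_quasi.
  split=> [k k12 P|hM P].
    apply: (quasi_pi_infty_regular_transfer
      (f := psi _ P) phi_cent _ _ _ qS).
    + exact: quot_surj.
    + by move=> K oK; exact: quot_cont oK.
    + exact: hausdorff_quot_closure0.
  apply: (quasi_pi_infty_regular_transfer
    (f := phi : {rmorphism complex_endo d -> endo_tau P}) phi_cent _ _ _ qS).
  + exact: phi_surj.
  + by move=> K oK; apply: cokernel_endo_continuous oK; left.
  + exact: hausdorff_endo_tau.
- move=> [slR _] qR.
  have qS : quasi_pi_regular (lt_matrix R (n.+1 + m)).
    by apply: quasi_pi_infty_regularW; exact: lt_matrixM_quasi.
  have slS : semilocal (lt_matrix R (n.+1 + m)).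
    (* [R] has Drazin inverses and no infinite orthogonal sets of idempotents, so 1 is a sum of
       local idempotents in [R], hence in the matrix ring. *)
    apply: local_sum_semilocal; apply: local_sum_matrix.
    have /quasi_pi_regularP[/separating_open sepR drR] :=
      quasi_pi_infty_regularW qR.
    apply: no_infinite_idempotents_local_sum sepR drR _.
    exact: semilocal_no_infinite_idempotents.
  (* The conclusion is purely algebraic; a topology on [endo M] is chosen to fit the form of
     [semiperfect_transfer]. *)
  pose P := free_resolution eps_surj d_ker (or_introl (erefl 1%N)).
  exact: (semiperfect_transfer
    (f := phi : {rmorphism complex_endo d -> endo_tau P})
    phi_cent phi_surj qS slS).
Qed.
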